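(* Let $k,p,s \in \omega$. Let $\Gamma$ be the class of (locally finite) $k$-edge-colorable multigraphs with maximum edge multiplicity at most $p$, and let $\Pi$ be the problem of proper $(k+ps)$-edge coloring. Then $(\Pi,\Gamma) \in \textnormal{ASI}_c(s)$.
   Context: All graphs are locally finite. HF denotes the set of hereditarily finite sets. A structured graph is a structure in a finite language extending the language of graphs (one binary adjacency relation, interpreted symmetrically and irreflexively); multigraphs are viewed as structured graphs (extra predicates encoding multiplicities), and edge colorings are encoded as functions $V(G)\to \textnormal{HF}$ in a standard way (each vertex records the colors of its incident edges, consistently at both endpoints). A coloring problem $(\Pi,\Gamma)$ consists of a class $\Gamma$ of structured graphs, closed under isomorphism and such that $G\in\Gamma$ iff every connected component of $G$ is in $\Gamma$, and a class $\Pi$ of functions $V(G)\to\textnormal{HF}$ ($G\in\Gamma$), closed under pushforward by isomorphisms and such that $c\in\Pi$ iff its restriction to each component is in $\Pi$. An ASI-$s$ algorithm is a function $\mathcal{A}$ which, on input $(H,<,U_0,\dots,U_s,C)$ where $H$ is a finite structured graph, $<$ a linear order on $V(H)$, $U_0,\dots,U_s$ a partition of $V(H)$, and $C\subseteq V(H)$, returns a function $C\to\textnormal{HF}$, such that for any isomorphism $\phi:(H,<,U_0,\dots,U_s,C)\to(H',<',U'_0,\dots,U'_s,C')$ we have $\mathcal{A}(H,\dots,C)=\mathcal{A}(H',\dots,C')\circ(\phi\upharpoonright C)$. It is computable if it is computable as a function on (canonical HF codes of) its inputs. For a structured graph $G$ with path metric $\rho_G$ and $r\in\omega$, $G^r$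 is the graph on $V(G)$ joining distinct $x,y$ with $\rho_G(x,y)\le r$. An ASI-$s$ witness for $G$ with scale $r$ is a partition $U_0,\dots,U_s$ of $V(G)$ such that every connected component of each $G^r\upharpoonright U_i$ is finite. Given such a witness and a linear order $<$ on $V(G)$, let $\mathcal{C}$ be the (disjoint) set of all components of all $G^r\upharpoonright U_i$, and $\tilde G$ the graph on $\mathcal{C}$ joining $C\neq D$ when $\rho_G(C,D)\le r$. For $n\in\omega$, $\mathcal{A}_n[(G,<,U_0,\dots,U_s)]$ is the coloring of $V(G)$ that colors each $C\in\mathcal{C}$ by $\mathcal{A}(G\upharpoonright W,<\upharpoonright W,U_0\cap W,\dots,U_s\cap W,C)$, where $W=\bigcup\{D\in\mathcal{C}:\rho_{\tilde G}(C,D)\le n\}$. $\mathcal{A}$ solves $(\Pi,\Gamma)$ in $n$ stages with scale $r$ if for every $G\in\Gamma$, every linear order $<$ on $V(G)$ and every ASI-$s$ witness $U_0,\dots,U_s$ for $G$ with scale $r$, $\mathcal{A}_n[(G,<,U_0,\dots,U_s)]\in\Pi$. $(\Pi,\Gamma)\in\textnormal{ASI}(s)$ if some ASI-$s$ algorithm solves it in some $n$ stages with some scale $r$; $(\Pi,\Gamma)\in\textnormal{ASI}_c(s)$ if moreover the algorithm can be taken computable. *)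

(* Defs.v *)
From mathcomp Require Import all_boot all_classical.

Set Implicit Arguments.
Unset Strict Implicit.
Unset Printing Implicit Defensive.

Local Open Scope classical_set_scope.

(* Hereditarily finite sets, in Ackermann's presentation: (V_omega, \in) is
   isomorphic to nat with "z is an element of x" read as "the z-th binary digit
   of x is 1".  The lemmas below (extensionality, well-foundedness and closure
   under forming finite sets) characterize V_omega up to isomorphism. *)
Definition HF : Type := nat.

Definition hf_mem (z x : HF) : bool := odd (x %/ 2 ^ z).

Definition hset (s : seq HF) : HF := \sum_(x <- undup s) 2 ^ x.

Definition hpair (x y : HF) : HF := hset [:: hset [:: x]; hset [:: x; y]].

Fixpoint hseq (s : seq HF) : HF := if s is x :: s' then hpair x (hseq s') else 0.

Lemma sum_pow2_lt (z : nat) (s : seq nat) :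
  uniq s -> all (fun x => x < z) s -> \sum_(x <- s) 2 ^ x < 2 ^ z.
Proof.
elim: z s => [|z IHz] s us /allP hs.
  by case: s us hs => [|x s] // _ hs; [rewrite big_nil|have:= hs x (mem_head _ _)].
have hz (t : seq nat) : uniq t -> {subset t <= s} -> z \notin t ->
    \sum_(x <- t) 2 ^ x < 2 ^ z.
  move=> ut ts zt; apply: IHz => //; apply/allP => x xt.
  have := hs x (ts _ xt); rewrite ltnS leq_eqVlt => /orP[/eqP xz|//].
  by rewrite -xz xt in zt.
case: (boolP (z \in s)) => zs; last first.
  by apply: leq_trans (hz _ us _ zs) _ => //; rewrite leq_exp2l.
rewrite (perm_big _ (perm_to_rem zs)) big_cons /= expnS mul2n -addnn ltn_add2l.
apply: hz; first exact: rem_uniq.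
  by move=> x /mem_rem.
by rewrite mem_rem_uniq // inE eqxx.
Qed.

Lemma mem_hset (z : HF) (s : seq HF) : hf_mem z (hset s) = (z \in s).
Proof.
rewrite /hf_mem /hset -(mem_undup s); have := undup_uniq s.
move: (undup s) => {}s us.
rewrite (bigID (fun x => x < z)) /=.
set A := \sum_(i <- s | i < z) _; set B := \sum_(i <- s | ~~ _) _.
have ltA : A < 2 ^ z.
  rewrite /A -big_filter; apply: sum_pow2_lt; first exact: filter_uniq.
  by apply/allP => x; rewrite mem_filter => /andP[].
have -> : B = (z \in s) * 2 ^ z + \sum_(i <- s | z < i) 2 ^ i.
  rewrite /B (bigID (fun x => x == z)) /=; congr (_ + _); last first.
    by apply: eq_bigl => x; rewrite -leqNgt ltn_neqAle eq_sym andbC.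
  transitivity (\sum_(i <- s | i == z) 2 ^ i).
    by apply: eq_bigl => x; case: eqP => [->|]; rewrite ?andbF // ltnn.
  case: (boolP (z \in s)) => zs.
    rewrite (perm_big _ (perm_to_rem zs)) big_cons eqxx mul1n.
    rewrite big_seq_cond big1 => [|x /andP[+ /eqP xz]]; first exact: addn0.
    by rewrite mem_rem_uniq // inE xz eqxx.
  rewrite mul0n big_seq_cond big1 // => x /andP[+ /eqP xz].
  by rewrite xz (negPf zs).
have /dvdnP[q ->] : 2 ^ z.+1 %| \sum_(i <- s | z < i) 2 ^ i.
  by apply: dvdn_sum => i zi; rewrite dvdn_exp2l.
have e : A + ((z \in s) * 2 ^ z + q * 2 ^ z.+1) = ((z \in s) + q.*2) * 2 ^ z + A.
  by rewrite addnC; congr (_ + _); rewrite mulnDl expnS mulnA muln2.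
by rewrite e divnMDl ?expn_gt0 // divn_small // addn0 oddD odd_double addbF oddb.
Qed.

Lemma hf_mem_lt (z x : HF) : hf_mem z x -> z < x.
Proof.
rewrite /hf_mem => h; apply: leq_trans (ltn_expl z (isT : 1 < 2)) _.
by rewrite leqNgt; apply/negP => lt; rewrite divn_small in h.
Qed.

Lemma hf_ext (x y : HF) : (forall z, hf_mem z x = hf_mem z y) -> x = y.
Proof.
have e (n : nat) : (n %/ 2).*2 + odd n = n.
  by rewrite divn2 addnC odd_double_half.
have [n] := ubnP x; elim: n x y => // n IH x y xn xy.
have oxy : odd x = odd y by have := xy 0; rewrite /hf_mem !divn1.
have s (t : HF) z : hf_mem z (t %/ 2) = hf_mem z.+1 t.
  by rewrite /hf_mem -divnMA -expnS.
case: (posnP x) => [x0|x0]; last first.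
  rewrite -(e x) -(e y) oxy; congr (_.*2 + _); apply: IH.
    by apply: leq_trans (ltn_Pdiv _ x0) _.
  by move=> z; rewrite !s xy.
subst x; apply/eqP; rewrite eq_sym; apply/negPn/negP; rewrite -lt0n => y0.
have /andP[le lt] : 2 ^ trunc_log 2 y <= y < 2 ^ (trunc_log 2 y).+1.
  exact: trunc_log_bounds.
have := xy (trunc_log 2 y); rewrite /hf_mem div0n /=.
suff -> : y %/ 2 ^ trunc_log 2 y = 1 by [].
apply/eqP; rewrite eqn_leq divn_gt0 ?expn_gt0 // le andbT -ltnS.
by rewrite ltn_divLR ?expn_gt0 // -expnS.
Qed.

(* The total computable functions nat^n -> nat: the least class containing the
   basic functions and closed under composition, primitive recursion and
   minimization of regular functions. *)
Inductive recursive : forall n : nat, (n.-tuple nat -> nat) -> Prop :=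
| rec_zero n : recursive (fun _ : n.-tuple nat => 0)
| rec_succ : recursive (fun t : 1.-tuple nat => (thead t).+1)
| rec_proj n (i : 'I_n) : recursive (fun t : n.-tuple nat => tnth t i)
| rec_comp m n (g : m.-tuple nat -> nat) (h : 'I_m -> n.-tuple nat -> nat) :
    recursive g -> (forall i, recursive (h i)) ->
    recursive (fun t : n.-tuple nat => g [tuple h i t | i < m])
| rec_prim n (g : n.-tuple nat -> nat) (h : n.+2.-tuple nat -> nat) :
    recursive g -> recursive h ->
    recursive (fun t : n.+1.-tuple nat =>
      iteri (thead t) (fun i a => h [tuple of i :: a :: behead_tuple t])
        (g (behead_tuple t)))
| rec_mu n (g : n.+1.-tuple nat -> nat) (f : n.-tuple nat -> nat) :
    recursive g ->
    (forall t, g [tuple of f t :: t] = 0) ->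
    (forall t y, y < f t -> g [tuple of y :: t] <> 0) ->
    recursive f.

Section Relations.
Variable T : Type.
Implicit Types (e : rel T) (A : set T).

(* dist_le e n x y: the path metric of e satisfies rho(x, y) <= n. *)
Definition dist_le e (n : nat) (x y : T) : Prop :=
  exists p : seq T, [/\ size p <= n, path e x p & last x p = y].

Definition restrict_rel e A : rel T :=
  fun x y => [&& x \in A, y \in A & e x y].

Definition component e A (x : T) : set T :=
  [set y | exists n, dist_le (restrict_rel e A) n x y].

(* The vertex sets of the connected components of the graph e induced on A. *)
Definition components e A : set (set T) := component e A @` A.

Lemma dist_le_sym e n x y : symmetric e -> dist_le e n x y -> dist_le e n y x.
Proof.
move=> sym [p [sp pp <-]]; exists (rev (belast x p)); split.
- by rewrite size_rev size_belast.
- rewrite rev_path (eq_path (e' := e)) // => a b; exact: sym.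
- by case: p {sp pp} => //= c p; rewrite rev_cons last_rcons.
Qed.

Lemma dist_le_trans e m n y x z :
  dist_le e m x y -> dist_le e n y z -> dist_le e (m + n) x z.
Proof.
move=> [p [sp pp <-]] [q [sq pq <-]]; exists (p ++ q); split.
- by rewrite size_cat leq_add.
- by rewrite cat_path pp.
- by rewrite last_cat.
Qed.

Lemma component_eq e A x y :
  symmetric e -> component e A x y -> component e A x = component e A y.
Proof.
move=> sym [n xy]; have sym' : symmetric (restrict_rel e A).
  by move=> a b; rewrite /restrict_rel andbCA sym.
apply/seteqP; split => z [m zm].
  by exists (n + m); apply: dist_le_trans zm; exact: dist_le_sym.
by exists (n + m); apply: dist_le_trans zm.
Qed.

Lemma component_sub e A x y : A x -> component e A x y -> A y.
Proof.
move=> Ax [n [p [_ + <-]]]; case/lastP: p => [//|p z].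
by rewrite rcons_path last_rcons => /andP[_ /and3P[_ /set_mem]].
Qed.

Definition strict_linear_order (lt : rel T) : Prop :=
  [/\ irreflexive lt, transitive lt & forall x y, x <> y -> lt x y \/ lt y x].

End Relations.

(* A finite relational language; the adjacency symbol is not listed. *)
Record language := Language { rsym : finType; arity : rsym -> nat }.

Record sgraph (L : language) := SGraph {
  vert :> Type;
  adj : rel vert;
  interp : forall R : rsym L, (arity R).-tuple vert -> bool;
  adj_sym : symmetric adj;
  adj_irr : irreflexive adj;
  adj_fin : forall x, finite_set [set y | adj x y] }.

Section StructuredGraphs.
Variable L : language.
Implicit Types G H : sgraph L.

Section Induced.
Variables (G : sgraph L) (W : set G).

Definition induced_adj : rel W := fun x y => adj (val x) (val y).

Definition induced_interp (R : rsym L) (t : (arity R).-tuple W) : bool :=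
  interp (map_tuple val t).

Lemma induced_adj_sym : symmetric induced_adj.
Proof. by move=> x y; apply: adj_sym. Qed.

Lemma induced_adj_irr : irreflexive induced_adj.
Proof. by move=> x; apply: adj_irr. Qed.

Lemma induced_adj_fin (x : W) : finite_set [set y | induced_adj x y].
Proof.
apply: (@finite_preimage _ _ [set y | adj (val x) y] val); last exact: adj_fin.
by move=> y z _ _; apply: val_inj.
Qed.

Definition induced : sgraph L :=
  SGraph induced_interp induced_adj_sym induced_adj_irr induced_adj_fin.

End Induced.

Definition sg_iso G H (f : G -> H) : Prop :=
  [/\ bijective f,
      forall x y, adj (f x) (f y) = adj x y &
      forall (R : rsym L) (t : (arity R).-tuple G),
        interp (map_tuple f t) = interp t].

(* cp_col G c is only meaningful for G in the class cp_graph. *)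
Record coloring_problem := ColoringProblem {
  cp_graph : sgraph L -> Prop;
  cp_col : forall G : sgraph L, (G -> HF) -> Prop;
  cp_graph_iso : forall G H (f : G -> H),
    sg_iso f -> cp_graph G -> cp_graph H;
  cp_graph_components : forall G,
    cp_graph G <->
    (forall K, components (@adj L G) setT K -> cp_graph (induced K));
  cp_col_iso : forall G H (f : G -> H) (c : G -> HF) (d : H -> HF),
    cp_graph G -> sg_iso f -> (forall x, d (f x) = c x) ->
    cp_col c -> cp_col d;
  cp_col_components : forall G (c : G -> HF),
    cp_graph G ->
    (cp_col c <->
     (forall K, components (@adj L G) setT K ->
        @cp_col (induced K) (fun x => c (val x)))) }.

(* An input (H, <, U_0, .., U_s, C); the partition is given by the function
   sending a vertex to the index of its class, so classes may be empty. *)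
Record asi_input (s : nat) := AsiInput {
  in_graph : sgraph L;
  in_lt : rel in_graph;
  in_cell : in_graph -> 'I_s.+1;
  in_set : set in_graph;
  in_fin : finite_set [set: in_graph];
  in_lt_linear : strict_linear_order in_lt }.

Arguments in_set {s} _ _.

Definition input_iso s (I J : asi_input s) (f : in_graph I -> in_graph J) :=
  [/\ sg_iso f,
      forall x y, in_lt (f x) (f y) = in_lt x y,
      forall x, in_cell (f x) = in_cell x &
      forall x, in_set J (f x) <-> in_set I x].

Record asi_algorithm (s : nat) := AsiAlgorithm {
  asi_run :> forall I : asi_input s, in_set I -> HF;
  asi_run_iso : forall (I J : asi_input s) (f : in_graph I -> in_graph J),
    input_iso f ->
    forall (x : in_graph I) (Cx : x \in in_set I) (Cfx : f x \in in_set J),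
      @asi_run I (SigSub Cx) = @asi_run J (SigSub Cfx) }.

Section Stages.
Variables (G : sgraph L) (s r : nat) (cell : G -> 'I_s.+1).

Definition power_graph : rel G :=
  fun x y => `[< x <> y /\ dist_le (@adj L G) r x y >].

Definition pieces : set (set G) :=
  \bigcup_(i in [set: 'I_s.+1]) components power_graph (cell @^-1` [set i]).

Definition asi_witness : Prop := forall K, pieces K -> finite_set K.

Definition piece_adj : rel (set G) :=
  fun K D => `[< [/\ pieces K, pieces D, K <> D &
    exists x y, [/\ K x, D y & dist_le (@adj L G) r x y]] >].

Definition window (n : nat) (K : set G) : set G :=
  \bigcup_(D in [set D | pieces D /\ dist_le piece_adj n K D]) D.

Definition piece_of (v : G) : set G :=
  component power_graph (cell @^-1` [set cell v]) v.

Lemma piece_of_mem v : piece_of v v.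
Proof. by exists 0, [::]. Qed.

Lemma piece_of_pieces v : pieces (piece_of v).
Proof. by exists (cell v) => //; exists v. Qed.

Lemma pieces_piece_of K x : pieces K -> K x -> K = piece_of x.
Proof.
move=> [i _ [a ai <-]] ax; have xi : cell x = i := component_sub ai ax.
rewrite /piece_of xi; apply: component_eq ax => u w.
by apply/asboolP/asboolP => -[ne d]; split;
  [exact: nesym|apply: dist_le_sym d; exact: adj_sym|
   exact: nesym|apply: dist_le_sym d; exact: adj_sym].
Qed.

Lemma window_self n v : window n (piece_of v) v.
Proof.
exists (piece_of v); last exact: piece_of_mem.
by split; [exact: piece_of_pieces|exists [::]].
Qed.

Lemma ball_finite n (x : G) : finite_set [set y | dist_le (@adj L G) n x y].
Proof.
elim: n x => [|n IHn] x.
  apply: sub_finite_set (finite_set1 x) => y [[|? ?] [//= _ _ <-]].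
have fin : finite_set (\bigcup_(z in [set z | adj x z])
    [set y | dist_le (@adj L G) n z y]).
  by apply: bigcup_finite; [exact: adj_fin|move=> z _; exact: IHn].
apply: (@sub_finite_set _ _ ([set x] `|` \bigcup_(z in [set z | adj x z])
    [set y | dist_le (@adj L G) n z y])).
  move=> y [[|z p] [/= sp pp lp]]; first by left.
  by right; case/andP: pp => xz pp; exists z => //; exists p.
by rewrite finite_setU; split => //; exact: finite_set1.
Qed.

Lemma window_finite n K : asi_witness -> finite_set (window n K).
Proof.
move=> fin.
suff {K} fd : forall K, finite_set [set D | pieces D /\ dist_le piece_adj n K D].
  by apply: bigcup_finite => // D [/fin].
elim: n => [|n IHn] K.
  by apply: sub_finite_set (finite_set1 K) => D [_ [[|? ?] [//= _ _ <-]]].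
have finN : finite_set [set D | piece_adj K D].
  have [KP|nK] := pselect (pieces K); last first.
    by apply: sub_finite_set (finite_set0 _) => D /asboolP[].
  have finB : finite_set (\bigcup_(x in K) [set y | dist_le (@adj L G) r x y]).
    by apply: bigcup_finite; [exact: fin|move=> x _; exact: ball_finite].
  apply: sub_finite_set (finite_image piece_of finB) => D /asboolP.
  move=> [_ DP _ [x [y [Kx Dy xy]]]]; exists y; first by exists x.
  by rewrite -(pieces_piece_of DP Dy).
have finU : finite_set (\bigcup_(E in [set E | piece_adj K E])
    [set D | pieces D /\ dist_le piece_adj n E D]).
  by apply: bigcup_finite => // E _; exact: IHn.
apply: (@sub_finite_set _ _ ([set K] `|` \bigcup_(E in [set E | piece_adj K E])
    [set D | pieces D /\ dist_le piece_adj n E D])).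
  move=> D [DP [[|E p] [/= sp pp lp]]]; first by left.
  right; case/andP: pp => KE pp; exists E => //; split => //.
  by exists p.
by rewrite finite_setU; split => //; exact: finite_set1.
Qed.

Variables (lt : rel G) (lt_lin : strict_linear_order lt) (wit : asi_witness).

Lemma window_typeT_finite n K :
  finite_set [set: induced (window n K)].
Proof.
apply: sub_finite_set (finite_preimage (f := val) _ (window_finite n K wit)).
  by move=> x _; exact: set_valP.
by move=> x y _ _; exact: val_inj.
Qed.

Lemma restrict_linear (W : set G) :
  strict_linear_order (fun x y : induced W => lt (val x) (val y)).
Proof.
have [irr tr tot] := lt_lin; split => [x|y x z|x y xy].
- exact: irr.
- exact: tr.
- by apply: tot => /val_inj.
Qed.

Definition stage_input (n : nat) (K : set G) : asi_input s :=
  @AsiInput s (induced (window n K))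
    (fun x y => lt (val x) (val y))
    (fun x => cell (val x))
    [set x | K (val x)]
    (window_typeT_finite n K)
    (restrict_linear (window n K)).

Definition stage_vertex (n : nat) (v : G) :
    in_graph (stage_input n (piece_of v)) :=
  SigSub (mem_set (window_self n v)).

Lemma stage_vertex_in n v :
  in_set (stage_input n (piece_of v)) (stage_vertex n v).
Proof. exact: piece_of_mem. Qed.

Definition stage_coloring (A : asi_algorithm s) (n : nat) (v : G) : HF :=
  A (stage_input n (piece_of v)) (SigSub (mem_set (stage_vertex_in n v))).

End Stages.

Definition solves (P : coloring_problem) (s : nat) (A : asi_algorithm s)
    (n r : nat) : Prop :=
  forall (G : sgraph L), cp_graph P G ->
  forall (lt : rel G) (lt_lin : strict_linear_order lt)
         (cell : G -> 'I_s.+1) (wit : asi_witness r cell),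
    cp_col P (stage_coloring lt_lin wit A n).

Section Codes.
Variables (s : nat) (I : asi_input s) (n : nat) (v : 'I_n -> in_graph I).

(* v is the increasing enumeration of the vertices. *)
Definition increasing_enum : Prop :=
  bijective v /\ forall i j : 'I_n, in_lt (v i) (v j) = (i < j).

Definition code_tuples (k : nat) (P : k.-tuple (in_graph I) -> bool) : HF :=
  hset [seq hseq [seq (nat_of_ord i : HF) | i <- t]
       | t : k.-tuple 'I_n <- enum {: k.-tuple 'I_n} & P (map_tuple v t)].

Definition code_pairs (e : rel (in_graph I)) : HF :=
  hset [seq hpair (ij.1 : 'I_n) (ij.2 : 'I_n)
       | ij <- enum {: 'I_n * 'I_n} & e (v ij.1) (v ij.2)].

Definition code_subset (A : set (in_graph I)) : HF :=
  hset [seq (nat_of_ord i : HF) | i <- enum 'I_n & v i \in A].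

(* The copy of the input with vertex set {0, .., n-1} and its usual order, as
   a single hereditarily finite set. *)
Definition code_input : HF :=
  hseq ([:: code_subset setT; code_pairs (@adj L (in_graph I));
            code_pairs (@in_lt s I)]
        ++ [seq code_tuples (@interp L (in_graph I) R) | R <- enum (rsym L)]
        ++ [seq code_subset (@in_cell s I @^-1` [set a]) | a <- enum 'I_s.+1]
        ++ [:: code_subset (in_set I)]).

(* h is the graph of c, seen as a function on a subset of {0, .., n-1}. *)
Definition codes_output (c : in_set I -> HF) (h : HF) : Prop :=
  forall z, hf_mem z h <->
    exists (i : 'I_n) (Ci : v i \in in_set I), z = hpair i (c (SigSub Ci)).

End Codes.

Definition computable_algorithm (s : nat) (A : asi_algorithm s) : Prop :=
  exists f : 1.-tuple nat -> nat, recursive f /\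
    forall (I : asi_input s) (n : nat) (v : 'I_n -> in_graph I),
      increasing_enum v -> codes_output v (@asi_run s A I) (f [tuple code_input v]).

Definition ASI_c (s : nat) (P : coloring_problem) : Prop :=
  exists A : asi_algorithm s, computable_algorithm A /\
    exists n r : nat, solves P A n r.

End StructuredGraphs.

(* Multigraphs of maximum multiplicity at most p: besides adjacency there are
   binary predicates M_1, .., M_p, the symbol j standing for M_(j+1). *)
Definition mg_language (p : nat) : language := Language (fun _ : 'I_p => 2).

(* G encodes the loopless multigraph with m x y parallel edges between x and y.
   The predicates are read on adjacent pairs only: a value on a pair in two
   different components would not be seen by the components. *)
Definition encodes_multigraph p (G : sgraph (mg_language p)) (m : G -> G -> nat) :=
  [/\ forall x y, m x y = m y x,
      forall x y, m x y <= p,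
      forall x y, adj x y = (0 < m x y) &
      forall (x y : G) (j : 'I_p), adj x y ->
        @interp _ G (j : rsym (mg_language p)) [tuple x; y] = (m x y == j.+1)].

(* phi x y i is the color of the i-th of the m x y edges between x and y. *)
Definition proper_edge_coloring (V : Type) (m : V -> V -> nat) (q : nat)
    (phi : V -> V -> nat -> nat) : Prop :=
  [/\ forall x y i, i < m x y -> phi x y i = phi y x i,
      forall x y i, i < m x y -> phi x y i < q &
      forall x y z i j, i < m x y -> j < m x z ->
        phi x y i = phi x z j -> y = z /\ i = j].

Definition edge_colorable (V : Type) (m : V -> V -> nat) (q : nat) : Prop :=
  exists phi, proper_edge_coloring m q phi.

(* Each vertex carries a label, distinct neighbors of a vertex having distinct
   labels, and the set of pairs (label of y, color) over its incident edges,
   y being the other endpoint.  The labels only serve to tell which neighbor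
   an edge leads to. *)
Definition codes_edge_coloring (V : Type) (m : V -> V -> nat)
    (phi : V -> V -> nat -> nat) (c : V -> HF) : Prop :=
  exists label : V -> HF,
    (forall x y z, 0 < m x y -> 0 < m x z -> label y = label z -> y = z) /\
    forall x, exists E : HF, c x = hpair (label x) E /\
      forall h, hf_mem h E <->
        exists y i, i < m x y /\ h = hpair (label y) (phi x y i).

Section EdgeColoringProblem.
Variables (k p q : nat).
Let L := mg_language p.
Implicit Types G H : sgraph L.

Definition mg_graph G : Prop :=
  exists m : G -> G -> nat, encodes_multigraph m /\ edge_colorable m k.

Definition mg_col G (c : G -> HF) : Prop :=
  exists (m : G -> G -> nat) (phi : G -> G -> nat -> nat),
    [/\ encodes_multigraph m, proper_edge_coloring m q phi &
        codes_edge_coloring m phi c].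

Lemma encodes_iso G H (f : G -> H) (g : H -> G) m :
  sg_iso f -> cancel g f -> encodes_multigraph m ->
  encodes_multigraph (fun x y => m (g x) (g y)).
Proof.
move=> [_ fa fr] gf [ms mp ma mi]; split => [x y|x y|x y|x y j xy].
- exact: ms.
- exact: mp.
- by rewrite -ma -fa !gf.
- have xy' : adj (g x) (g y) by rewrite -fa !gf.
  rewrite -(mi _ _ _ xy') -(fr j); congr interp; apply: val_inj => /=.
  by rewrite !gf.
Qed.

Lemma proper_iso (V V' : Type) (g : V' -> V) r m phi :
  injective g -> proper_edge_coloring m r phi ->
  proper_edge_coloring (fun x y => m (g x) (g y)) r
    (fun x y => phi (g x) (g y)).
Proof.
move=> gi [ps pr pp]; split => [x y i|x y i|x y z i j iy jz e].
- exact: ps.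
- exact: pr.
- by have [/gi] := pp _ _ _ _ _ iy jz e.
Qed.

Lemma mg_graph_iso G H (f : G -> H) : sg_iso f -> mg_graph G -> mg_graph H.
Proof.
move=> isof [m [em [phi pphi]]]; have [[g fg gf] _ _] := isof.
exists (fun x y => m (g x) (g y)); split; first exact: encodes_iso isof gf em.
exists (fun x y => phi (g x) (g y)); apply: proper_iso pphi.
exact: can_inj gf.
Qed.

Lemma mg_col_iso G H (f : G -> H) (c : G -> HF) (d : H -> HF) :
  mg_graph G -> sg_iso f -> (forall x, d (f x) = c x) -> mg_col c -> mg_col d.
Proof.
move=> _ isof dc [m [phi [em pphi [l [linj lc]]]]].
have [[g fg gf] _ _] := isof.
exists (fun x y => m (g x) (g y)), (fun x y => phi (g x) (g y)); split.
- exact: encodes_iso isof gf em.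
- apply: proper_iso pphi; exact: can_inj gf.
- exists (fun x => l (g x)); split.
    by move=> x y z xy xz e; apply: (can_inj gf); exact: linj xy xz e.
  move=> x; have [E [cE hE]] := lc (g x); exists E.
  split; first by rewrite -cE -dc gf.
  move=> h; rewrite hE; split => -[y [i [iy ->]]].
    by exists (f y), i; rewrite fg.
  by exists (g y), i.
Qed.

Lemma encodes_induced G (K : set G) m :
  encodes_multigraph m ->
  @encodes_multigraph p (induced K) (fun x y => m (val x) (val y)).
Proof.
move=> [ms mp ma mi]; split => [x y|x y|x y|x y j xy].
- exact: ms.
- exact: mp.
- exact: ma.
- by rewrite -(mi _ _ _ xy) /= /induced_interp; congr interp; apply: val_inj.
Qed.

Lemma glue G (X : Type) (x0 : X) (F : forall K : set G, K -> K -> X) :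
  exists g : G -> G -> X, forall K, components (@adj L G) setT K ->
    forall a b : K, g (val a) (val b) = F K a b.
Proof.
have refl a : component (@adj L G) setT a a by exists 0, [::].
exists (fun a b => if pselect (component (@adj L G) setT a b) is left h
  then F _ (SigSub (mem_set (refl a))) (SigSub (mem_set h)) else x0).
move=> K [x _ Kx] [a aK] [b bK] /=.
have E : K = component (@adj L G) setT a.
  by rewrite -Kx; apply: component_eq; [exact: adj_sym|rewrite Kx; exact: set_mem aK].
move: aK bK; rewrite {}E => {x Kx K} aK bK.
case: pselect => [h|[]]; last exact: set_mem bK.
by congr (F _ _ _); apply: val_inj.
Qed.

Lemma component_nbr G (x : G) :
  exists (K : set G) (a : K), [/\ components (@adj L G) setT K, val a = x &
    forall y, adj x y -> exists b : K, val b = y].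
Proof.
have xx : component (@adj L G) setT x x by exists 0, [::].
exists (component (@adj L G) setT x), (SigSub (mem_set xx)); split => //.
  by exists x.
move=> y xy; have xy' : component (@adj L G) setT x y.
  by exists 1, [:: y]; rewrite /= /restrict_rel !in_setT xy.
by exists (SigSub (mem_set xy')).
Qed.

Lemma glue_encodes G (mK : forall K : set G, K -> K -> nat) :
  (forall K, components (@adj L G) setT K ->
     @encodes_multigraph p (induced K) (mK K)) ->
  exists m : G -> G -> nat, encodes_multigraph m /\
    forall K, components (@adj L G) setT K ->
      forall a b : K, m (val a) (val b) = mK K a b.
Proof.
move=> emK; have [g gE] := glue 0 mK.
pose m (x y : G) := if adj x y then g x y else 0.
have mE K : components (@adj L G) setT K ->
    forall a b : K, m (val a) (val b) = mK K a b.
  move=> cK a b; have [_ _ ma _] := emK K cK; have := ma a b.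
  rewrite /m /= /induced_adj gE //; case: adj => //.
  by case: (mK K a b).
have adjP (x y : G) : adj x y -> exists (K : set G) (a b : K),
    [/\ components (@adj L G) setT K, val a = x & val b = y].
  have [K [a [cK ax nb]]] := component_nbr x.
  by move=> /nb[b yb]; exists K, a, b.
exists m; split => //; split => [x y|x y|x y|x y j xy].
- case: (boolP (adj x y)) => xy; last first.
    by rewrite /m (adj_sym y x) (negPf xy).
  have [K [a [b [cK <- <-]]]] := adjP _ _ xy.
  by rewrite !mE //; case: (emK K cK).
- case: (boolP (adj x y)) => xy; last by rewrite /m (negPf xy).
  have [K [a [b [cK <- <-]]]] := adjP _ _ xy.
  by rewrite !mE //; case: (emK K cK).
- case: (boolP (adj x y)) => xy; last by rewrite /m (negPf xy).
  have [K [a [b [cK ax yb]]]] := adjP _ _ xy.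
  rewrite -xy -ax -yb mE //; have [_ _ ma _] := emK K cK; exact: ma.
- have [K [a [b [cK ax yb]]]] := adjP _ _ xy.
  subst x y; rewrite mE //; have [_ _ _ mi] := emK K cK.
  by rewrite -(mi a b j xy) /= /induced_interp; congr interp; apply: val_inj.
Qed.

Lemma glue_proper G r (mK : forall K : set G, K -> K -> nat)
    (phiK : forall K : set G, K -> K -> nat -> nat) (m : G -> G -> nat) :
  encodes_multigraph m ->
  (forall K, components (@adj L G) setT K ->
     forall a b : K, m (val a) (val b) = mK K a b) ->
  (forall K, components (@adj L G) setT K ->
     proper_edge_coloring (mK K) r (phiK K)) ->
  exists phi : G -> G -> nat -> nat, proper_edge_coloring m r phi /\
    forall K, components (@adj L G) setT K ->
      forall a b : K, phi (val a) (val b) = phiK K a b.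
Proof.
move=> [_ _ ma _] mE pK; have [phi phiE] := glue (fun=> 0) phiK.
have adjm (x y : G) i : i < m x y -> adj x y.
  by move=> im; rewrite ma; exact: leq_ltn_trans im.
exists phi; split => //; split => [x y i iy|x y i iy|x y z i j iy jz].
- have [K [a [cK ax nb]]] := component_nbr x; have [b yb] := nb _ (adjm _ _ _ iy).
  subst x y; rewrite !phiE //; have [h _ _] := pK K cK.
  by apply: h; rewrite -mE.
- have [K [a [cK ax nb]]] := component_nbr x; have [b yb] := nb _ (adjm _ _ _ iy).
  subst x y; rewrite !phiE //; have [_ h _] := pK K cK.
  by apply: h; rewrite -mE.
- have [K [a [cK ax nb]]] := component_nbr x; have [b yb] := nb _ (adjm _ _ _ iy).
  have [d zd] := nb _ (adjm _ _ _ jz).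
  subst x y z; rewrite !phiE // => e; have [_ _ h] := pK K cK.
  by have [||-> ->] := h a b d i j _ _ e; rewrite -?mE.
Qed.

Lemma mg_graph_components G :
  mg_graph G <->
  (forall K, components (@adj L G) setT K -> mg_graph (induced K)).
Proof.
split => [[m [em [phi pphi]]] K cK|H].
  exists (fun x y => m (val x) (val y)); split; first exact: encodes_induced.
  exists (fun x y => phi (val x) (val y)); apply: proper_iso pphi.
  exact: val_inj.
have /all_sig[mK mKP] : forall K : set G, {m : K -> K -> nat |
    components (@adj L G) setT K ->
    @encodes_multigraph p (induced K) m /\ edge_colorable m k}.
  move=> K; apply: cid; have [cK|nK] := pselect (components (@adj L G) setT K).
    by have [m mP] := H K cK; exists m.
  by exists (fun _ _ => 0).
have [m [em mE]] := glue_encodes (fun K cK => (mKP K cK).1).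
have /all_sig[phiK pK] : forall K : set G, {phi : K -> K -> nat -> nat |
    components (@adj L G) setT K -> proper_edge_coloring (mK K) k phi}.
  move=> K; apply: cid; have [cK|nK] := pselect (components (@adj L G) setT K).
    by have [_ [phi ?]] := mKP K cK; exists phi.
  by exists (fun _ _ _ => 0).
exists m; split => //; have [phi [pphi _]] := glue_proper em mE pK.
by exists phi.
Qed.

Lemma mg_col_components G (c : G -> HF) :
  mg_graph G ->
  (mg_col c <->
   (forall K, components (@adj L G) setT K ->
      @mg_col (induced K) (fun x => c (val x)))).
Proof.
move=> _; split => [[m [phi [em pphi [l [linj lc]]]]] K cK|H].
  exists (fun x y => m (val x) (val y)), (fun x y => phi (val x) (val y)); split.
  - exact: encodes_induced.
  - apply: proper_iso pphi; exact: val_inj.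
  - exists (fun x => l (val x)); split.
      by move=> x y z xy xz e; apply: val_inj; exact: linj xy xz e.
    move=> x; have [E [cE hE]] := lc (val x); exists E; split => // h.
    rewrite hE; split => -[y [i [iy ->]]]; last by exists (val y), i.
    have [_ _ ma _] := em.
    have xy : adj (val x) y by rewrite ma; exact: leq_ltn_trans iy.
    have Ky : K y.
      case: cK x xy {iy cE hE} => u _ Ku x xy; rewrite -Ku.
      have ux : component (@adj L G) setT u (val x) by rewrite Ku; exact: set_valP.
      rewrite (component_eq (@adj_sym _ G) ux); exists 1, [:: y].
      by rewrite /= /restrict_rel !in_setT xy.
    by exists (SigSub (mem_set Ky)), i.
have /all_sig[D DP] : forall K : set G,
    {D : (K -> K -> nat) * (K -> K -> nat -> nat) * (K -> HF) |
     components (@adj L G) setT K ->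
     [/\ @encodes_multigraph p (induced K) D.1.1,
         proper_edge_coloring D.1.1 q D.1.2,
         forall x y z, 0 < D.1.1 x y -> 0 < D.1.1 x z -> D.2 y = D.2 z -> y = z &
         forall x : K, exists E : HF, c (val x) = hpair (D.2 x) E /\
           forall h, hf_mem h E <->
             exists y i, i < D.1.1 x y /\ h = hpair (D.2 y) (D.1.2 x y i)]}.
  move=> K; apply: cid; have [cK|nK] := pselect (components (@adj L G) setT K).
    by have [m [phi [em pphi [l [? ?]]]]] := H K cK; exists (m, phi, l).
  by exists (fun _ _ => 0, fun _ _ _ => 0, fun=> 0).
have emK K : components (@adj L G) setT K ->
    @encodes_multigraph p (induced K) (D K).1.1 by move=> /DP[].
have pK K : components (@adj L G) setT K ->
    proper_edge_coloring (D K).1.1 q (D K).1.2 by move=> /DP[].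
have [m [em mE]] := glue_encodes emK.
have [phi [pphi phiE]] := glue_proper em mE pK.
have [g gE] := glue 0 (fun K (a _ : K) => (D K).2 a).
have [_ _ ma _] := em.
have adjm (x y : G) i : i < m x y -> adj x y.
  by move=> im; rewrite ma; exact: leq_ltn_trans im.
exists m, phi; split => //; exists (fun x => g x x); split.
  move=> x y z xy xz; have [K [a [cK ax nb]]] := component_nbr x.
  have [b yb] := nb _ (adjm _ _ _ xy); have [d zd] := nb _ (adjm _ _ _ xz).
  subst x y z; rewrite !gE // => e; congr val; have [_ _ h _] := DP K cK.
  by apply: (h a) => //; rewrite -mE.
move=> x; have [K [a [cK ax nb]]] := component_nbr x.
have [_ _ _ /(_ a)[E [cE hE]]] := DP K cK; exists E.
subst x; rewrite gE //; split => // h; rewrite hE; split => -[y [i [iy ->]]].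
  by exists (val y), i; rewrite gE // phiE // mE.
have [b yb] := nb _ (adjm _ _ _ iy); subst y.
by exists b, i; rewrite gE // phiE // -mE.
Qed.

Definition edge_coloring_problem : coloring_problem L :=
  ColoringProblem mg_graph_iso mg_graph_components mg_col_iso mg_col_components.

End EdgeColoringProblem.

(* Main.v *)
Require Import Defs.
From mathcomp Require Import perm all_boot all_classical.

Set Implicit Arguments.
Unset Strict Implicit.
Unset Printing Implicit Defensive.

(** The cells are treated one after the other.  After the cells [U_0, .., U_(i-1)] there is a
   proper coloring with [k + p * (i - 1)] colors of all edges near these cells.  The subgraph of
   vertices near [U_i] has finite components, and each of them is colored with [p] more colors,
   keeping the old colors except in a layer of bounded width; a canonical choice is the least
   code of such a coloring, vertices being named by their rank in the component.

   That the old coloring extends is shown by peeling off its colors one at a time.  A maximal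
   matching extends one color class near the part to be kept; the vertices it misses are
   independent, so Vizing fans centered first at covered and then at missed vertices color
   the remaining edges with one color less.

   A component near a cell stays near a single piece, so every color is determined by a bounded
   number of neighboring pieces and the windows of two adjacent vertices agree on the color of
   the edge.  Labels that tell neighbors apart are the pairs (cell, rank in the component of the
   vertices within distance 1 of that cell). *)

(** * Vizing's theorem with a prescribed part *)

(** Applied directly to the prescribed coloring, Vizing's argument fails: its Kempe exchanges may
    run through the part to be kept. This is why colors are peeled off. Each kept color class is
    frozen as a matching and removed; the exchanges may then recolor everything else, since only the
    matchings enter the final coloring of the kept part. Once all old colors are frozen, the kept
    part has no edges left.

    The fan count asks for [p] spare colors at the leaves only; the center may have as many edges as
    there are colors. A vertex missed by the matching can have degree one too large for a leaf but
    not for a center, so such vertices have to be pairwise nonadjacent.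

    Each frozen color consumes a layer of width 4 of the old coloring. An old coloring must
    therefore reach beyond what the next cell keeps, and the radii [rho i] decrease by [gap] from
    cell to cell. The first cell needs no extra colors, because the given [k]-edge coloring
    restricts to its components; only the other [s] cells pay [p] each. *)

Section Chains.
Variables (V : finType) (f g : V -> V) (u : V).
Hypotheses (ff : involutive f) (gg : involutive g) (fu : f u = u).

Let chain_rel := [rel x y : V | (f x == y) || (g x == y)].

(** Since [f] fixes [u], the component of [u] under the two involutions is a path with end [u]; the
    walk follows it, beginning with [g]. *)
Fixpoint walk (i : nat) : V :=
  if i is i'.+1 then (if odd i' then f (walk i') else g (walk i')) else u.

Lemma walk_closed (A : V -> Prop) x :
  A u -> (forall y, A y -> A (f y)) -> (forall y, A y -> A (g y)) ->
  connect chain_rel u x -> A x.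
Proof.
move=> uA fA gA /connectP[p + ->]; elim: p u uA => //= y p IHp z zA /andP[zy yp].
by apply: IHp yp; case/orP: zy => /eqP <-; [exact: fA|exact: gA].
Qed.

Lemma walk_step i y : y = walk i -> (exists2 l, l <= i.+1 & f y = walk l) /\
  (exists2 l, l <= i.+1 & g y = walk l).
Proof.
move=> ->; case: i => [|i] /=.
  by split; [exists 0; rewrite ?fu|exists 1].
case: (boolP (odd i)) => oi /=; split.
- by exists i; [exact: leqW (leqnSn i)|rewrite ff].
- by exists i.+2; rewrite //= oi.
- by exists i.+2; rewrite //= (negPf oi).
- by exists i; [exact: leqW (leqnSn i)|rewrite gg].
Qed.

Lemma walk_reach x : connect chain_rel u x -> exists i, walk i == x.
Proof.
apply: (@walk_closed (fun x => exists i, walk i == x)) => [|y [i /eqP e]|y [i /eqP e]].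
- by exists 0.
- by have [[l _ ->] _] := walk_step (esym e); exists l.
- by have [_ [l _ ->]] := walk_step (esym e); exists l.
Qed.

(** At the first visit to a fixed point of [g] the last step, if any, was an [f]-step. The next step
    would stay put, so the vertices visited so far are closed under both involutions. *)
Lemma walk_end w w' i : g w = w -> walk i = w -> (forall l, walk l = w -> i <= l) ->
  connect chain_rel u w' -> exists2 l, l <= i & walk l = w'.
Proof.
move=> gw iw imin.
have oi : ~~ odd i.
  case: i iw imin => // i iw imin; apply/negP => /= oi.
  suff /imin : walk i = w by rewrite ltnn.
  by move: iw => /=; rewrite (negPf oi) => e; rewrite -gw -e gg.
apply: (@walk_closed (fun x => exists2 l, l <= i & walk l = x)) => [|y [l li e]|y [l li e]].
- by exists 0.
- have [eli | lt] := eqVneq l i; last first.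
    have [[l' l'l ->] _] := walk_step (esym e); exists l' => //.
    by apply: leq_trans l'l _; rewrite ltn_neqAle lt.
  rewrite -e; case: l eli li {e} => [|l] eli li /=; first by exists 0; rewrite ?fu.
  case: ifP => ol; first by exists l; rewrite ?ff // ltnW.
  by move: oi; rewrite -eli /= ol.
- have [eli | lt] := eqVneq l i; last first.
    have [_ [l' l'l ->]] := walk_step (esym e); exists l' => //.
    by apply: leq_trans l'l _; rewrite ltn_neqAle lt.
  by exists i => //; rewrite iw -e eli iw gw.
Qed.

(** By [walk_end] each of the two is visited no later than the other, hence at the same time: a
    chain leaving [u] has only one other end. *)
Lemma chain_ends w w' : g w = w -> g w' = w' ->
  connect chain_rel u w -> connect chain_rel u w' -> w = w'.
Proof.
move=> gw gw' uw uw'.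
case: (ex_minnP (walk_reach uw)) => i /eqP iw imin.
case: (ex_minnP (walk_reach uw')) => j /eqP jw jmin.
have [l li lw] := walk_end gw iw (fun l e => imin l (introT eqP e)) uw'.
have [l' lj lw'] := walk_end gw' jw (fun l e => jmin l (introT eqP e)) uw.
have ji : j <= i by apply: leq_trans li; apply: jmin; rewrite lw.
have ij : i <= j by apply: leq_trans lj; apply: imin; rewrite lw'.
by rewrite -iw -jw; congr walk; apply/eqP; rewrite eqn_leq ij.
Qed.

End Chains.

(** * Edge colorings of multigraphs as sets of colors on pairs *)

Section EdgeColorings.
Import mathcomp.boot.fintype mathcomp.boot.finset.
Variables (V C : finType).
Implicit Types (P : {set C}) (S : V -> V -> {set C}) (M : V -> V -> nat).

(** Parallel edges are interchangeable here, so a pair carries just the set of colors of its edges.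
    Indices of edges return only when colorings are coded. *)
Definition pcol P S : Prop :=
  [/\ forall x y, S x y = S y x, forall x, S x x = set0,
      forall x y, S x y \subset P &
      forall x y z c, c \in S x y -> c \in S x z -> y = z].

Definition full_col P S M : Prop := pcol P S /\ forall x y, #|S x y| = M x y.

Definition miss P S x : {set C} := [set c in P | [forall y, c \notin S x y]].

Definition degree M x : nat := \sum_y M x y.

Definition same_pair (u v x y : V) : bool :=
  (x == u) && (y == v) || (x == v) && (y == u).

Lemma same_pair_sym u v x y : same_pair u v x y = same_pair u v y x.
Proof. by rewrite /same_pair orbC; congr orb; rewrite andbC. Qed.

Lemma same_pairl u v y : u != v -> same_pair u v u y = (y == v).
Proof. by move=> /negPf uv; rewrite /same_pair eqxx uv /= orbF. Qed.

Lemma same_pairr u v x : u != v -> same_pair u v x v = (x == u).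
Proof. by move=> /negPf uv; rewrite /same_pair eqxx [v == u]eq_sym uv andbT andbF orbF. Qed.

Lemma missP P S x c : reflect (c \in P /\ forall y, c \notin S x y) (c \in miss P S x).
Proof.
by rewrite inE; apply: (iffP andP) => -[-> /forallP].
Qed.

Lemma miss_notin P S x y c : c \in miss P S x -> c \notin S x y.
Proof. by case/missP. Qed.

Lemma card_miss P S x : pcol P S ->
  #|miss P S x| + degree (fun x y => #|S x y|) x = #|P|.
Proof.
move=> [_ _ sP dis].
rewrite -(cardsID (miss P S x) P); congr addn.
  by congr #|pred_of_set _|; apply/setP => c; rewrite !inE; case: (c \in P).
rewrite /degree (eq_bigr (fun y => \sum_(c in S x y) 1)); last first.
  by move=> y _; rewrite sum1_card.
rewrite (eq_bigr (fun y => \sum_(c in P) (c \in S x y : nat))); last first.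
  move=> y _; rewrite [RHS]big_mkcond [LHS]big_mkcond; apply: eq_bigr => c _.
  by case: (boolP (c \in S x y)) => cS; [rewrite (fintype.subsetP (sP x y) _ cS)|case: ifP].
rewrite exchange_big -sum1_card /= [RHS]big_mkcond [LHS]big_mkcond /=.
apply: eq_bigr => c _; rewrite !inE; case: (boolP (c \in P)) => //= cP; rewrite andbT.
case: (boolP [forall y, c \notin S x y]) => [/forallP h|/forallPn[y]] /=.
  by rewrite big1 // => y _; rewrite (negPf (h y)).
rewrite negbK => cy; rewrite (bigD1 y) //= cy big1 // => z zy.
by case: (boolP (c \in S x z)) => // cz; rewrite (dis _ _ _ _ cz cy) eqxx in zy.
Qed.

(** * Vizing fans and Kempe exchanges around a center *)

Section Fan.
Variables (P : {set C}) (T : V -> V -> nat) (u : V).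
Hypothesis nofull : ~ exists S, full_col P S T.

(** One edge between the center [u] and [w] is still uncolored; [u] is fixed while [w] moves along a
    fan. *)
Definition near_col S w : Prop :=
  [/\ pcol P S, u != w & forall x y, #|S x y| + same_pair u w x y = T x y].

Lemma near_col_miss S w c : near_col S w ->
  c \in miss P S u -> c \in miss P S w -> False.
Proof.
move=> [[sym irr sP dis] uw cnt] /missP[cP cu] /missP[_ cw]; apply: nofull.
exists (fun x y => if same_pair u w x y then c |: S x y else S x y).
have cS x y z : same_pair u w x y -> c \notin S x z.
  by case/orP => /andP[/eqP -> _]; [exact: cu|exact: cw].
split; first split => [x y|x|x y|x y z d].
- by rewrite same_pair_sym sym.
- rewrite irr; case: ifP => //; rewrite /same_pair.
  by case/orP => /andP[/eqP -> /eqP e]; move: uw; rewrite e eqxx.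
- by case: ifP => _ //; rewrite subUset sub1set cP sP.
- case: ifP => xy; case: ifP => xz.
  + move=> _ _; move: xy xz; rewrite /same_pair.
    case/orP => /andP[/eqP -> /eqP ->]; first by rewrite eqxx (negPf uw) /= orbF => /eqP.
    by rewrite [w == u]eq_sym eqxx (negPf uw) /= => /eqP.
  + by rewrite !inE => /orP[/eqP -> cz|]; [move: (cS x y z xy); rewrite cz|exact: dis].
  + by rewrite !inE => dy /orP[/eqP dc|]; [move: (cS x z y xz); rewrite -dc dy|exact: dis].
  + exact: dis.
- move=> x y; rewrite -cnt; case: ifP => xy; last by rewrite addn0.
  by rewrite cardsU1 (cS x y y xy) addnC.
Qed.

(** A fan is the set of vertices reachable by this relation rather than a sequence, because the
    final count runs over the whole reachable set. *)
Definition fan_rel S : rel V := fun w w' => [exists c, (c \in miss P S w) && (c \in S u w')].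

(** The color [c] is moved from a pair [u], [w'] to the open edge at [w]. Only [w] can lose a
    missing color, and at [u] only the pairs with [w] and [w'] change, so the rest of a fan path
    stays a fan path. *)
Lemma near_col_shift S w w' c : near_col S w -> c \in miss P S w -> c \in S u w' ->
  exists S', [/\ near_col S' w', miss P S' u = miss P S u,
    forall x, x != w -> miss P S x \subset miss P S' x &
    forall y, y != w -> y != w' -> S' u y = S u y].
Proof.
move=> [[sym irr sP dis] uw cnt] /missP[cP cw] cw'.
have ww' : w != w'.
  by apply/eqP => e; move: (cw u); rewrite sym e cw'.
have uw' : u != w' by apply/eqP => e; move: cw'; rewrite -e irr inE.
pose S' x y := if same_pair u w x y then c |: S x y
  else if same_pair u w' x y then S x y :\ c else S x y.
have S'u y : S' u y = if y == w then c |: S u y else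
    if y == w' then S u y :\ c else S u y by rewrite /S' !same_pairl.
have cu x : c \in S u x -> x = w' by move/dis; apply.
have disj x y : same_pair u w x y -> same_pair u w' x y = false.
  case/orP => /andP[/eqP -> /eqP ->]; rewrite /same_pair.
    by rewrite [w == u]eq_sym (negPf ww') (negPf uw) !andbF.
  by rewrite [w == u]eq_sym (negPf ww') (negPf uw).
have S'sub x y d : d != c -> (d \in S' x y) = (d \in S x y).
  by move=> /negPf dc; rewrite /S'; do 2?case: ifP => _; rewrite // !inE dc.
have S'c x y : (c \in S' x y) = same_pair u w x y || (c \in S x y) && ~~ same_pair u w' x y.
  rewrite /S'; case: ifP => [|_] /=; first by rewrite !inE eqxx.
  by case: ifP => _; rewrite ?inE ?eqxx ?andbF ?andbT.
exists S'; split.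
- split => //; first split => [x y|x|x y|x y z d].
  + by rewrite /S' !(same_pair_sym _ _ x y) sym.
  + rewrite /S' /same_pair; have [->|xu] := eqVneq x u.
      by rewrite (negPf uw) (negPf uw') /= irr.
    by rewrite !andbF /= irr.
  + rewrite /S'; case: ifP => _; first by rewrite subUset sub1set cP sP.
    by case: ifP => _ //; apply: fintype.subset_trans (sP x y); rewrite subsetDl.
  + have [->|dc] := eqVneq d c; last by rewrite !S'sub //; exact: dis.
    rewrite !S'c => /orP[xy|/andP[xy nxy]] /orP[xz|/andP[xz nxz]].
    * case/orP: xy xz => /andP[/eqP -> /eqP ->].
        by rewrite same_pairl // => /eqP.
      by rewrite same_pair_sym same_pairr // => /eqP.
    * case/orP: xy xz nxz => /andP[/eqP -> /eqP ->]; last by rewrite (negPf (cw z)).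
      by move/cu => ->; rewrite same_pairl // eqxx.
    * case/orP: xz xy nxy => /andP[/eqP -> /eqP ->]; last by rewrite (negPf (cw y)).
      by move/cu => ->; rewrite same_pairl // eqxx.
    * exact: dis xy xz.
  + move=> x y; rewrite -cnt /S'; case: ifP => xy.
      rewrite disj // cardsU1 addn0 addnC.
      suff -> : c \notin S x y by [].
      case/orP: xy => /andP[/eqP -> /eqP ->]; last exact: cw.
      by rewrite sym cw.
    case: ifP => xy'; rewrite !addn0 //.
    suff cxy : c \in S x y by rewrite [in RHS](cardsD1 c) cxy addnC.
    by case/orP: xy' => /andP[/eqP -> /eqP ->]; rewrite // sym.
- apply/setP => d; apply/missP/missP => -[dP h]; split => // y.
    have [dc|dc] := eqVneq d c; last by rewrite -S'sub.
    by move: (h w); rewrite dc S'c same_pairl // eqxx.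
  have [dc|dc] := eqVneq d c; last by rewrite S'sub.
  by move: (h w'); rewrite dc cw'.
- move=> x xw; apply/fintype.subsetP => d /missP[dP h]; apply/missP; split => // y.
  have [dc|dc] := eqVneq d c; last by rewrite S'sub.
  rewrite dc S'c -dc (negPf (h y)) orbF /same_pair (negPf xw) /= orbF.
  apply/negP => /andP[/eqP xu /eqP yw]; move: (h w').
  by rewrite xu dc cw'.
- by move=> y yw yw'; rewrite S'u (negPf yw) (negPf yw').
Qed.

Lemma path_impl (e e' : rel V) a s :
  (forall x y, x \in a :: s -> y \in s -> e x y -> e' x y) -> path e a s -> path e' a s.
Proof.
elim: s a => //= b s IHs a h /andP[ab bs]; rewrite h ?mem_head //=.
by apply: IHs bs => x y xs ys; apply: h; rewrite inE ?xs ?ys orbT.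
Qed.

Lemma path_stop (e e' : rel V) (Q : pred V) a s :
  (forall x y, x \notin Q -> e x y -> e' x y) -> path e a s -> last a s \in Q ->
  exists i, path e' a (take i s) /\ last a (take i s) \in Q.
Proof.
move=> h; elim: s a => [|b s IHs] a /=; first by move=> _ aQ; exists 0.
case/andP => ab bs lQ; case: (boolP (a \in Q)) => aQ; first by exists 0.
by have [i [pi li]] := IHs b bs lQ; exists i.+1; rewrite /= h.
Qed.

(** The open edge is shifted along the path to its last vertex, where [c] would close it. As the
    vertices are distinct, no shift disturbs the rest of the path. *)
Lemma fan_path_miss ws S w c : near_col S w -> path (fan_rel S) w ws -> uniq (w :: ws) ->
  c \in miss P S u -> c \in miss P S (last w ws) -> False.
Proof.
elim: ws S w => [|w1 ws IHws] S w nS; first by move=> _ _; exact: near_col_miss nS.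
rewrite /= => /andP[/existsP[d /andP[dw dw1]] pw] /andP[wn /andP[w1n us]] cu cl.
have [S' [nS' mu ms su]] := near_col_shift nS dw dw1.
move: wn; rewrite inE negb_or => /andP[ww1 wn].
apply: (IHws S' w1 nS' _ _ _ _); rewrite ?mu //=; last 2 first.
- by rewrite w1n.
- apply: (fintype.subsetP (ms _ _)) cl; apply/eqP => e.
  by move: (mem_last w1 ws); rewrite e inE (negPf ww1) (negPf wn).
apply: path_impl pw => x y xs ys /existsP[d' /andP[dx dy]]; apply/existsP; exists d'.
rewrite (fintype.subsetP (ms _ _) _ dx) ?su //=.
- by apply/eqP => e; move: wn; rewrite -e ys.
- by apply/eqP => e; move: w1n; rewrite -e ys.
- by apply/eqP => e; move: xs; rewrite e inE (negPf ww1) (negPf wn).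
Qed.

Lemma fan_miss S v w c : near_col S v -> connect (fan_rel S) v w ->
  c \in miss P S u -> c \in miss P S w -> False.
Proof.
by move=> nS /connectP[p + ->] => /shortenP[q pq uq _]; exact: fan_path_miss nS pq uq.
Qed.

Definition kempe_rel S a b : rel V := fun x y => (a \in S x y) || (b \in S x y).

Definition kempe_swap S a b (X : {set V}) x y : {set C} :=
  if x \in X then tperm a b @: S x y else S x y.

Lemma kempe_swap_near S a b (X : {set V}) v : a \in P -> b \in P ->
  (forall x y, kempe_rel S a b x y -> (x \in X) = (y \in X)) ->
  near_col S v -> near_col (kempe_swap S a b X) v.
Proof.
move=> aP bP cl [[sym irr sP dis] uv cnt]; split => //; last first.
  move=> x y; rewrite -cnt /kempe_swap; case: ifP => // _.
  by rewrite card_imset //; exact: perm_inj.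
split => [x y|x|x y|x y z c].
- rewrite /kempe_swap sym; case: (boolP (kempe_rel S a b y x)) => [/cl ->|] //.
  rewrite negb_or => /andP[na nb].
  suff -> : tperm a b @: S y x = S y x by rewrite !if_same.
  apply/setP => c; rewrite -{1}[c](tpermK a b) mem_imset; last exact: perm_inj.
  by case: tpermP => // ->; rewrite (negPf na) (negPf nb).
- by rewrite /kempe_swap irr imset0 if_same.
- rewrite /kempe_swap; case: ifP => // _; apply/fintype.subsetP => c /imsetP[d dS ->].
  by case: tpermP => [//|//|_ _]; exact: (fintype.subsetP (sP x y)).
- rewrite /kempe_swap; case: ifP => [_|_]; last exact: dis.
  by rewrite -[c](tpermK a b) !mem_imset; try exact: perm_inj; exact: dis.
Qed.

Lemma kempe_swap_miss S a b (X : {set V}) x c : a \in P -> b \in P -> x \in X ->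
  (c \in miss P (kempe_swap S a b X) x) = (tperm a b c \in miss P S x).
Proof.
move=> aP bP xX; have PP : (c \in P) = (tperm a b c \in P).
  by case: tpermP => // ->; rewrite aP bP.
rewrite !inE PP; congr andb; apply: eq_forallb => y.
by rewrite /kempe_swap xX -{1}[c](tpermK a b) mem_imset; last exact: perm_inj.
Qed.

(* Otherwise exchanging [a] and [b] along the chain of [w] makes [a] missing at both
   ends of a fan. *)
Lemma fan_chain S v w a b : near_col S v -> connect (fan_rel S) v w ->
  a \in miss P S u -> b \in miss P S w -> connect (kempe_rel S a b) u w.
Proof.
move=> nS vw au bw; have [sym irr sP dis] : pcol P S by case: nS.
have aP : a \in P by case/missP: au.
have bP : b \in P by case/missP: bw.
have ksym : connect_sym (kempe_rel S a b).
  by apply: sym_connect_sym => x y; rewrite /kempe_rel sym.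
apply: contraT; rewrite ksym => nwu; exfalso.
pose X := [set x | connect (kempe_rel S a b) w x].
have cl x y : kempe_rel S a b x y -> (x \in X) = (y \in X).
  by move=> xy; rewrite !inE; exact: (same_connect_r ksym (connect1 xy)).
have uX : u \notin X by rewrite inE.
pose S' := kempe_swap S a b X.
have nS' : near_col S' v by exact: kempe_swap_near.
have S'u y : S' u y = S u y by rewrite /S' /kempe_swap (negPf uX).
have mS' x : x \notin X -> miss P S' x = miss P S x.
  by move=> xX; apply/setP => c; rewrite !inE /S' /kempe_swap (negPf xX).
(* The fan path is cut at the first vertex of [X] that misses [b]. Up to there it survives the
   exchange: the color leading on from a vertex of [X] is not [a], which is absent at [u], nor [b],
   which is present at that vertex. *)
pose Q := [pred x | (x \in X) && (b \in miss P S x)].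
have fr x y : x \notin Q -> fan_rel S x y -> fan_rel S' x y.
  move=> xQ /existsP[c /andP[cx cy]]; apply/existsP; exists c; rewrite S'u cy andbT.
  case: (boolP (x \in X)) => xX; last by rewrite mS'.
  rewrite kempe_swap_miss // tpermD //.
    by apply/eqP => ac; move: (miss_notin y au); rewrite ac cy.
  by apply/eqP => bc; move: xQ; rewrite inE xX bc cx.
have wQ : w \in Q by rewrite inE bw inE connect0.
case/connectP: vw => p /shortenP[q pq uq _] wq.
have [i [pi li]] := path_stop fr pq (etrans (congr1 (fun x => x \in Q) (esym wq)) wQ).
move: li; rewrite inE => /andP[lX lb].
apply: (fan_path_miss (c := a) nS' pi); first 2 last.
- by rewrite kempe_swap_miss // tpermL.
- by rewrite -[v :: _]/(take i.+1 (v :: q)) take_uniq.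
- by rewrite mS'.
Qed.

(** A vertex without color [c] is its own partner. This makes [partner] a total involution whose
    fixed points are the possible chain ends, as [chain_ends] requires. *)
Definition partner S c x : V := if [pick y | c \in S x y] is Some y then y else x.

Lemma partnerP S c x y : pcol P S -> c \in S x y -> partner S c x = y.
Proof.
move=> [_ _ _ dis] cxy; rewrite /partner; case: pickP => [z cz|/(_ y)].
  exact: dis cz cxy.
by rewrite cxy.
Qed.

Lemma partner_miss S c x : c \in miss P S x -> partner S c x = x.
Proof. by case/missP => _ h; rewrite /partner; case: pickP => // y; rewrite (negPf (h y)). Qed.

Lemma partnerK S c : pcol P S -> involutive (partner S c).
Proof.
move=> pS x; have [sym _ _ _] := pS; rewrite {2}/partner; case: pickP => [y cxy|h].
  by apply: partnerP pS _; rewrite sym.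
by rewrite /partner; case: pickP => // y; rewrite h.
Qed.

(** Both vertices would be the other end of the chain in colors [a] and [b] that starts at [u]. *)
Lemma fan_miss_disjoint S v w w' a b : near_col S v ->
  connect (fan_rel S) v w -> connect (fan_rel S) v w' ->
  a \in miss P S u -> b \in miss P S w -> b \in miss P S w' -> w = w'.
Proof.
move=> nS vw vw' au bw bw'; have pS : pcol P S by case: nS.
have sub x : connect (kempe_rel S a b) u x ->
    connect [rel x y | (partner S a x == y) || (partner S b x == y)] u x.
  by apply: connect_sub => y z /orP[] c; apply: connect1; rewrite /= (partnerP pS c) eqxx ?orbT.
apply: (@chain_ends _ (partner S a) (partner S b) u); try exact: partnerK pS.
- exact: partner_miss.
- exact: partner_miss.
- exact: partner_miss.
- exact: sub (fan_chain nS vw au bw).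
- exact: sub (fan_chain nS vw' au bw').
Qed.

(** Color by color: a color missing at some fan vertex is missing at only one of them, is present at
    [u], and the neighbor of [u] to which it leads is again in the fan. *)
Lemma fan_count S v : near_col S v -> miss P S u != set0 ->
  \sum_(w | connect (fan_rel S) v w) #|miss P S w| <=
  \sum_(w | connect (fan_rel S) v w) #|S u w|.
Proof.
move=> nS /set0Pn[a au].
have dc (E : V -> {set C}) : \sum_(w | connect (fan_rel S) v w) #|E w| =
    \sum_c \sum_(w | connect (fan_rel S) v w) (c \in E w).
  rewrite exchange_big; apply: eq_bigr => w _.
  by rewrite -sum1_card big_mkcond; apply: eq_bigr => c _; case: ifP.
rewrite !dc; apply: leq_sum => c _.
case: (pickP [pred w | connect (fan_rel S) v w & c \in miss P S w]) => [w|h]; last first.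
  by rewrite big1 // => w vw; move: (h w); rewrite /= vw => /= ->.
case/andP => /= vw cw; rewrite (bigD1 w) //= cw big1 ?addn0; last first.
  move=> w' /andP[vw' /eqP ne]; case: (boolP (_ \in _)) => // cw'; case: ne.
  exact: fan_miss_disjoint nS vw' vw au cw' cw.
have [cP _] := missP _ _ _ _ cw.
have [y cy] : exists y, c \in S u y.
  have : c \notin miss P S u by apply/negP => cu; exact: fan_miss nS vw cu cw.
  by rewrite inE cP /= => /forallPn[y]; rewrite negbK; exists y.
have vy : connect (fan_rel S) v y.
  by apply: connect_trans vw (connect1 _); apply/existsP; exists c; rewrite cw.
by rewrite (bigD1 y) //= cy.
Qed.

End Fan.

(** Without a completion the fan of [v] would contradict [fan_count]: each of its vertices misses at
    least as many colors as it shares with [u], and [v] misses one more. *)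
Lemma vizing_step P S u v : pcol P S -> u != v -> miss P S u != set0 ->
  (forall w, (w == v) || (S u w != set0) -> #|S u w| + (w == v) <= #|miss P S w|) ->
  exists S', full_col P S' (fun x y => #|S x y| + same_pair u v x y).
Proof.
move=> pS uv mu h; apply: contrapT => nofull.
have nS : near_col P (fun x y => #|S x y| + same_pair u v x y) u S v by [].
have := fan_count nofull nS mu; apply/negP; rewrite -ltnNge.
have fw w : connect (fan_rel P u S) v w -> (w == v) || (S u w != set0).
  case/connectP => p; case/lastP: p => [_ -> /=|p x]; first by rewrite eqxx.
  rewrite rcons_path last_rcons => /andP[_ /existsP[c /andP[_ cx]]] ->.
  by apply/orP; right; apply/set0Pn; exists c.
rewrite [X in _ < X](bigD1 v) //= [X in X < _](bigD1 v) //=.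
rewrite -addSn leq_add //; first by have := h v; rewrite eqxx addn1; apply.
by apply: leq_sum => w /andP[/fw/h + _]; apply: leq_trans; rewrite leq_addr.
Qed.

(** * Completing a coloring and extending a prescribed part *)

Definition multigraph p M : Prop :=
  [/\ forall x y, M x y = M y x, forall x, M x x = 0 & forall x y, M x y <= p].

(** The condition on a fan center is asymmetric: the center may use up all of [P], since an
    uncolored edge leaves it a free color, while each neighbor keeps [p] colors in reserve, enough
    for any multiplicity. *)
Definition fan_ok p P M u : Prop :=
  degree M u <= #|P| /\ forall w, 0 < M u w -> degree M w + p <= #|P|.

(** Edges are colored one at a time. Each step may recolor everything but changes the number of
    colors only on the new pair, so the hypotheses persist. *)
Lemma fill_col p P M S : pcol P S -> multigraph p M ->
  (forall x y, #|S x y| <= M x y) ->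
  (forall x y, #|S x y| < M x y -> fan_ok p P M x \/ fan_ok p P M y) ->
  exists S', full_col P S' M.
Proof.
move=> pS [Msym Mirr Mp].
have [d] := ubnP (\sum_x \sum_y (M x y - #|S x y|)).
elim: d S pS => // d IHd S pS dS leM ok.
case: (pickP [pred xy | #|S xy.1 xy.2| < M xy.1 xy.2]) => [[x y] /= lt|h]; last first.
  exists S; split => // x y; apply/eqP; rewrite eqn_leq leM leqNgt.
  by have := h (x, y) => /= ->.
have [u [v [uv [du nu]]]] : exists u v, #|S u v| < M u v /\ fan_ok p P M u.
  have [sym _ _ _] := pS.
  by case: (ok _ _ lt) => o; [exists x, y|exists y, x; rewrite sym Msym].
have [] := @vizing_step P S u v pS.
- by apply/eqP => e; move: uv; rewrite e Mirr.
- rewrite -card_gt0 -(ltn_add2r (degree (fun x y => #|S x y|) u)) (card_miss _ pS) add0n.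
  apply: leq_trans du; rewrite /degree (bigD1 v) //= [X in _ < X](bigD1 v) //=.
  by rewrite -addSn leq_add // leq_sum.
- move=> w wv; have Mw : 0 < M u w.
    case/orP: wv => [/eqP ->|]; first exact: leq_ltn_trans uv.
    by rewrite -card_gt0 => /leq_trans; apply.
  apply: (@leq_trans p).
    apply: leq_trans (Mp u w); case: eqP => [->|_]; first by rewrite addn1.
    by rewrite addn0.
  rewrite -(leq_add2l (degree (fun x y => #|S x y|) w)) [X in _ <= X]addnC (card_miss _ pS).
  by apply: leq_trans (nu w Mw); rewrite leq_add2r leq_sum.
move=> S' [pS' cS']; apply: (IHd S') => // [|x' y'|x' y' lt'].
- rewrite ltnS in dS; apply: leq_trans dS.
  have le x' y' : M x' y' - #|S' x' y'| <= M x' y' - #|S x' y'|.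
    by rewrite cS' leq_sub2l // leq_addr.
  rewrite (bigD1 u) //= [X in _ < X](bigD1 u) //= -addSn leq_add //; last first.
    by apply: leq_sum => x' _; apply: leq_sum => y' _.
  rewrite (bigD1 v) //= [X in _ < X](bigD1 v) //= -addSn leq_add //; last first.
    by apply: leq_sum => y' _.
  by rewrite cS' /same_pair !eqxx /= addn1 subnSK.
- rewrite cS'; case: (boolP (same_pair _ _ _ _)) => [|_]; last by rewrite addn0.
  have [sym _ _ _] := pS.
  by rewrite addn1; case/orP => /andP[/eqP -> /eqP ->]; rewrite // sym Msym.
- by apply: ok; apply: leq_ltn_trans lt'; rewrite cS' leq_addr.
Qed.

Lemma trim_col P S M : pcol P S -> (forall x y, M x y = M y x) ->
  exists S', pcol P S' /\ forall x y, #|S' x y| = minn (M x y) #|S x y|.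
Proof.
move=> [sym irr sP dis] Msym.
pose S' x y := [set c in take (M x y) (enum (S x y))].
have sub x y c : c \in S' x y -> c \in S x y.
  by rewrite inE => /mem_take; rewrite mem_enum.
exists S'; split; first split => [x y|x|x y|x y z c /sub cy /sub cz].
- by rewrite /S' sym Msym.
- by apply/eqP; rewrite -subset0 -(irr x); apply/fintype.subsetP => c /sub.
- by apply/fintype.subsetP => c /sub; exact: (fintype.subsetP (sP x y)).
- exact: dis cy cz.
move=> x y; rewrite cardsE (card_uniqP _) ?take_uniq ?enum_uniq //.
by rewrite size_take_min -cardE.
Qed.

Definition matching M (N : rel V) : Prop :=
  [/\ forall x y, N x y = N y x, forall x y z, N x y -> N x z -> y = z &
      forall x y, N x y -> 0 < M x y].

Definition covered (N : rel V) x : bool := [exists y, N x y].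

Lemma maximal_matching p M N (D : pred V) : multigraph p M -> matching M N ->
  exists N', [/\ matching M N', forall x y, N x y -> N' x y,
    forall x y, N' x y -> N x y \/ D x /\ D y &
    forall x y, D x -> D y -> ~~ covered N' x -> ~~ covered N' y -> M x y = 0].
Proof.
move=> [Msym Mirr _]; have [d] := ubnP #|[pred x | ~~ covered N x]|.
elim: d N => // d IHd N dN mN.
case: (pickP [pred xy | [&& D xy.1, D xy.2, ~~ covered N xy.1, ~~ covered N xy.2
   & 0 < M xy.1 xy.2]]) => [[a b] /= /and5P[Da Db na nb Mab]|h]; last first.
  exists N; split => // [x y ? |x y Dx Dy nx ny]; first by left.
  by apply/eqP; rewrite -leqn0 leqNgt; have := h (x, y); rewrite /= Dx Dy nx ny /= => ->.
have ab : a != b by apply/eqP => e; move: Mab; rewrite e Mirr.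
have nN x y z : same_pair a b x y -> N x z -> False.
  case/orP => /andP[/eqP -> _] Nz.
    by case/negP: na; apply/existsP; exists z.
  by case/negP: nb; apply/existsP; exists z.
have [sym fn pos] := mN.
have [||N' [m' ext or mx]] := IHd (fun x y => N x y || same_pair a b x y).
- rewrite ltnS in dN; apply: leq_trans dN.
  apply: proper_card; apply/properP; split.
    apply/fintype.subsetP => x; rewrite !inE; apply: contra => /existsP[y xy].
    by apply/existsP; exists y; rewrite xy.
  exists a; rewrite !inE // negbK; apply/existsP; exists b.
  by rewrite same_pairl // eqxx orbT.
- split => [x y|x y z|x y]; first by rewrite sym same_pair_sym.
    move=> /orP[xy|xy] /orP[xz|xz].
    + exact: fn xy xz.
    + by case: (nN _ _ _ xz xy).
    + by case: (nN _ _ _ xy xz).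
    + case/orP: xy xz => /andP[/eqP -> /eqP ->].
        by rewrite same_pairl // => /eqP.
      by rewrite same_pair_sym same_pairr // => /eqP.
  by case/orP => [/pos //|/orP[]/andP[/eqP -> /eqP ->]] //; rewrite Msym.
exists N'; split => // x y; first by move=> xy; apply: ext; rewrite xy.
case/or => [/orP[xy|/orP[]/andP[/eqP -> /eqP ->]]|]; by [left|right].
Qed.

(* Induction on [k], peeling off one color [c0] of [phi]: a maximal matching [N] extends the
   [c0]-edges of [phi] near [B 0] and agrees with those of [theta] far away.  In between, the
   vertices not covered by [N] are independent, so that Vizing fans complete the coloring
   inherited from [theta] to one of the rest of the multigraph without the color [c0]. *)
Lemma extend_col p k M (P0 P : {set C}) (B : nat -> {set V}) phi theta :
  multigraph p M -> #|P0| = k -> P0 \subset P -> #|P| = k + p ->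
  (forall j, B j \subset B j.+1) ->
  (forall j x y, x \in B j -> 0 < M x y -> y \in B j.+1) ->
  pcol P0 phi -> (forall x y, #|phi x y| <= M x y) ->
  (forall x y, x \in B (4 * k) -> y \in B (4 * k) -> #|phi x y| = M x y) ->
  full_col P theta M ->
  exists S, full_col P S M /\ forall x y, x \in B 0 -> y \in B 0 -> S x y = phi x y.
Proof.
elim: k M P0 P phi theta => [|k IHk] M P0 P phi theta mM cP0 P0P cP Bm Bn pphi phile
    phiM [ptheta ctheta].
  (* With [P0] empty the kept part has no edges, so every full coloring agrees with [phi] there. *)
  exists theta; split => // x y xB yB; have e := phiM x y xB yB.
  have z : phi x y = set0.
    have [_ _ sP0 _] := pphi; apply/eqP; rewrite -subset0; apply: fintype.subset_trans (sP0 x y) _.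
    by rewrite subset0 -cards_eq0 cP0.
  by rewrite z; apply/eqP; rewrite -cards_eq0 ctheta -e z cards0.
have [c0 c0P0] : exists c, c \in P0 by apply/set0Pn; rewrite -card_gt0 cP0.
have [Msym Mirr Mp] := mM; pose t := 4 * k.
have T4 : 4 * k.+1 = t.+4 by rewrite mulnS addnC !addnS addn0.
rewrite T4 in phiM.
have [phisym phiirr phiP phid] := pphi.
have [thsym thirr thP thd] := ptheta.
have Bsub i x : x \in B i -> x \in B i.+1 by apply: (fintype.subsetP (Bm i)).
(* Radius [t.+1] captures every [c0]-edge of [phi] that has an end in [B t], so the matching decides
   the color [c0] at all vertices of [B t]. *)
pose N0 : rel V := fun x y => [&& x \in B t.+1, y \in B t.+1 & c0 \in phi x y].
(* Away from [N0] the matching follows the [c0]-edges of [theta]; there [theta] without [c0] has at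
   least as many colors as edges remain. *)
pose N1 : rel V := fun x y => N0 x y || [&& x \notin B t, y \notin B t,
  ~~ covered N0 x, ~~ covered N0 y & c0 \in theta x y].
have mN1 : matching M N1.
  have cov0 x y : N0 x y -> covered N0 x by move=> xy; apply/existsP; exists y.
  split => [x y|x y z|x y].
  - by rewrite /N1 /N0 (phisym x) (thsym x); congr orb; [rewrite andbCA|apply/and5P/and5P => -[]].
  - move=> /orP[xy|/and5P[_ _ nx _ xy]] /orP[xz|/and5P[_ _ nx' _ xz]].
    + by case/and3P: xy => _ _ xy; case/and3P: xz => _ _ xz; exact: phid xy xz.
    + by rewrite (cov0 _ _ xy) in nx'.
    + by rewrite (cov0 _ _ xz) in nx.
    + exact: thd xy xz.
  - case/orP => [/and3P[_ _ c]|/and5P[_ _ _ _ c]].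
      by apply: leq_trans (phile x y); rewrite card_gt0; apply/set0Pn; exists c0.
    by rewrite -ctheta card_gt0; apply/set0Pn; exists c0.
have [N [[Nsym Nfun Npos] N1N NN1 Nmax]] :=
  maximal_matching (fun x => x \notin B t) mM mN1.
pose M' x y := M x y - N x y.
have mM' : multigraph p M'.
  split => [x y|x|x y]; rewrite /M' ?Mirr //; first by rewrite Msym Nsym.
  exact: leq_trans (leq_subr _ _) (Mp x y).
have M'M x y : M' x y <= M x y by rewrite leq_subr.
have NB x y : x \in B t -> y \in B t -> N x y = (c0 \in phi x y).
  move=> xB yB; apply/idP/idP => [|c].
    case/NN1 => [|[]]; last by rewrite xB.
    by case/orP => [/and3P[]|/and5P[]] //; rewrite xB.
  by apply: N1N; rewrite /N1 /N0 c !Bsub.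
(* Within [B t.+3] only these vertices can still have degree [k.+1] after the matching is removed,
   and by maximality no two of them are adjacent. *)
pose defect x := (x \notin B t) && ~~ covered N x.
have degM x : x \in B t.+3 -> degree M x <= degree (fun x y => #|phi x y|) x.
  move=> xB; apply: leq_sum => y _; case: (posnP (M x y)) => [->//|Mxy].
  by rewrite phiM //; [exact: Bsub|exact: Bn xB Mxy].
have degM' x : x \in B t.+3 -> degree M' x <= k.+1.
  move=> xB; apply: (@leq_trans (degree M x)); first exact: leq_sum.
  by apply: leq_trans (degM x xB) _; rewrite -cP0 -(card_miss x pphi) leq_addl.
have degN x : x \in B t.+3 -> ~~ defect x -> degree M' x <= k.
  move=> xB; case: (boolP (covered N x)) => [/existsP[y xy] _|cx].
    rewrite -ltnS -cP0 -(card_miss x pphi).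
    apply: (@leq_trans (degree M x)); last by apply: leq_trans (degM x xB) _; rewrite leq_addl.
    rewrite /degree (bigD1 y) //= [X in _ < X](bigD1 y) //= -addSn leq_add ?leq_sum //.
    by rewrite /M' xy subn1 prednK // Npos.
  rewrite /defect cx andbT negbK => xt.
  apply: (@leq_trans (degree M x)); first exact: leq_sum.
  apply: leq_trans (degM x xB) _; rewrite -ltnS -cP0 -(card_miss x pphi) -[X in X < _]add0n.
  rewrite ltn_add2r card_gt0; apply/set0Pn; exists c0; apply/missP; split => // y.
  apply: contra cx => c; apply/existsP; exists y; apply: N1N; rewrite /N1 /N0 c Bsub //=.
  rewrite (Bn t x y) //; apply: leq_trans (phile x y).
  by rewrite card_gt0; apply/set0Pn; exists c0.
pose touch x y := (x \in B t.+1) || (y \in B t.+1).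
have touch_sym x y : touch x y = touch y x by rewrite /touch orbC.
have c0P : c0 \in P by apply: (fintype.subsetP P0P).
have cP' : #|P :\ c0| = k + p.
  by apply: succn_inj; rewrite -addSn -cP (cardsD1 c0 P) c0P.
(* Pairs touching [B t.+1] start uncolored. Elsewhere [theta] without [c0] may have a color too
   many, where [N] contains a pair that has no [c0]-edge of [theta], and is trimmed. *)
have [S0 [pS0 cS0]] : exists S0, pcol (P :\ c0) S0 /\
    forall x y, #|S0 x y| = if touch x y then 0 else M' x y.
  have [|S0 [pS0 cS0]] := @trim_col (P :\ c0)
      (fun x y => if touch x y then set0 else theta x y :\ c0) M' _ (let: And3 h _ _ := mM' in h).
    split => [x y|x|x y|x y z c].
    - by rewrite touch_sym thsym.
    - by rewrite thirr set0D if_same.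
    - by case: ifP => _; rewrite ?sub0set // setSD.
    - do 2?case: ifP => _; rewrite ?inE // => /andP[_ cy] /andP[_ cz]; exact: thd cy cz.
  exists S0; split => // x y; rewrite cS0; case: ifP => tc; first by rewrite cards0 minn0.
  apply/minn_idPl; rewrite -(leq_add2l (c0 \in theta x y)) -cardsD1 ctheta /M'.
  case: (boolP (c0 \in theta x y)) => cth; last by rewrite leq_subr.
  suff -> : N x y by rewrite subnKC // -ctheta card_gt0; apply/set0Pn; exists c0.
  move: tc => /negbT; rewrite negb_or => /andP[xB yB].
  apply: N1N; apply/orP; right; rewrite cth !(contra (@Bsub t _)) //= andbT.
  by apply/andP; split; apply/existsPn => z; rewrite /N0 ?(negPf xB) ?(negPf yB).
(* In the first round the touching edges with a defect end wait, so a center in [B t.+1] has only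
   leaves of degree at most [k]. *)
pose M1 x y := if touch x y && (defect x || defect y) then 0 else M' x y.
have M1M' x y : M1 x y <= M' x y by rewrite /M1; case: ifP.
have [M'sym M'irr M'p] := mM'.
have p_gt0 x y : 0 < M' x y -> 0 < p.
  by move=> h; apply: leq_trans (M'p x y).
(* A center may have degree [k.+1]; this fits into [k + p] colors because the presence of an edge
   forces [p] to be positive. *)
have deg_ok x y : 0 < M' x y -> k.+1 <= k + p.
  by move=> /p_gt0 h; rewrite -addn1 leq_add2l.
have M'B j x y : x \in B j -> 0 < M' x y -> y \in B j.+1.
  by move=> xB h; apply: (Bn j x y xB); apply: leq_trans (M'M x y).
have ok1 x y : x \in B t.+1 -> 0 < M1 x y -> fan_ok p (P :\ c0) M1 x.
  move=> xB xy; have xy' := leq_trans xy (M1M' x y).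
  rewrite /fan_ok cP'; split.
    apply: leq_trans (deg_ok _ _ xy'); apply: leq_trans (degM' x (Bsub _ _ (Bsub _ _ xB))).
    exact: leq_sum.
  move=> w xw; rewrite leq_add2r; have xw' := leq_trans xw (M1M' x w).
  apply: (@leq_trans (degree M' w)); first exact: leq_sum.
  apply: degN; first by apply: Bsub; exact: M'B xB xw'.
  by move: xw; rewrite /M1 /touch xB /=; case: (defect w); rewrite // orbT.
have [||x y|S1 [pS1 cS1]] := @fill_col p (P :\ c0) M1 S0 pS0.
- split => [x y|x|x y]; rewrite /M1 ?M'irr ?if_same //.
    by rewrite touch_sym M'sym orbC.
  by case: ifP.
- by move=> x y; rewrite cS0 /M1; case: ifP.
- rewrite cS0 => lt; have pos : 0 < M1 x y by exact: leq_ltn_trans lt.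
  move: lt; case: ifP => [/orP[xB|yB] _|tc]; last by rewrite /M1 tc ltnn.
    by left; exact: ok1 pos.
  right; apply: (ok1 y x yB).
  by rewrite /M1 touch_sym orbC M'sym.
have [|x y|S2 [pS2 cS2]] := @fill_col p (P :\ c0) M' S1 pS1 mM'.
- by move=> x y; rewrite cS1.
(* In the second round the centers are defect vertices, whose neighbors are not. A center lies in
   [B t.+2], a leaf in [B t.+3], and the edges of the leaf are colored by [phi] inside [B t.+4]:
   hence width 4 per color. *)
- rewrite cS1; have ok2 a b : a \in B t.+2 -> defect a -> 0 < M' a b -> fan_ok p (P :\ c0) M' a.
    move=> aB da ab; rewrite /fan_ok cP'; split.
      by apply: leq_trans (deg_ok _ _ ab); exact: degM' (Bsub _ _ aB).
    move=> w aw; rewrite leq_add2r; apply: degN; first exact: M'B aB aw.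
    apply/negP => /andP[wt wc]; case/andP: da => at_ ac.
    by have := leq_trans aw (M'M a w); rewrite Nmax.
  rewrite /M1; case: ifP => [/andP[tc df] pos|_]; last by rewrite ltnn.
  have pos' : 0 < M' y x by rewrite M'sym.
  have xyB : x \in B t.+2 /\ y \in B t.+2.
    case/orP: tc => h; split; try exact: Bsub.
      exact: M'B h pos.
    exact: M'B h pos'.
  by case/orP: df => df; [left; apply: ok2 pos|right; apply: ok2 pos'] => //; case: xyB.
have phiM' x y : x \in B t -> y \in B t -> #|phi x y :\ c0| = M' x y.
  have B4 z : z \in B t -> z \in B t.+4 by move=> /Bsub/Bsub/Bsub/Bsub.
  move=> xB yB; rewrite /M' NB // -phiM; [|exact: B4..].
  by rewrite [in RHS](cardsD1 c0) addKn.
(* [S2] takes over the role of [theta]. It need not agree with [phi] anywhere; the matching alone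
   records the color [c0]. *)
have [|||||||||S [[pS cS] Sphi]] := IHk M' (P0 :\ c0) (P :\ c0)
    (fun x y => if (x \in B t) && (y \in B t) then phi x y :\ c0 else set0) S2 mM'.
- by apply/eqP; rewrite -eqSS -cP0 (cardsD1 c0 P0) c0P0.
- exact: setSD.
- exact: cP'.
- exact: Bm.
- exact: M'B.
- split => [x y|x|x y|x y z c].
  + by rewrite andbC phisym.
  + by rewrite phiirr set0D if_same.
  + by case: ifP => _; rewrite ?sub0set // setSD.
  + by do 2?case: ifP => _; rewrite ?inE // => /andP[_ cy] /andP[_ cz]; exact: phid cy cz.
- by move=> x y; case: ifP => [/andP[xB yB]|_]; rewrite ?cards0 // phiM'.
- by move=> x y xB yB; rewrite xB yB phiM'.
- by [].
have [Ssym Sirr SP Sd] := pS.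
have c0S x y : c0 \notin S x y.
  by apply/negP => /(fintype.subsetP (SP x y)); rewrite !inE eqxx.
exists (fun x y => if N x y then c0 |: S x y else S x y); split; first split.
- split => [x y|x|x y|x y z c].
  + by rewrite Nsym Ssym.
  + by rewrite Sirr; case: ifP => // /Npos; rewrite Mirr.
  + have SPP : S x y \subset P by apply: fintype.subset_trans (SP x y) _; rewrite subsetDl.
    by case: ifP => _ //; rewrite subUset sub1set c0P.
  + have [->|/negPf cc0] := eqVneq c c0.
      by case: ifP => xy; case: ifP => xz; rewrite ?(negPf (c0S _ _)) // => _ _; exact: Nfun xy xz.
    by do 2?case: ifP => _; rewrite ?inE ?cc0 //=; exact: Sd.
- move=> x y; case: ifP => xy; last by rewrite cS /M' xy subn0.
  by rewrite cardsU1 c0S cS /M' xy subnKC // Npos.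
- have B0 x : x \in B 0 -> x \in B t.
    by elim: (t) => // i IHi /IHi; exact: Bsub.
  move=> x y xB yB; have xt := B0 _ xB; have yt := B0 _ yB.
  rewrite Sphi // NB // xt yt /=.
  case: ifP => c; first by rewrite setD1K.
  by apply/setP => d; rewrite !inE; case: eqP => // ->; rewrite c.
Qed.

End EdgeColorings.

(** * Recursive functions *)

Notation recb P := (recursive (fun t => nat_of_bool (P t))).

Section Recursive.
Implicit Types (n : nat).

Lemma rec_ext n (f g : n.-tuple nat -> nat) : recursive f -> f =1 g -> recursive g.
Proof. by move=> rf fg; rewrite -(funext fg). Qed.

Lemma rec_comp_tuple m n (g : m.-tuple nat -> nat) (hs : m.-tuple (n.-tuple nat -> nat)) :
  recursive g -> (forall i, recursive (tnth hs i)) ->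
  recursive (fun t => g [tuple of [seq h t | h <- hs]]).
Proof.
move=> rg rh; apply: rec_ext (rec_comp rg rh) _ => t; congr g.
by apply: eq_from_tnth => i; rewrite tnth_mktuple tnth_map.
Qed.

Lemma rec_app1 (F : nat -> nat) n (f : n.-tuple nat -> nat) :
  recursive (fun t : 1.-tuple nat => F (thead t)) -> recursive f ->
  recursive (fun t => F (f t)).
Proof.
move=> rF rf; have h (i : 'I_1) : recursive (tnth [tuple f] i) by rewrite ord1.
by apply: rec_ext (rec_comp_tuple rF h) _.
Qed.

Lemma rec_var0 n : recursive (fun t : n.+1.-tuple nat => thead t).
Proof. exact: rec_proj ord0. Qed.

Lemma rec_shift n (f : n.-tuple nat -> nat) :
  recursive f -> recursive (fun t : n.+1.-tuple nat => f (behead_tuple t)).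
Proof.
move=> rf; have h (i : 'I_n) := rec_proj (lift ord0 i).
apply: rec_ext (rec_comp rf h) _ => t; congr f.
by apply: eq_from_tnth => i; rewrite tnth_mktuple [t in LHS]tuple_eta tnthS.
Qed.

(** Fixes the treatment of bound variables: they are put in front of the tuple of parameters, here
    the index and then the accumulator. *)
Lemma rec_iter n (b g : n.-tuple nat -> nat) (h : n.-tuple nat -> nat -> nat -> nat) :
  recursive b -> recursive g ->
  recursive (fun t : n.+2.-tuple nat =>
    h (behead_tuple (behead_tuple t)) (thead t) (thead (behead_tuple t))) ->
  recursive (fun t => iteri (b t) (h t) (g t)).
Proof.
move=> rb rg rh; have rp := rec_prim rg rh.
have hs (i : 'I_n.+1) : recursive (fun t : n.-tuple nat => tnth [tuple of b t :: t] i).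
  case: (unliftP ord0 i) => [j ->|->].
    by apply: rec_ext (rec_proj j) _ => t; rewrite tnthS.
  by apply: rec_ext rb _ => t; rewrite tnth0.
apply: rec_ext (rec_comp rp hs) _ => t.
have -> : [tuple tnth [tuple of b t :: t] i | i < n.+1] = [tuple of b t :: t].
  by apply: eq_from_tnth => i; rewrite tnth_mktuple.
rewrite theadE; have -> : behead_tuple [tuple of b t :: t] = t by apply: val_inj.
by apply: eq_iteri => i a; congr h; apply: val_inj.
Qed.

Lemma rec_const n c : recursive (fun _ : n.-tuple nat => c).
Proof.
elim: c => [|c IHc]; first exact: rec_zero.
exact: (rec_app1 rec_succ IHc).
Qed.

Lemma rec_S n (f : n.-tuple nat -> nat) : recursive f -> recursive (fun t => (f t).+1).
Proof. exact: (rec_app1 rec_succ). Qed.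

Lemma rec_add n (f g : n.-tuple nat -> nat) :
  recursive f -> recursive g -> recursive (fun t => f t + g t).
Proof.
move=> rf rg; apply: rec_ext (rec_iter (h := fun _ _ a => a.+1) rf rg _) _.
  by apply: rec_S; apply: rec_shift (rec_var0 _).
by move=> t; elim: (f t) => //= i ->.
Qed.

Lemma rec_pred n (f : n.-tuple nat -> nat) : recursive f -> recursive (fun t => (f t).-1).
Proof.
move=> rf; apply: rec_ext (rec_iter (h := fun _ i _ => i) rf (rec_zero _) _) _.
  exact: rec_var0.
by move=> t; case: (f t).
Qed.

Lemma rec_sub n (f g : n.-tuple nat -> nat) :
  recursive f -> recursive g -> recursive (fun t => f t - g t).
Proof.
move=> rf rg; apply: rec_ext (rec_iter (h := fun _ _ a => a.-1) rg rf _) _.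
  by apply: rec_pred; apply: rec_shift (rec_var0 _).
by move=> t; elim: (g t) => /= [|i ->]; rewrite ?subn0 // subnS.
Qed.

(** Inserts an ignored accumulator, so that a body with one bound variable can be iterated. *)
Lemma rec_skip n (F : n.-tuple nat -> nat -> nat) :
  recursive (fun t : n.+1.-tuple nat => F (behead_tuple t) (thead t)) ->
  recursive (fun t : n.+2.-tuple nat => F (behead_tuple (behead_tuple t)) (thead t)).
Proof.
move=> rF; have hs (i : 'I_n.+1) : recursive (fun t : n.+2.-tuple nat =>
    tnth [tuple of thead t :: behead_tuple (behead_tuple t)] i).
  case: (unliftP ord0 i) => [j ->|->].
    by apply: rec_ext (rec_shift (rec_shift (rec_proj j))) _ => t; rewrite tnthS.
  by apply: rec_ext (rec_var0 _) _ => t; rewrite tnth0.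
apply: rec_ext (rec_comp rF hs) _ => t.
have -> : [tuple tnth [tuple of thead t :: behead_tuple (behead_tuple t)] i | i < n.+1] =
    [tuple of thead t :: behead_tuple (behead_tuple t)].
  by apply: eq_from_tnth => i; rewrite tnth_mktuple.
by rewrite theadE; congr F; apply: val_inj.
Qed.

Lemma rec_sum n (b : n.-tuple nat -> nat) (F : n.-tuple nat -> nat -> nat) :
  recursive b -> recursive (fun t : n.+1.-tuple nat => F (behead_tuple t) (thead t)) ->
  recursive (fun t => \sum_(0 <= i < b t) F t i).
Proof.
move=> rb rF.
apply: rec_ext (rec_iter (h := fun t i a => a + F t i) rb (rec_zero _) _) _.
  apply: rec_add; first exact: rec_shift (rec_var0 _).
  exact: rec_skip rF.
by move=> t; elim: (b t) => [|i IHi] /=; rewrite ?big_nil // big_nat_recr //= IHi.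
Qed.

Lemma rec_mul n (f g : n.-tuple nat -> nat) :
  recursive f -> recursive g -> recursive (fun t => f t * g t).
Proof.
move=> rf rg; apply: rec_ext (rec_sum (F := fun t _ => g t) rf (rec_shift rg)) _ => t.
by rewrite sum_nat_const_nat subn0.
Qed.

Lemma rec_negb n (P : n.-tuple nat -> bool) : recb P -> recb (fun t => ~~ P t).
Proof.
by move=> rP; apply: rec_ext (rec_sub (rec_const _ 1) rP) _ => t; case: (P t).
Qed.

Lemma rec_andb n (P Q : n.-tuple nat -> bool) :
  recb P -> recb Q -> recb (fun t => P t && Q t).
Proof.
by move=> rP rQ; apply: rec_ext (rec_mul rP rQ) _ => t; case: (P t); case: (Q t).
Qed.

Lemma rec_orb n (P Q : n.-tuple nat -> bool) :
  recb P -> recb Q -> recb (fun t => P t || Q t).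
Proof.
move=> rP rQ; apply: rec_ext (rec_negb (rec_andb (rec_negb rP) (rec_negb rQ))) _ => t.
by rewrite negb_and !negbK.
Qed.

Lemma rec_implb n (P Q : n.-tuple nat -> bool) :
  recb P -> recb Q -> recb (fun t => P t ==> Q t).
Proof. by move=> rP rQ; apply: rec_ext (rec_orb (rec_negb rP) rQ) _ => t; rewrite implybE. Qed.

Lemma rec_leq n (f g : n.-tuple nat -> nat) :
  recursive f -> recursive g -> recb (fun t => f t <= g t).
Proof.
move=> rf rg; apply: rec_ext (rec_sub (rec_const _ 1) (rec_sub rf rg)) _ => t.
by rewrite -[f t <= g t]subn_eq0; case: (f t - g t) => [|[]].
Qed.

Lemma rec_eq n (f g : n.-tuple nat -> nat) :
  recursive f -> recursive g -> recb (fun t => f t == g t).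
Proof.
move=> rf rg; apply: rec_ext (rec_andb (rec_leq rf rg) (rec_leq rg rf)) _ => t.
by rewrite eqn_leq.
Qed.

Lemma rec_if n (P : n.-tuple nat -> bool) (f g : n.-tuple nat -> nat) :
  recb P -> recursive f -> recursive g -> recursive (fun t => if P t then f t else g t).
Proof.
move=> rP rf rg; apply: rec_ext (rec_add (rec_mul rP rf) (rec_mul (rec_negb rP) rg)) _ => t.
by case: (P t); rewrite !(mul1n, mul0n, addn0).
Qed.

Lemma rec_has n (b : n.-tuple nat -> nat) (P : n.-tuple nat -> nat -> bool) :
  recursive b -> recb (fun t : n.+1.-tuple nat => P (behead_tuple t) (thead t)) ->
  recb (fun t => has (P t) (iota 0 (b t))).
Proof.
move=> rb rP; have rs := rec_sum (F := fun t i => P t i) rb rP.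
apply: rec_ext (rec_leq (rec_const _ 1) rs) _ => t; congr nat_of_bool.
rewrite has_count -sum1_count /index_iota subn0.
by congr leq; rewrite [RHS]big_mkcond; apply: eq_bigr => i _; case: (P t i).
Qed.

Lemma rec_all n (b : n.-tuple nat -> nat) (P : n.-tuple nat -> nat -> bool) :
  recursive b -> recb (fun t : n.+1.-tuple nat => P (behead_tuple t) (thead t)) ->
  recb (fun t => all (P t) (iota 0 (b t))).
Proof.
move=> rb rP; apply: rec_ext (rec_negb (rec_has (P := fun t i => ~~ P t i) rb (rec_negb rP))) _.
by move=> t; rewrite has_predC negbK.
Qed.

Lemma find_iotaS (P : pred nat) b : find P (iota 0 b.+1) =
  if find P (iota 0 b) < b then find P (iota 0 b) else if P b then b else b.+1.
Proof.
rewrite -addn1 iotaD find_cat has_find !size_iota /= add0n.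
by case: ifP => // _; case: (P b); rewrite ?addn0 ?addn1.
Qed.

(** The first solution below the bound equals the number of [i] such that no [j <= i] is a solution;
    if there is none this is the bound itself, as for [find]. *)
Lemma rec_find n (b : n.-tuple nat -> nat) (P : n.-tuple nat -> nat -> bool) :
  recursive b -> recb (fun t : n.+1.-tuple nat => P (behead_tuple t) (thead t)) ->
  recursive (fun t => find (P t) (iota 0 (b t))).
Proof.
move=> rb rP.
have rs := rec_sum (F := fun t i => all (fun j => ~~ P t j) (iota 0 i.+1)) rb.
apply: rec_ext (rs _) _.
  apply: (rec_all (P := fun (t : n.+1.-tuple nat) j => ~~ P (behead_tuple t) j)).
    exact: rec_S (rec_var0 _).
  apply: rec_negb.
  exact: (rec_skip (F := fun t i => nat_of_bool (P t i)) rP).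
move=> t; elim: (b t) => [|i IHi]; first by rewrite big_nil.
rewrite big_nat_recr // IHi find_iotaS all_predC; set fi := find _ _.
have hi : has (P t) (iota 0 i) = (fi < i) by rewrite has_find size_iota.
have le : fi <= i by rewrite -[X in _ <= X](size_iota 0 i) find_size.
rewrite -addn1 iotaD has_cat hi /= add0n orbF; case: ltngtP le => //= [_ _|-> _].
  by rewrite addn0.
by case: (P t i); rewrite ?addn0 ?addn1.
Qed.

Lemma find_iotaP (P : pred nat) b x : x < b -> P x -> (forall y, y < x -> ~~ P y) ->
  find P (iota 0 b) = x.
Proof.
move=> xb Px hx; have hs : has P (iota 0 b) by apply/hasP; exists x; rewrite ?mem_iota.
have fb : find P (iota 0 b) < b by rewrite -[X in _ < X](size_iota 0 b) -has_find.
have := nth_find 0 hs; rewrite nth_iota // add0n => Pf.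
apply/eqP; rewrite eqn_leq; apply/andP; split.
  rewrite leqNgt; apply/negP => /(before_find 0); rewrite nth_iota ?add0n ?Px //.
by rewrite leqNgt; apply/negP => /hx; rewrite Pf.
Qed.

Lemma rec_exp2 n (f : n.-tuple nat -> nat) : recursive f -> recursive (fun t => 2 ^ f t).
Proof.
move=> rf; apply: rec_ext (rec_iter (h := fun _ _ a => a + a) rf (rec_const _ 1) _) _.
  by apply: rec_add; apply: rec_shift (rec_var0 _).
by move=> t; elim: (f t) => //= i ->; rewrite addnn expnS mul2n.
Qed.

Lemma rec_half n (f : n.-tuple nat -> nat) : recursive f -> recursive (fun t => (f t)./2).
Proof.
move=> rf; have rP := rec_leq (rec_S (rec_shift rf)) (rec_S (rec_S (rec_add (rec_var0 n) (rec_var0 n)))).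
apply: rec_ext (rec_find (P := fun t i => f t < (i + i).+2) (rec_S rf) rP) _ => t.
apply: find_iotaP; first by rewrite ltnS -divn2 leq_div.
  by rewrite addnn -doubleS -ltn_half_double.
by move=> y; rewrite addnn -doubleS -ltn_half_double -leqNgt.
Qed.

Lemma rec_odd n (f : n.-tuple nat -> nat) : recursive f -> recb (fun t => odd (f t)).
Proof.
move=> rf; have rh := rec_half rf.
apply: rec_ext (rec_negb (rec_eq rf (rec_add rh rh))) _ => t; congr nat_of_bool.
by rewrite addnn -{1}(odd_double_half (f t)) -[X in _ == X]add0n eqn_add2r eqb0 negbK.
Qed.

Lemma rec_hf_mem n (f g : n.-tuple nat -> nat) :
  recursive f -> recursive g -> recb (fun t => hf_mem (f t) (g t)).
Proof.
move=> rf rg.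
have ri := rec_iter (h := fun _ _ a => a./2) rf rg (rec_half (rec_shift (rec_var0 _))).
apply: rec_ext (rec_odd ri) _ => t; rewrite /hf_mem; congr (nat_of_bool (odd _)).
by elim: (f t) => [|i /= ->]; rewrite ?expn0 ?divn1 //= -divn2 -divnMA expnSr.
Qed.

(** * Decoding pairs, sequences and sets *)

Lemma hset1 x : hset [:: x] = 2 ^ x.
Proof. by rewrite /hset /= big_seq1. Qed.

Lemma hset2 x y : hset [:: x; y] = if x == y then 2 ^ x else 2 ^ x + 2 ^ y.
Proof.
rewrite /hset /= inE; case: eqP => [->|_]; first by rewrite big_seq1.
by rewrite big_cons big_seq1.
Qed.

Lemma rec_hset2 n (f g : n.-tuple nat -> nat) :
  recursive f -> recursive g -> recursive (fun t => hset [:: f t; g t]).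
Proof.
move=> rf rg; apply: rec_ext (rec_if (rec_eq rf rg) (rec_exp2 rf)
  (rec_add (rec_exp2 rf) (rec_exp2 rg))) _ => t.
by rewrite hset2.
Qed.

Lemma rec_hpair n (f g : n.-tuple nat -> nat) :
  recursive f -> recursive g -> recursive (fun t => hpair (f t) (g t)).
Proof.
move=> rf rg; apply: rec_ext (rec_hset2 (rec_exp2 rf) (rec_hset2 rf rg)) _ => t.
by rewrite /hpair hset1.
Qed.

Lemma hset_inj s1 s2 : hset s1 = hset s2 -> s1 =i s2.
Proof. by move=> e z; rewrite -!mem_hset e. Qed.

Lemma hpair_inj x y x' y' : hpair x y = hpair x' y' -> x = x' /\ y = y'.
Proof.
move=> /hset_inj e.
have xx : x = x'.
  have := e (hset [:: x]); rewrite !inE eqxx /= => /esym/orP[]/eqP/hset_inj/(_ x').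
    by rewrite !inE eqxx => /eqP.
  by rewrite !inE eqxx /= => /eqP.
split=> //; rewrite -{}xx {x'} in e.
have : hset [:: x; y] \in [:: hset [:: x]; hset [:: x; y']] by rewrite -e !inE eqxx orbT.
have : hset [:: x; y'] \in [:: hset [:: x]; hset [:: x; y]] by rewrite e !inE eqxx orbT.
rewrite !inE => /orP[]/eqP/hset_inj h1 /orP[]/eqP/hset_inj h2.
- have := h1 y'; have := h2 y; rewrite !inE !eqxx !orbT => /esym/eqP -> /esym/eqP -> //.
- have := h1 y'; rewrite !inE eqxx orbT => /esym/eqP y'x.
  by have := h2 y; rewrite !inE eqxx orbT y'x orbb => /esym/eqP.
- have := h2 y; rewrite !inE eqxx orbT => /esym/eqP yx.
  by have := h1 y'; rewrite !inE eqxx orbT yx orbb => /esym/eqP.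
- have := h2 y; rewrite !inE eqxx orbT => /esym/orP[]/eqP // yx.
  by have := h1 y'; rewrite !inE eqxx orbT yx orbb => /esym/eqP.
Qed.

Lemma hpair_gt x y : x < hpair x y /\ y < hpair x y.
Proof.
have lt : hset [:: x; y] < hpair x y by apply: hf_mem_lt; rewrite mem_hset !inE eqxx orbT.
by split; apply: ltn_trans lt; apply: hf_mem_lt; rewrite mem_hset !inE eqxx ?orbT.
Qed.

(** A pair exceeds both of its components, so decoding is a search below [w]. *)
Definition hfst (w : HF) : HF :=
  find (fun x => has (fun y => w == hpair x y) (iota 0 w)) (iota 0 w).

Definition hsnd (w : HF) : HF :=
  find (fun y => has (fun x => w == hpair x y) (iota 0 w)) (iota 0 w).

Lemma hfst_pair x y : hfst (hpair x y) = x.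
Proof.
have [xp yp] := hpair_gt x y; apply: find_iotaP => //.
  by apply/hasP; exists y; rewrite ?mem_iota.
by move=> z zx; apply/hasPn => y' _; apply/eqP => /hpair_inj[xz _]; rewrite xz ltnn in zx.
Qed.

Lemma hsnd_pair x y : hsnd (hpair x y) = y.
Proof.
have [xp yp] := hpair_gt x y; apply: find_iotaP => //.
  by apply/hasP; exists x; rewrite ?mem_iota.
by move=> z zx; apply/hasPn => y' _; apply/eqP => /hpair_inj[_ xz]; rewrite xz ltnn in zx.
Qed.

Fixpoint hnth (i : nat) (w : HF) : HF := if i is j.+1 then hnth j (hsnd w) else hfst w.

Lemma hnth_hseq i s : i < size s -> hnth i (hseq s) = nth 0 s i.
Proof.
elim: i s => [|i IHi] [|x s] //= lt; first by rewrite hfst_pair.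
by rewrite hsnd_pair IHi.
Qed.

(** A set given by its binary digits, which makes it a bounded sum and so recursive without any
    list. *)
Definition hsetof (b : nat) (P : pred nat) : HF := \sum_(0 <= h < b) (if P h then 2 ^ h else 0).

Lemma mem_hsetof z b P : hf_mem z (hsetof b P) = (z < b) && P z.
Proof.
rewrite /hsetof -big_mkcond /= -big_filter.
have -> : \sum_(h <- [seq h <- index_iota 0 b | P h]) 2 ^ h =
    hset [seq h <- index_iota 0 b | P h].
  by rewrite /hset undup_id // filter_uniq // iota_uniq.
by rewrite mem_hset mem_filter mem_index_iota andbC.
Qed.

Lemma rec_hsetof n (b : n.-tuple nat -> nat) (P : n.-tuple nat -> nat -> bool) :
  recursive b -> recb (fun t : n.+1.-tuple nat => P (behead_tuple t) (thead t)) ->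
  recursive (fun t => hsetof (b t) (P t)).
Proof.
move=> rb rP; apply: (rec_sum (F := fun t h => if P t h then 2 ^ h else 0)) => //.
apply: rec_if => //; [exact: rec_exp2 (rec_var0 _)|exact: rec_zero].
Qed.

Lemma rec_hfst n (f : n.-tuple nat -> nat) : recursive f -> recursive (fun t => hfst (f t)).
Proof.
move=> rf; apply: (rec_find (P := fun t x => has (fun y => f t == hpair x y) (iota 0 (f t)))) => //.
apply: (rec_has (P := fun (t : n.+1.-tuple nat) y => f (behead_tuple t) == hpair (thead t) y)).
  exact: rec_shift.
apply: rec_eq; first exact: (rec_shift (rec_shift rf)).
by apply: rec_hpair; [apply: rec_shift|]; exact: rec_var0.
Qed.

Lemma rec_hsnd n (f : n.-tuple nat -> nat) : recursive f -> recursive (fun t => hsnd (f t)).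
Proof.
move=> rf; apply: (rec_find (P := fun t x => has (fun y => f t == hpair y x) (iota 0 (f t)))) => //.
apply: (rec_has (P := fun (t : n.+1.-tuple nat) y => f (behead_tuple t) == hpair y (thead t))).
  exact: rec_shift.
apply: rec_eq; first exact: (rec_shift (rec_shift rf)).
by apply: rec_hpair; [|apply: rec_shift]; exact: rec_var0.
Qed.

Lemma rec_hnth i n (f : n.-tuple nat -> nat) : recursive f -> recursive (fun t => hnth i (f t)).
Proof. by elim: i f => [|i IHi] f rf; [exact: rec_hfst|apply: IHi; exact: rec_hsnd]. Qed.

End Recursive.

(** * The coloring of a finite window *)

(* A finite multigraph on the vertices [0, .., sz - 1] with its cells; the other naturals are
   junk, on which [nadj] and [ncell] are false. *)
Record nstr := NStr {
  sz : nat;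
  nadj : rel nat;
  nmul : nat -> nat -> nat;
  ncell : nat -> pred nat }.

Section Stages.
Variables (k p s : nat) (X : nstr).

(** Peeling one color in [extend_col] takes a layer of width 4, and fewer than or exactly
    [k + p * s] colors are peeled; the extra 1 is the step from [rho i] to the component radius
    [(rho i).+1]. *)
Definition gap : nat := (4 * (k + p * s)).+1.

Definition rho (i : nat) : nat := gap * (s - i).

Fixpoint close_to (i r : nat) (x : nat) : bool :=
  if r is r'.+1 then
    close_to i r' x || has (fun y => nadj X x y && close_to i r' y) (iota 0 (sz X))
  else ncell X i x.

Fixpoint upto (i r : nat) (x : nat) : bool :=
  if i is i'.+1 then upto i' r x || close_to i' r x else false.

(** Closed sets replace paths in the definition of components: sets of vertices are the numbers
    below [2 ^ sz X], so quantifying over them is bounded. *)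
Definition closed_set (i r : nat) (Z : HF) : bool :=
  all (fun a => all (fun b =>
    [&& hf_mem a Z, close_to i r a, close_to i r b & nadj X a b] ==> hf_mem b Z)
    (iota 0 (sz X))) (iota 0 (sz X)).

(* The connected component of [x] in the subgraph induced on [close_to i r]. *)
Definition ccomp (i r x y : nat) : bool :=
  all (fun Z => hf_mem x Z && closed_set i r Z ==> hf_mem y Z) (iota 0 (2 ^ sz X)).

(** Unlike the number of a vertex, its rank in the component is the same in all windows that contain
    the component. *)
Definition rank (i r x y : nat) : nat := \sum_(0 <= c < y) ccomp i r x c.

Definition quad (a b j c : nat) : HF := hpair a (hpair b (hpair j c)).

(** A missing entry yields [q], which is not a color. *)
Definition col (q : nat) (z : HF) (a b j : nat) : nat :=
  find (fun c => hf_mem (quad a b j c) z) (iota 0 q).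

(* [z] codes a proper coloring of the component of [x], read through ranks so that it does not
   depend on the names of the vertices, which agrees with [old] near the previous cells. *)
Definition valid (i : nat) (old : nat -> nat -> nat -> nat) (x : nat) (z : HF) : bool :=
  let q := k + p * i in
  let r := (rho i).+1 in
  let c a b j := col q z (rank i r x a) (rank i r x b) j in
  all (fun a => all (fun b => all (fun j =>
    [&& ccomp i r x a, ccomp i r x b & j < nmul X a b] ==>
    [&& c a b j < q, c a b j == c b a j,
        upto i r a && upto i r b ==> (c a b j == old a b j) &
        all (fun d => all (fun l =>
          [&& ccomp i r x d, l < nmul X a d & c a b j == c a d l] ==> (b == d) && (j == l))
          (iota 0 p)) (iota 0 (sz X))])
    (iota 0 p)) (iota 0 (sz X))) (iota 0 (sz X)).

(** Every quadruple with entries in these ranges is at most the sum, so all sets of such quadruples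
    have codes below the bound. *)
Definition zbound (q : nat) : nat :=
  2 ^ (\sum_(0 <= a < sz X) \sum_(0 <= b < sz X) \sum_(0 <= j < p) \sum_(0 <= c < q)
         quad a b j c).+1.

Definition pick_col (i : nat) (old : nat -> nat -> nat -> nat) (x : nat) : HF :=
  find (valid i old x) (iota 0 (zbound (k + p * i))).

(** Colors are replaced within radius [rho i'], although the code covers radius [(rho i').+1]. The
    margin is needed at the border: an edge from a recolored vertex to one that is only near earlier
    cells lies in the component, and there the code repeats the old color. *)
Fixpoint stage (i x y j : nat) : nat :=
  if i is i'.+1 then
    if close_to i' (rho i') x && close_to i' (rho i') y then
      col (k + p * i') (pick_col i' (stage i') x)
        (rank i' (rho i').+1 x x) (rank i' (rho i').+1 x y) j
    else stage i' x y j
  else 0.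

Fixpoint lab (i y : nat) : HF :=
  if i is i'.+1 then if ncell X i' y then hpair i' (rank i' 1 y y) else lab i' y else 0.

Definition out_pair (x b j : nat) : HF := hpair (lab s.+1 b) (stage s.+1 x b j).

Definition out (x : nat) : HF := hpair (lab s.+1 x)
  (hsetof (\sum_(0 <= b < sz X) \sum_(0 <= j < p) (out_pair x b j).+1)
    (fun h => has (fun b => has (fun j => (j < nmul X x b) && (h == out_pair x b j))
      (iota 0 p)) (iota 0 (sz X)))).

End Stages.

(** The symbol of index [j'] stands for multiplicity [j'.+1]; the offset 3 skips the vertex set, the
    adjacency and the order. *)
Fixpoint mul_code (j : nat) (w : HF) (x y : nat) : nat :=
  if j is j'.+1 then
    if hf_mem (hpair x (hpair y 0)) (hnth (3 + j') w) then j else mul_code j' w x y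
  else 0.

(** The positions are those of [code_input]. The order of the input has become the usual order of
    the numbers. *)
Definition str_of (p s : nat) (w : HF) : nstr := NStr
  (find (fun x => ~~ hf_mem x (hnth 0 w)) (iota 0 w))
  (fun x y => hf_mem (hpair x y) (hnth 1 w))
  (fun x y => if hf_mem (hpair x y) (hnth 1 w) then mul_code p w x y else 0)
  (fun i x => (i <= s) && hf_mem x (hnth (3 + p + i) w)).

Definition run_code (k p s : nat) (w : HF) : HF :=
  let X := str_of p s w in
  hsetof (\sum_(0 <= i < sz X) (hpair i (out k p s X i)).+1)
    (fun z => has (fun i => hf_mem i (hnth (4 + p + s) w) && (z == hpair i (out k p s X i)))
      (iota 0 (sz X))).

(** [valid] nests six bound variables, the code and [a], [b], [j], [d], [l]; hence up to six
    shifts. *)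
Ltac rec_leaf :=
  match goal with
  | |- recursive (fun _ => ?c) => exact (rec_const _ c)
  | H : recursive _ |- _ => first [exact H
      | exact (rec_shift H)
      | exact (rec_shift (rec_shift H))
      | exact (rec_shift (rec_shift (rec_shift H)))
      | exact (rec_shift (rec_shift (rec_shift (rec_shift H))))
      | exact (rec_shift (rec_shift (rec_shift (rec_shift (rec_shift H)))))
      | exact (rec_shift (rec_shift (rec_shift (rec_shift (rec_shift (rec_shift H))))))]
  | |- _ => first [exact (rec_var0 _)
      | exact (rec_shift (rec_var0 _))
      | exact (rec_shift (rec_shift (rec_var0 _)))
      | exact (rec_shift (rec_shift (rec_shift (rec_var0 _))))
      | exact (rec_shift (rec_shift (rec_shift (rec_shift (rec_var0 _)))))
      | exact (rec_shift (rec_shift (rec_shift (rec_shift (rec_shift (rec_var0 _))))))]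
  end.

Ltac rec_step := cbv beta; first
  [ rec_leaf | eapply rec_S | eapply rec_hpair | eapply rec_hf_mem | eapply rec_hnth
  | eapply rec_exp2 | eapply rec_has | eapply rec_all | eapply rec_find | eapply rec_hsetof
  | eapply rec_sum
  | eapply rec_leq | eapply rec_eq | eapply rec_andb | eapply rec_orb | eapply rec_negb
  | eapply rec_implb | eapply rec_if | eapply rec_add ].

(** * Recursiveness of the stages and of the output *)

Section RecursiveStages.
Variables (k p s : nat).

Local Notation S w := (str_of p s w).

Lemma rec_sz n (fw : n.-tuple nat -> nat) : recursive fw -> recursive (fun t => sz (S (fw t))).
Proof. move=> rw; rewrite /=; repeat rec_step. Qed.

Lemma rec_nadj n (fw fx fy : n.-tuple nat -> nat) :
  recursive fw -> recursive fx -> recursive fy ->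
  recb (fun t => nadj (S (fw t)) (fx t) (fy t)).
Proof. move=> rw rx ry; rewrite /=; repeat rec_step. Qed.

Lemma rec_nmul n (fw fx fy : n.-tuple nat -> nat) :
  recursive fw -> recursive fx -> recursive fy ->
  recursive (fun t => nmul (S (fw t)) (fx t) (fy t)).
Proof.
move=> rw rx ry; rewrite /=; apply: rec_if; [by repeat rec_step| |exact: rec_zero].
by elim: (p) => [|j IHj]; [exact: rec_zero|rewrite /mul_code -/mul_code; repeat rec_step].
Qed.

Lemma rec_ncell i n (fw fx : n.-tuple nat -> nat) :
  recursive fw -> recursive fx -> recb (fun t => ncell (S (fw t)) i (fx t)).
Proof. move=> rw rx; rewrite /ncell /str_of; repeat rec_step. Qed.

Lemma rec_near i r n (fw fx : n.-tuple nat -> nat) :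
  recursive fw -> recursive fx -> recb (fun t => close_to (S (fw t)) i r (fx t)).
Proof.
elim: r n fw fx => [|r IHr] n fw fx rw rx; first exact: rec_ncell.
rewrite /close_to -/close_to; apply: rec_orb; first exact: IHr.
apply: rec_has; first exact: rec_sz.
by apply: rec_andb; [apply: rec_nadj|apply: IHr]; repeat rec_step.
Qed.

Lemma rec_upto i r n (fw fx : n.-tuple nat -> nat) :
  recursive fw -> recursive fx -> recb (fun t => upto (S (fw t)) i r (fx t)).
Proof.
move=> rw rx; elim: i => [|i IHi]; first exact: rec_zero.
by rewrite /upto -/upto; apply: rec_orb => //; exact: rec_near.
Qed.

Lemma rec_comp_set i r n (fw fx fy : n.-tuple nat -> nat) :
  recursive fw -> recursive fx -> recursive fy ->
  recb (fun t => ccomp (S (fw t)) i r (fx t) (fy t)).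
Proof.
move=> rw rx ry; apply: rec_all; first exact: rec_exp2 (rec_sz rw).
apply: rec_implb; last by repeat rec_step.
apply: rec_andb; first by repeat rec_step.
by do 2!(apply: rec_all; first by apply: rec_sz; repeat rec_step);
  repeat first [rec_leaf | apply: rec_near | apply: rec_nadj | rec_step].
Qed.

Lemma rec_rank i r n (fw fx fy : n.-tuple nat -> nat) :
  recursive fw -> recursive fx -> recursive fy ->
  recursive (fun t => rank (S (fw t)) i r (fx t) (fy t)).
Proof.
by move=> rw rx ry; apply: rec_sum => //; apply: rec_comp_set; repeat rec_step.
Qed.

Lemma rec_col q n (fz fa fb fj : n.-tuple nat -> nat) :
  recursive fz -> recursive fa -> recursive fb -> recursive fj ->
  recursive (fun t => col q (fz t) (fa t) (fb t) (fj t)).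
Proof. by move=> rz ra rb rj; rewrite /col /quad; repeat rec_step. Qed.

Ltac rec_num := repeat (cbv beta; first [rec_leaf | eapply rec_sz | eapply rec_nadj
  | eapply rec_nmul | eapply rec_ncell | eapply rec_near | eapply rec_upto
  | eapply rec_comp_set | eapply rec_rank | eapply rec_col | rec_step]).

Lemma rec_stage i n (fw fx fy fj : n.-tuple nat -> nat) :
  recursive fw -> recursive fx -> recursive fy -> recursive fj ->
  recursive (fun t => stage k p s (S (fw t)) i (fx t) (fy t) (fj t)).
Proof.
elim: i n fw fx fy fj => [|i IHi] n fw fx fy fj rw rx ry rj; first exact: rec_zero.
rewrite /stage -/stage; apply: rec_if; [by rec_num| |exact: IHi].
apply: rec_col; [|by rec_num..].
apply: rec_find; first by rewrite /zbound /quad; rec_num.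
rewrite /valid; repeat (cbv beta; first [rec_leaf | eapply IHi | eapply rec_sz
  | eapply rec_nmul | eapply rec_upto
  | eapply rec_comp_set | eapply rec_rank | eapply rec_col | rec_step]).
Qed.

Lemma rec_lab i n (fw fx : n.-tuple nat -> nat) :
  recursive fw -> recursive fx -> recursive (fun t => lab (S (fw t)) i (fx t)).
Proof.
move=> rw rx; elim: i => [|i IHi]; first exact: rec_zero.
by rewrite /lab -/lab; apply: rec_if => //; rec_num.
Qed.

Lemma rec_out n (fw fx : n.-tuple nat -> nat) :
  recursive fw -> recursive fx -> recursive (fun t => out k p s (S (fw t)) (fx t)).
Proof.
move=> rw rx; rewrite /out /out_pair.
by repeat (cbv beta; first [rec_leaf | eapply rec_stage | eapply rec_lab | eapply rec_sz
  | eapply rec_nmul | rec_step]).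
Qed.

Lemma rec_run_code n (fw : n.-tuple nat -> nat) :
  recursive fw -> recursive (fun t => run_code k p s (fw t)).
Proof.
move=> rw; apply: rec_hsetof.
  apply: rec_sum; first exact: rec_sz.
  by apply: rec_S; apply: rec_hpair; [|apply: rec_out]; rec_leaf.
apply: rec_has; first by apply: rec_sz; rec_leaf.
apply: rec_andb; first by apply: rec_hf_mem; [|apply: rec_hnth]; rec_leaf.
by apply: rec_eq; [|apply: rec_hpair; [|apply: rec_out]]; rec_leaf.
Qed.

End RecursiveStages.

(** * From indexed parallel edges to sets of colors *)

Section SetsOfColors.
Import mathcomp.boot.fintype mathcomp.boot.finset.
Variables (V : finType) (q : nat).
Implicit Types (M : V -> V -> nat) (f : V -> V -> nat -> nat).

Definition color_set M f (x y : V) : {set 'I_q} :=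
  [set c : 'I_q | has (fun j => f x y j == c) (iota 0 (M x y))].

Lemma mem_color_set M f x y (c : 'I_q) :
  reflect (exists2 j, j < M x y & f x y j = c) (c \in color_set M f x y).
Proof.
rewrite inE; apply: (iffP hasP) => [[j + /eqP]|[j jM e]].
  by rewrite mem_iota add0n => jM e; exists j.
by exists j; [rewrite mem_iota|apply/eqP].
Qed.

Lemma full_col_of_coloring p q0 M f : q0 <= q -> multigraph p M ->
  proper_edge_coloring M q0 f ->
  full_col [set c : 'I_q | c < q0] (color_set M f) M.
Proof.
move=> q0q [Msym Mirr _] [fs fq fp]; split; first split.
- move=> x y; apply/setP => c; apply/mem_color_set/mem_color_set => -[j jM e].
    by exists j; [rewrite Msym|rewrite -fs].
  by exists j; [rewrite Msym|rewrite -fs].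
- by move=> x; apply/setP => c; rewrite !inE Mirr.
- move=> x y; apply/fintype.subsetP => c /mem_color_set[j jM e].
  by rewrite inE -e fq.
- move=> x y z c /mem_color_set[j jM e] /mem_color_set[l lM e'].
  by have [] := fp x y z j l jM lM (etrans e (esym e')).
move=> x y.
have fb (j : 'I_(M x y)) : f x y j < q by apply: leq_trans q0q; exact: fq.
have -> : color_set M f x y = [set Ordinal (fb j) | j in 'I_(M x y)].
  apply/setP => c; apply/mem_color_set/imsetP => [[j jM e]|[j _ ->]].
    by exists (Ordinal jM) => //; apply: val_inj; rewrite /= e.
  by exists j.
rewrite card_imset ?card_ord // => i j [e]; apply: val_inj => /=.
by have [] := fp x y y i j (ltn_ord i) (ltn_ord j) e.
Qed.

End SetsOfColors.

(** * Properness of the stages on a finite structure *)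

Section Numeric.
Variables (k p s : nat).

Record wf (X : nstr) : Prop := Wf {
  wf_sym : symmetric (nadj X);
  wf_lt : forall x y, nadj X x y -> x < sz X;
  wf_mulC : forall x y, nmul X x y = nmul X y x;
  wf_mulp : forall x y, nmul X x y <= p;
  wf_adj : forall x y, nadj X x y = (0 < nmul X x y);
  wf_irr : forall x, nmul X x x = 0;
  wf_cell_lt : forall i x, ncell X i x -> x < sz X;
  wf_cell : forall x, x < sz X -> exists2 i, i <= s & ncell X i x;
  wf_cell_uniq : forall i j x, ncell X i x -> ncell X j x -> i = j;
  wf_col : edge_colorable (nmul X) k }.

Variable X : nstr.
Hypothesis wfX : wf X.
Local Notation n := (sz X).

Lemma nmul_lt x y j : j < nmul X x y -> x < n /\ y < n.
Proof.
move=> h; have xy : nadj X x y by rewrite (wf_adj wfX); exact: leq_ltn_trans h.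
by split; [exact: (wf_lt wfX xy)|move: xy; rewrite (wf_sym wfX); exact: (wf_lt wfX)].
Qed.

Lemma near_lt i r x : close_to X i r x -> x < n.
Proof.
elim: r => [|r IHr] /=; first exact: (wf_cell_lt wfX).
by case/orP => [/IHr //|/hasP[y _ /andP[/(wf_lt wfX)]]].
Qed.

Lemma near_mono i r r' x : r <= r' -> close_to X i r x -> close_to X i r' x.
Proof.
elim: r' => [|r' IHr']; first by rewrite leqn0 => /eqP ->.
by rewrite leq_eqVlt => /orP[/eqP -> //|/IHr' h /h /= ->].
Qed.

Lemma near_adj i r x y : nadj X x y -> close_to X i r y -> close_to X i r.+1 x.
Proof.
move=> xy ny; apply/orP; right; apply/hasP; exists y; last by rewrite xy.
by rewrite mem_iota (near_lt ny).
Qed.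

Lemma uptoP i r x : reflect (exists2 i', i' < i & close_to X i' r x) (upto X i r x).
Proof.
apply: (iffP idP) => [|[i' + nx]].
  elim: i => //= i IHi /orP[/IHi[i' ii nx]|nx]; last by exists i.
  by exists i' => //; exact: ltnW.
elim: i => //= i IHi; rewrite ltnS leq_eqVlt => /orP[/eqP <-|/IHi ->//].
by rewrite nx orbT.
Qed.

Lemma upto_mono i r r' x : r <= r' -> upto X i r x -> upto X i r' x.
Proof. by move=> rr /uptoP[i' ii nx]; apply/uptoP; exists i' => //; exact: near_mono nx. Qed.

Lemma upto_adj i r x y : nadj X x y -> upto X i r y -> upto X i r.+1 x.
Proof. by move=> xy /uptoP[i' ii nx]; apply/uptoP; exists i' => //; exact: near_adj nx. Qed.

Definition near_step i r : rel nat := fun a b => [&& close_to X i r a, close_to X i r b & nadj X a b].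

(** The set of vertices reachable by paths is closed and has a code below [2 ^ n], so it is one of
    the sets tested by [ccomp]. *)
Lemma compP i r x y : x < n ->
  ccomp X i r x y <-> exists q, path (near_step i r) x q /\ last x q = y.
Proof.
move=> xn; split => [/allP h|[q [pq <-]]].
  pose Q y := `[< exists q, path (near_step i r) x q /\ last x q = y >].
  have /h : hset [seq y <- iota 0 n | Q y] \in iota 0 (2 ^ n).
    rewrite mem_iota add0n /hset undup_id ?filter_uniq ?iota_uniq //.
    apply: sum_pow2_lt; first by rewrite filter_uniq ?iota_uniq.
    by apply/allP => z; rewrite mem_filter mem_iota => /and3P[].
  rewrite !mem_hset !mem_filter !mem_iota /= !add0n xn andbT.
  have -> /= : Q x by apply/asboolP; exists [::].
  move=> /implyP h'; have /h' : closed_set X i r (hset [seq y <- iota 0 n | Q y]).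
    apply/allP => a; rewrite mem_iota => an; apply/allP => b; rewrite mem_iota => bn.
    apply/implyP; rewrite !mem_hset !mem_filter !mem_iota => /and4P[/andP[/asboolP[q [pq la]] _]].
    move=> na nb ab; apply/andP; split => //; apply/asboolP.
    by exists (rcons q b); rewrite rcons_path last_rcons pq la /near_step na nb ab.
  by case/andP => /asboolP.
apply/allP => Z _; apply/implyP => /andP[+ cl]; elim: q x xn pq => //= b q IHq x xn.
case/andP => /and3P[nx nb xb] pq xZ; have bn := near_lt nb; apply: IHq => //.
move/allP: cl => /(_ x); rewrite mem_iota xn => /(_ isT)/allP/(_ b); rewrite mem_iota bn.
by move=> /(_ isT)/implyP; apply; rewrite xZ nx nb xb.
Qed.

Lemma comp_refl i r x : x < n -> ccomp X i r x x.
Proof. by move=> xn; apply/(compP _ _ _ xn); exists [::]. Qed.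

Lemma comp_lt i r x y : x < n -> ccomp X i r x y -> y < n.
Proof.
move=> xn /(compP _ _ _ xn)[q [pq <-]]; case/lastP: q pq => // q z.
by rewrite rcons_path last_rcons => /andP[_ /and3P[_ /near_lt]].
Qed.

Lemma comp_trans i r x y z : x < n -> ccomp X i r x y -> ccomp X i r y z -> ccomp X i r x z.
Proof.
move=> xn xy; have yn := comp_lt xn xy; move: xy => /(compP _ _ _ xn)[q [pq lq]].
move=> /(compP _ _ _ yn)[q' [pq' <-]]; apply/(compP _ _ _ xn); exists (q ++ q').
by rewrite cat_path last_cat lq pq.
Qed.

Lemma comp_sym i r x y : x < n -> ccomp X i r x y -> ccomp X i r y x.
Proof.
move=> xn xy; have yn := comp_lt xn xy; move: xy => /(compP _ _ _ xn)[q [pq lq]].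
apply/(compP _ _ _ yn).
have sym : symmetric (near_step i r).
  by move=> a b; rewrite /near_step (wf_sym wfX) andbCA.
have [q' [_ pq' lq']] := dist_le_sym sym (ex_intro _ q (And3 (leqnn (size q)) pq lq)).
by exists q'.
Qed.

Lemma comp_eq i r x y : x < n -> ccomp X i r x y -> ccomp X i r y =1 ccomp X i r x.
Proof.
move=> xn xy z; have yn := comp_lt xn xy; apply/idP/idP => h; first exact: comp_trans xy h.
exact: comp_trans (comp_sym xn xy) h.
Qed.

Lemma comp_step i r x y z : x < n -> ccomp X i r x y -> close_to X i r y -> close_to X i r z ->
  nadj X y z -> ccomp X i r x z.
Proof.
move=> xn xy ny nz yz; apply: comp_trans xy _ => //.
apply/compP; first exact: near_lt ny.
by exists [:: z]; rewrite /= /near_step ny nz yz.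
Qed.

Lemma rank_eq i r x y : x < n -> ccomp X i r x y -> rank X i r y =1 rank X i r x.
Proof.
by move=> xn xy z; apply: eq_bigr => c _; rewrite (comp_eq xn xy).
Qed.

Lemma rank_lt i r x a b : ccomp X i r x a -> a < b -> rank X i r x a < rank X i r x b.
Proof.
move=> xa ab; rewrite /rank [X in _ < X](big_cat_nat (n := a)) //= ?(ltnW ab) //.
by rewrite -addn1 leq_add2l big_ltn // xa.
Qed.

Lemma rank_inj i r x a b : ccomp X i r x a -> ccomp X i r x b ->
  rank X i r x a = rank X i r x b -> a = b.
Proof.
move=> xa xb e; case: (ltngtP a b) => // h.
  by have := rank_lt xa h; rewrite e ltnn.
by have := rank_lt xb h; rewrite e ltnn.
Qed.

Lemma rank_le i r x a : rank X i r x a <= a.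
Proof.
rewrite -[X in _ <= X](subn0 a) -[X in _ <= X]muln1 -sum_nat_const_nat.
by apply: leq_sum => c _; case: ccomp.
Qed.

Variant valid_spec i old x z : Prop := ValidSpec of
  let c a b j := col (k + p * i) z (rank X i (rho k p s i).+1 x a)
    (rank X i (rho k p s i).+1 x b) j in
  let K := ccomp X i (rho k p s i).+1 x in
  forall a b j, K a -> K b -> j < nmul X a b ->
  [/\ c a b j < k + p * i, c a b j = c b a j,
      upto X i (rho k p s i).+1 a -> upto X i (rho k p s i).+1 b -> c a b j = old a b j &
      forall d l, K d -> l < nmul X a d -> c a b j = c a d l -> b = d /\ j = l].

Lemma validP i old x z : x < n -> valid k p s X i old x z <-> valid_spec i old x z.
Proof.
move=> xn; split.
  move=> /allP v; split => c K a b j Ka Kb jm.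
  have an := comp_lt xn Ka; have bn := comp_lt xn Kb.
  have jp := leq_trans jm (wf_mulp wfX a b).
  have := v a; rewrite mem_iota an => /(_ isT)/allP/(_ b).
  rewrite mem_iota bn => /(_ isT)/allP/(_ j).
  rewrite mem_iota jp => /(_ isT); rewrite -/(K a) -/(K b) Ka Kb jm /=.
  case/and4P => lt /eqP sym /implyP old_eq /allP inj; split => //.
    by move=> ua ub; apply/eqP/old_eq; rewrite ua ub.
  move=> d l Kd lm e; have dn := comp_lt xn Kd.
  have lp := leq_trans lm (wf_mulp wfX a d).
  have := inj d; rewrite mem_iota dn => /(_ isT)/allP/(_ l); rewrite mem_iota lp.
  by move=> /(_ isT)/implyP; rewrite -/(K d) Kd lm /= => /(_ (introT eqP e))/andP[/eqP -> /eqP ->].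
case=> h; apply/allP => a _; apply/allP => b _; apply/allP => j _; apply/implyP.
case/and3P => Ka Kb jm; have [lt sym old_eq inj] := h a b j Ka Kb jm.
apply/and4P; split => //; first by apply/eqP.
  by apply/implyP => /andP[ua ub]; apply/eqP; exact: old_eq.
apply/allP => d _; apply/allP => l _; apply/implyP => /and3P[Kd lm /eqP e].
by have [-> ->] := inj d l Kd lm e; rewrite !eqxx.
Qed.

(** The chosen code thus depends on the component only, and both ends of an edge read the same
    one. *)
Lemma valid_eq i old x y z : x < n -> ccomp X i (rho k p s i).+1 x y ->
  valid k p s X i old y z = valid k p s X i old x z.
Proof.
move=> xn xy; rewrite /valid.
have re : rank X i (rho k p s i).+1 y = rank X i (rho k p s i).+1 x.
  by apply/funext; exact: rank_eq.
have ce : ccomp X i (rho k p s i).+1 y = ccomp X i (rho k p s i).+1 x.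
  by apply/funext; exact: comp_eq.
by rewrite re ce.
Qed.

Lemma leq_sum_term (b : nat) (F : nat -> nat) a : a < b -> F a <= \sum_(0 <= i < b) F i.
Proof.
by move=> ab; rewrite (bigD1_seq a) ?iota_uniq ?mem_index_iota //= leq_addr.
Qed.

(** Ranks are injective on the component, so the set of quadruples that records [f] through ranks
    can be read back without ambiguity. *)
Lemma code_exists i old x (f : nat -> nat -> nat -> nat) : x < n ->
  let K := ccomp X i (rho k p s i).+1 x in
  (forall a b j, K a -> K b -> j < nmul X a b ->
    [/\ f a b j < k + p * i, f a b j = f b a j,
      upto X i (rho k p s i).+1 a -> upto X i (rho k p s i).+1 b -> f a b j = old a b j &
      forall d l, K d -> l < nmul X a d -> f a b j = f a d l -> b = d /\ j = l]) ->
  exists2 z, z < zbound p X (k + p * i) & valid k p s X i old x z.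
Proof.
move=> xn K hf; pose rk := rank X i (rho k p s i).+1 x; pose q := k + p * i.
pose L := [seq quad (rk t.1.1) (rk t.1.2) t.2 (f t.1.1 t.1.2 t.2) |
  t <- [seq (ab, j) | ab <- [seq (a, b) | a <- iota 0 n, b <- iota 0 n], j <- iota 0 p] &
    [&& K t.1.1, K t.1.2 & t.2 < nmul X t.1.1 t.1.2]].
have memL a b j c : K a -> K b -> j < nmul X a b ->
    (quad (rk a) (rk b) j c \in L) = (c == f a b j).
  move=> Ka Kb jm; apply/mapP/eqP => [[[[a' b'] j']]|->].
    rewrite mem_filter /= => /andP[/and3P[Ka' Kb' _] _].
    case/hpair_inj => ra /hpair_inj[rb /hpair_inj[-> ->]].
    by rewrite (rank_inj Ka Ka' ra) (rank_inj Kb Kb' rb).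
  exists (a, b, j) => //=; rewrite mem_filter /= Ka Kb jm /=.
  apply/allpairsP; exists ((a, b), j); split => //=.
    apply/allpairsP; exists (a, b); split => //=; rewrite mem_iota add0n.
      exact: comp_lt Ka.
    exact: comp_lt Kb.
  by rewrite mem_iota; exact: leq_trans jm (wf_mulp wfX a b).
have colL a b j : K a -> K b -> j < nmul X a b -> col q (hset L) (rk a) (rk b) j = f a b j.
  move=> Ka Kb jm; have [lt _ _ _] := hf a b j Ka Kb jm.
  apply: find_iotaP => //; first by rewrite mem_hset memL.
  by move=> c cf; rewrite mem_hset memL // neq_ltn cf.
exists (hset L).
  apply: sum_pow2_lt; first exact: undup_uniq.
  apply/allP => c; rewrite mem_undup => /mapP[[[a b] j]]; rewrite mem_filter /=.
  case/andP => /and3P[Ka Kb jm] _ ->; have [lt _ _ _] := hf a b j Ka Kb jm; rewrite ltnS.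
  have an : rk a < n by apply: leq_ltn_trans (rank_le _ _ _ _) (comp_lt xn Ka).
  have bn : rk b < n by apply: leq_ltn_trans (rank_le _ _ _ _) (comp_lt xn Kb).
  have jp := leq_trans jm (wf_mulp wfX a b).
  apply: leq_trans (leq_sum_term _ an); apply: leq_trans (leq_sum_term _ bn).
  apply: leq_trans (leq_sum_term _ jp); exact: (@leq_sum_term _ (fun c => quad _ _ _ c)).
apply/validP => //; split => c K' a b j Ka Kb jm.
have [lt sym old_eq inj] := hf a b j Ka Kb jm.
rewrite /c (colL a b j) // (colL b a j) //; last by rewrite (wf_mulC wfX).
split => // d l Kd lm; rewrite (colL a d l) //; exact: inj.
Qed.

(** For positive [i] the radius is [rho i.-1], that of the last cell treated. The [i.-1] in the
    number of colors reflects that the first cell uses only [k]. *)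
Definition stage_ok i : Prop := forall x y j, j < nmul X x y ->
  let up := upto X i (gap k p s * (s.+1 - i)) in up x -> up y ->
  [/\ stage k p s X i x y j < k + p * i.-1, stage k p s X i x y j = stage k p s X i y x j &
      forall z l, up z -> l < nmul X x z -> stage k p s X i x y j = stage k p s X i x z l ->
        y = z /\ j = l].

Import mathcomp.boot.fintype mathcomp.boot.finset.

Lemma full_col_setT (V : finType) q (P : {set 'I_q}) (S : V -> V -> {set 'I_q}) M :
  full_col P S M -> full_col setT S M.
Proof. by move=> [[sym irr sP dis] cS]; split => //; split => // x y; exact: finset.subsetT. Qed.

Lemma card_ord_lt q q0 : q0 <= q -> #|[set c : 'I_q | c < q0]| = q0.
Proof.
move=> q0q; have inj : injective (widen_ord q0q) by move=> a b [/val_inj].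
rewrite -[RHS]card_ord -(card_imset _ inj).
congr #|pred_of_set _|; apply/setP => c; rewrite inE; apply/idP/imsetP => [h|[d _ ->]].
  by exists (Ordinal h) => //; exact: val_inj.
exact: (ltn_ord d).
Qed.

(** In [extend_col] the given [k]-edge coloring plays [theta] and the previous stage, restricted to
    the component, plays [phi]. *)
Lemma component_col i x : i <= s -> stage_ok i -> x < n ->
  let K := ccomp X i (rho k p s i).+1 x in
  let M (a b : 'I_n) := if K a && K b then nmul X a b else 0 in
  exists S : 'I_n -> 'I_n -> {set 'I_(k + p * i)}, full_col setT S M /\
    forall a b : 'I_n, K a -> K b ->
      upto X i (rho k p s i).+1 a -> upto X i (rho k p s i).+1 b ->
      S a b = color_set (k + p * i) M (fun a b => stage k p s X i a b) a b.
Proof.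
move=> si ok xn K M.
have mM : multigraph p M.
  split => [a b|a|a b]; rewrite /M; first by rewrite andbC (wf_mulC wfX).
    by rewrite (wf_irr wfX) if_same.
  by case: ifP => // _; exact: (wf_mulp wfX).
have MX (a b : 'I_n) j : j < M a b -> [/\ K a, K b & j < nmul X a b].
  by rewrite /M; case: ifP => // /andP[].
have [phi0 [ps pk pp]] := wf_col wfX.
have fth : full_col setT (color_set (k + p * i) M (fun a b => phi0 a b)) M.
  apply: full_col_setT; apply: (full_col_of_coloring (q0 := k) _ mM); first exact: leq_addr.
  split => [a b j /MX[_ _ h]|a b j /MX[_ _ h]|a b d j l /MX[_ _ h] /MX[_ _ h'] e].
  - exact: ps.
  - exact: pk.
  - by have [/val_inj -> ->] := pp _ _ _ _ _ h h' e.
(* No cell precedes the first one, so nothing is prescribed and the given coloring is taken as it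
   is. *)
case: i => [|i] in si ok K M mM MX fth *.
  by exists (color_set (k + p * 0) M (fun a b => phi0 a b)).
pose R := gap k p s * (s.+1 - i.+1); pose k' := k + p * i.
pose N (a b : 'I_n) := if upto X i.+1 R a && upto X i.+1 R b then M a b else 0.
have NM a b j : j < N a b -> [/\ upto X i.+1 R a, upto X i.+1 R b & j < M a b].
  by rewrite /N; case: ifP => // /andP[].
have k'q : k' <= k + p * i.+1 by rewrite leq_add2l leq_mul2l leqnSn orbT.
have [Msym Mirr Mp] := mM.
have [pphi cphi] : full_col [set c : 'I_(k + p * i.+1) | c < k']
    (color_set (k + p * i.+1) N (fun a b => stage k p s X i.+1 a b)) N.
  apply: (full_col_of_coloring (p := p)) => //.
    split => [a b|a|a b]; rewrite /N; first by rewrite andbC Msym.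
      by rewrite Mirr if_same.
    by case: ifP.
  split => [a b j /NM[ua ub /MX[_ _ h]]|a b j /NM[ua ub /MX[_ _ h]]|].
  - by have [] := ok a b j h ua ub.
  - by have [] := ok a b j h ua ub.
  - move=> a b d j l /NM[ua ub /MX[_ _ h]] /NM[_ ud /MX[_ _ h']] e.
    have [_ _ inj] := ok a b j h ua ub.
    by have [/val_inj -> ->] := inj d l ud h' e.
(* [gap] is made for this inequality: the old coloring reaches far enough beyond the part to be kept
   to peel [k'] colors. *)
have radius : (rho k p s i.+1).+1 + 4 * k' <= R.
  rewrite /R /rho subSS -[s - i](subnSK si) mulnS addnC -addSnnS leq_add2r /gap ltnS.
  by rewrite leq_mul2l /= leq_add2l leq_mul2l (ltnW si) orbT.
pose B j := [set a : 'I_n | K a && upto X i.+1 ((rho k p s i.+1).+1 + j) a].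
have NB a b : a \in B (4 * k') -> b \in B (4 * k') -> N a b = M a b.
  rewrite !inE /N => /andP[_ ua] /andP[_ ub].
  by rewrite (upto_mono radius ua) (upto_mono radius ub).
have [|||j|j a b|//|a b|a b aB bB||S [fS eS]] := @extend_col 'I_n 'I_(k + p * i.+1) p k' M
    [set c : 'I_(k + p * i.+1) | c < k'] setT B
    (color_set (k + p * i.+1) N (fun a b => stage k p s X i.+1 a b))
    (color_set (k + p * i.+1) M (fun a b => phi0 a b)) mM.
- exact: card_ord_lt.
- exact: finset.subsetT.
- by rewrite cardsT card_ord mulnS addnCA addnC.
- apply/fintype.subsetP => a; rewrite !inE => /andP[-> ua]; rewrite andTb.
  by apply: upto_mono ua; rewrite leq_add2l.
- rewrite !inE => /andP[Ka ua] /MX[_ Kb ab]; rewrite Kb addnS andTb.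
  by apply: upto_adj ua; rewrite (wf_sym wfX) (wf_adj wfX).
- by rewrite cphi /N; case: ifP.
- by rewrite cphi NB.
- exact: fth.
have B0 (a : 'I_n) : K a -> upto X i.+1 (rho k p s i.+1).+1 a -> a \in B 0.
  by move=> Ka ua; rewrite inE Ka addn0 ua.
have B4 a : a \in B 0 -> a \in B (4 * k').
  by rewrite !inE => /andP[-> ua]; rewrite andTb; apply: upto_mono ua; rewrite leq_add2l.
exists S; split => // a b Ka Kb ua ub; rewrite eS; [|exact: B0..].
by apply/setP => c; rewrite !inE NB //; apply: B4; exact: B0.
Qed.

(** The extension provides only sets of colors. Parallel edges get their old indices back near
    earlier cells; on other pairs any enumeration of the set will do. *)
Lemma valid_exists i x : i <= s -> stage_ok i -> x < n ->
  exists2 z, z < zbound p X (k + p * i) & valid k p s X i (stage k p s X i) x z.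
Proof.
move=> si ok xn; have [S [[[Ssym _ _ Sd] cS] eS]] := component_col si ok xn.
set K := ccomp X i (rho k p s i).+1 x in cS eS *.
set M := (fun a b : 'I_n => _) in cS eS.
set up := upto X i (rho k p s i).+1 in eS *.
pose g (a b : 'I_n) j := if up a && up b then stage k p s X i a b j
  else nth 0 [seq val c | c <- enum (S a b)] j.
have upR a : up a -> upto X i (gap k p s * (s.+1 - i)) a.
  by apply: upto_mono; rewrite subSn // mulnS addnC -addn1 leq_add.
have gS (a b : 'I_n) j : K a -> K b -> j < nmul X a b ->
    exists2 c, c \in S a b & val c = g a b j.
  move=> Ka Kb jm; have jM : j < M a b by rewrite /M Ka Kb.
  rewrite /g; case: ifP => [/andP[ua ub]|_].
    have [lt _ _] := ok a b j jm (upR _ ua) (upR _ ub).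
    have lt' : stage k p s X i a b j < k + p * i.
      by apply: leq_trans lt _; rewrite leq_add2l leq_mul2l leq_pred orbT.
    exists (Ordinal lt') => //; rewrite eS //; apply/mem_color_set.
    by exists j.
  have js : j < size (enum (S a b)) by rewrite -cardE cS.
  have [c0 _] : exists c, c \in S a b by apply/set0Pn; rewrite -card_gt0 cS; exact: leq_ltn_trans jM.
  exists (nth c0 (enum (S a b)) j); first by rewrite -mem_enum mem_nth.
  by rewrite (nth_map c0).
have g_inj (a b : 'I_n) j l : K a -> K b -> j < nmul X a b -> l < nmul X a b ->
    g a b j = g a b l -> j = l.
  move=> Ka Kb jm lm; have jM : j < M a b by rewrite /M Ka Kb.
  have lM : l < M a b by rewrite /M Ka Kb.
  rewrite /g; case: ifP => [/andP[ua ub]|_] e.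
    have [_ _ inj] := ok a b j jm (upR _ ua) (upR _ ub).
    by have [] := inj b l (upR _ ub) lm e.
  have u : uniq [seq val c | c <- enum (S a b)] by rewrite map_inj_uniq ?enum_uniq //; exact: val_inj.
  by apply/eqP; rewrite -(nth_uniq 0 _ _ u) ?e ?size_map -?cardE ?cS.
pose f a b j := if insub a is Some a' then if insub b is Some b' then g a' b' j else 0 else 0.
have fE (a b : 'I_n) j : f a b j = g a b j by rewrite /f !valK.
apply: (code_exists (f := f) xn) => a b j Ka Kb.
have [a' ea] : exists a' : 'I_n, a = a' by exists (Ordinal (comp_lt xn Ka)).
have [b' eb] : exists b' : 'I_n, b = b' by exists (Ordinal (comp_lt xn Kb)).
rewrite {a}ea {b}eb !fE in Ka Kb * => jm; have [c cS' ec] := gS _ _ _ Ka Kb jm.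
split.
- by rewrite -ec; exact: ltn_ord.
- rewrite /g andbC Ssym; case: ifP => // /andP[ub ua].
  by have [] := ok a' b' j jm (upR _ ua) (upR _ ub).
- by move=> ua ub; rewrite /g /up ua ub.
- move=> d l Kd; have [d' ed] : exists d' : 'I_n, d = d' by exists (Ordinal (comp_lt xn Kd)).
  rewrite {d}ed !fE in Kd * => lm e; have [c' cd ec'] := gS _ _ _ Ka Kd lm.
  have cc : c = c' by apply: val_inj; rewrite ec ec'.
  have bd : b' = d' by apply: Sd cS' _; rewrite cc.
  by split; [rewrite bd|apply: (g_inj a' b') => //; rewrite ?bd // -e bd].
Qed.

Lemma pick_valid i x : i <= s -> stage_ok i -> x < n ->
  valid k p s X i (stage k p s X i) x (pick_col k p s X i (stage k p s X i) x).
Proof.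
move=> si ok xn; have [z zb vz] := valid_exists si ok xn.
have hz : has (valid k p s X i (stage k p s X i) x) (iota 0 (zbound p X (k + p * i))).
  by apply/hasP; exists z; rewrite ?mem_iota.
have := nth_find 0 hz; rewrite nth_iota ?add0n //.
by move: hz; rewrite has_find size_iota.
Qed.

(** At a vertex within [rho i] of the new cell all its relevant edges obey the chosen code; at any
    other vertex they keep their old colors. *)
Lemma stage_okS i : i <= s -> stage_ok i -> stage_ok i.+1.
Proof.
move=> si ok; rewrite /stage_ok subSS -/(rho k p s i) /=.
set r := rho k p s i; set old := stage k p s X i.
pose c x y j := col (k + p * i) (pick_col k p s X i old x) (rank X i r.+1 x x) (rank X i r.+1 x y) j.
pose up x := upto X i r x || close_to X i r x; rewrite -/(c _ _ _).
have upR x : upto X i r.+1 x -> upto X i (gap k p s * (s.+1 - i)) x.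
  by apply: upto_mono; rewrite subSn // mulnS addnC -addn1 leq_add.
have adjm x y j : j < nmul X x y -> nadj X x y.
  by rewrite (wf_adj wfX); exact: leq_ltn_trans.
have cl x y j : j < nmul X x y -> close_to X i r x -> ccomp X i r.+1 x y.
  move=> xy nx; have xn := near_lt nx.
  apply: (comp_step xn (comp_refl _ _ xn)).
  - exact: near_mono nx.
  - by apply: near_adj nx; rewrite (wf_sym wfX); exact: adjm xy.
  - exact: adjm xy.
have V x : close_to X i r x -> valid_spec i old x (pick_col k p s X i old x).
  by move=> nx; apply/validP; [|apply: pick_valid => //]; exact: near_lt nx.
have up1 x y j : j < nmul X x y -> upto X i r x -> upto X i r.+1 y.
  by move=> xy; apply: upto_adj; rewrite (wf_sym wfX); exact: adjm xy.
have upW x : upto X i r x -> upto X i r.+1 x by exact: upto_mono.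
have far x y j : j < nmul X x y -> ~~ (close_to X i r x && close_to X i r y) ->
    up x -> up y -> upto X i r.+1 x /\ upto X i r.+1 y.
  move=> xy; rewrite negb_and /up; case/orP => /negPf nx; rewrite nx orbF => ux uy.
    by split; [exact: upW|exact: up1 xy ux].
  by split; [apply: (up1 y x j) => //; rewrite (wf_mulC wfX)|exact: upW].
pose st x y j := if close_to X i r x && close_to X i r y then c x y j else old x y j.
(* If [y] is not recolored it is near an earlier cell, so both ends are within [r.+1] of that cell
   and the code agrees with [old]. *)
have stc x y j : j < nmul X x y -> close_to X i r x -> up x -> up y -> st x y j = c x y j.
  move=> xy nx ux uy; rewrite /st nx /=; case: ifP => // ny.
  have [u1 u2] : upto X i r.+1 x /\ upto X i r.+1 y by apply: (far x y j); rewrite ?ny ?andbF.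
  have xn := near_lt nx.
  by case: (V x nx) => /(_ x y j (comp_refl _ _ xn) (cl _ _ _ xy nx) xy)[_ _ h _]; rewrite -h.
have sto x y j : close_to X i r x = false -> st x y j = old x y j by rewrite /st => ->.
move=> x y j xy ux uy; rewrite -/(st x y j) -/(st y x j); split.
- case: (boolP (close_to X i r x)) => nx.
    rewrite stc //; have xn := near_lt nx.
    by case: (V x nx) => /(_ x y j (comp_refl _ _ xn) (cl _ _ _ xy nx) xy)[].
  rewrite sto; last exact: negPf.
  have [u1 u2] : upto X i r.+1 x /\ upto X i r.+1 y by apply: (far x y j); rewrite ?(negPf nx).
  have [lt _ _] := ok x y j xy (upR _ u1) (upR _ u2).
  by apply: leq_trans lt _; rewrite leq_add2l leq_mul2l leq_pred orbT.
- rewrite /st [close_to X i r y && _]andbC; case: ifP => [/andP[nx ny]|/negbT nxy].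
    have xn := near_lt nx; have xyc := cl _ _ _ xy nx; rewrite /c.
    have -> : pick_col k p s X i old y = pick_col k p s X i old x.
      by apply: eq_find => z; exact: valid_eq.
    rewrite !(rank_eq xn xyc).
    by case: (V x nx) => /(_ x y j (comp_refl _ _ xn) xyc xy)[].
  have [u1 u2] := far _ _ _ xy nxy ux uy.
  by have [] := ok x y j xy (upR _ u1) (upR _ u2).
- move=> z l uz xz; rewrite -/(st x z l).
  case: (boolP (close_to X i r x)) => nx.
    rewrite !stc //; have xn := near_lt nx.
    case: (V x nx) => /(_ x y j (comp_refl _ _ xn) (cl _ _ _ xy nx) xy)[_ _ _]; apply => //.
    exact: cl xz nx.
  rewrite !sto; [|exact: negPf..].
  have [u1 u2] : upto X i r.+1 x /\ upto X i r.+1 y by apply: (far x y j); rewrite ?(negPf nx).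
  have [_ u3] : upto X i r.+1 x /\ upto X i r.+1 z by apply: (far x z l); rewrite ?(negPf nx).
  have [_ _ inj] := ok x y j xy (upR _ u1) (upR _ u2).
  by move=> e; apply: inj => //; exact: upR.
Qed.

Lemma stage_okP i : i <= s.+1 -> stage_ok i.
Proof.
elim: i => [_|i IHi si]; first by move=> x y j _ up.
by apply: stage_okS => //; apply: IHi; exact: ltnW.
Qed.

(** After the last cell the radius is 0, and every vertex belongs to a cell, so [stage_ok] covers
    all edges. *)
Lemma stage_proper : proper_edge_coloring (nmul X) (k + p * s) (stage k p s X s.+1).
Proof.
have ok := stage_okP (leqnn s.+1).
have up x : x < n -> upto X s.+1 (gap k p s * (s.+1 - s.+1)) x.
  move=> xn; have [i si ix] := wf_cell wfX xn; rewrite subnn muln0.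
  by apply/uptoP; exists i.
split => [x y j xy|x y j xy|x y z j l xy xz e].
- by have [xn yn] := nmul_lt xy; have [] := ok x y j xy (up _ xn) (up _ yn).
- by have [xn yn] := nmul_lt xy; have [] := ok x y j xy (up _ xn) (up _ yn).
- have [xn yn] := nmul_lt xy; have [_ zn] := nmul_lt xz.
  by have [_ _] := ok x y j xy (up _ xn) (up _ yn); apply => //; exact: up.
Qed.

Lemma lab_cell i y m : ncell X i y -> i < m -> lab X m y = hpair i (rank X i 1 y y).
Proof.
move=> iy; elim: m => // m IHm; rewrite ltnS leq_eqVlt => /orP[/eqP e|im] /=.
  by rewrite -e iy.
case: ifP => [my|_]; last exact: IHm.
by move: im; rewrite (wf_cell_uniq wfX iy my) ltnn.
Qed.

(** Two neighbors of [x] in one cell are joined through [x] inside the vertices within distance 1 of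
    that cell, so they are ranked in the same component. *)
Lemma lab_inj x y z : 0 < nmul X x y -> 0 < nmul X x z ->
  lab X s.+1 y = lab X s.+1 z -> y = z.
Proof.
move=> xy xz; have [xn yn] := nmul_lt xy; have [_ zn] := nmul_lt xz.
have [i si iy] := wf_cell wfX yn; have [i' si' iz] := wf_cell wfX zn.
rewrite (lab_cell iy) // (lab_cell iz) // => /hpair_inj[ei re].
rewrite -{i'}ei in si' iz re *.
have near1 u : ncell X i u -> close_to X i 1 u by move=> /= ->.
have nx : close_to X i 1 x by apply: (near_adj (r := 0)) iy; rewrite (wf_adj wfX).
have yz : ccomp X i 1 y z.
  have yx : ccomp X i 1 y x.
    apply: (comp_step yn (comp_refl _ _ yn) (near1 _ iy) nx).
    by rewrite (wf_adj wfX) (wf_mulC wfX).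
  by apply: (comp_step yn yx nx (near1 _ iz)); rewrite (wf_adj wfX).
apply: (rank_inj (comp_refl _ _ yn) yz).
by rewrite re (rank_eq yn yz).
Qed.

End Numeric.

(** * Locality *)

Local Open Scope classical_set_scope.

Section Locality.
Variables (k p s r : nat) (G : sgraph (mg_language p)) (m : G -> G -> nat).
Variables (lt : rel G) (cell : G -> 'I_s.+1).
Hypothesis lt_lin : strict_linear_order lt.
Hypothesis r_large : ((gap k p s * s).+1).*2 < r.

Definition close_set (i d : nat) : set G :=
  [set x | exists u, nat_of_ord (cell u) = i /\ dist_le (@adj _ G) d x u].

Definition close_comp (i d : nat) : G -> set G := component (@adj _ G) (close_set i d).

(* [X] is a copy of an induced subgraph of [G], and [D d] consists of vertices that lie at
   least [d] pieces deep inside that subgraph. *)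
Record view (X : nstr) (v : nat -> G) (D : nat -> set G) : Prop := View {
  v_wf : wf k p s X;
  v_ord : forall a b, a < sz X -> b < sz X -> (a < b) = lt (v a) (v b);
  v_adj : forall a b, a < sz X -> b < sz X -> nadj X a b = adj (v a) (v b);
  v_mul : forall a b, a < sz X -> b < sz X -> nmul X a b = m (v a) (v b);
  v_cell : forall i a, a < sz X -> ncell X i a = (nat_of_ord (cell (v a)) == i);
  v_im : forall x, D 0 x -> exists2 a, a < sz X & v a = x;
  v_dist : forall d x y, D d.+1 x -> dist_le (@adj _ G) r x y -> D d y;
  v_piece : forall d x y, D d x -> piece_of r cell x y -> D d y }.

Lemma dist_le_mono d d' x y : d <= d' -> dist_le (@adj _ G) d x y -> dist_le (@adj _ G) d' x y.
Proof. by move=> dd [q [sq pq lq]]; exists q; split => //; exact: leq_trans dd. Qed.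

Lemma dist_le0 d x : dist_le (@adj _ G) d x x.
Proof. by exists [::]. Qed.

(** Cell vertices witnessing closeness for consecutive vertices of the path are at distance at most
    [2 * d + 1 <= r], hence in the same piece. *)
Lemma close_comp_piece i d q x u : d.*2 < r -> nat_of_ord (cell u) = i ->
  dist_le (@adj _ G) d x u -> path (restrict_rel (@adj _ G) (close_set i d)) x q ->
  exists u', [/\ piece_of r cell u u', nat_of_ord (cell u') = i &
    dist_le (@adj _ G) d (last x q) u'].
Proof.
move=> dr; elim: q x u => [|y q IHq] x u ui xu /=.
  by move=> _; exists u; split => //; exact: piece_of_mem.
case/andP => /and3P[_ /set_mem[u1 [u1i yu1]] xy] pq.
have uu1 : piece_of r cell u u1.
  have [->|ne] := pselect (u = u1); first exact: piece_of_mem.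
  exists 1, [:: u1]; split => //=; rewrite andbT /restrict_rel.
  apply/and3P; split; [by apply/mem_set|apply/mem_set|].
    by apply: val_inj; rewrite /= u1i ui.
  apply/asboolP; split => //; apply: (@dist_le_mono (d + (1 + d))).
    by rewrite addnCA addnn.
  apply: dist_le_trans (dist_le_sym (@adj_sym _ G) xu) _.
  by apply: dist_le_trans yu1; exists [:: y]; rewrite /= xy.
have [u' [pu' u'i yu']] := IHq y u1 u1i yu1 pq; exists u'; split => //.
by rewrite (pieces_piece_of (piece_of_pieces r cell u) uu1).
Qed.

Section OneView.
Variables (X : nstr) (v : nat -> G) (D : nat -> set G).
Hypothesis vX : view X v D.
Local Notation n := (sz X).

Let wfX : wf k p s X := v_wf vX.

Lemma v_inj a b : a < n -> b < n -> v a = v b -> a = b.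
Proof.
have [irr _ _] := lt_lin => an bn e; case: (ltngtP a b) => //.
  by rewrite (v_ord vX) // e irr.
by rewrite (v_ord vX) // e irr.
Qed.

Lemma v_mono d d' x : d <= d' -> D d' x -> D d x.
Proof.
elim: d' => [|d' IHd']; first by rewrite leqn0 => /eqP ->.
rewrite leq_eqVlt => /orP[/eqP -> //|/IHd' h Dx]; apply: h.
exact: (v_dist vX Dx (dist_le0 _ _)).
Qed.

Lemma v_image d x : D d x -> exists2 a, a < n & v a = x.
Proof. by move=> Dx; apply: (v_im vX); exact: v_mono Dx. Qed.

Lemma close_to_set i d a : a < n -> close_to X i d a -> close_set i d (v a).
Proof.
elim: d a => [|d IHd] a an /=.
  by rewrite (v_cell vX) // => /eqP ca; exists (v a); split => //; exact: dist_le0.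
case/orP => [/(IHd a an)[u [ui au]]|/hasP[b bn /andP[ab /IHd h]]].
  by exists u; split => //; exact: dist_le_mono au.
move: bn; rewrite mem_iota => bn; have [u [ui bu]] := h bn.
exists u; split => //; rewrite -add1n; apply: dist_le_trans bu.
by exists [:: v b]; rewrite /= -(v_adj vX) // ab.
Qed.

(** A path from [v a] to the cell may run anywhere in the ball of radius [d], so the whole ball has
    to be visible in [X]. *)
Lemma close_set_to i d a : a < n ->
  (forall y, dist_le (@adj _ G) d (v a) y -> exists2 b, b < n & v b = y) ->
  close_set i d (v a) -> close_to X i d a.
Proof.
elim: d a => [|d IHd] a an im [u [ui [q [sq pq lq]]]].
  by case: q sq pq lq => // _ _ e; rewrite /= (v_cell vX) // /= in e *; rewrite e ui.
case: q sq pq lq => [_ _ e|y q /= sq /andP[ay pq] lq].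
  by apply: (near_mono (r := 0)) => //=; rewrite (v_cell vX) // /= in e *; rewrite e ui.
have [b bn vb] : exists2 b, b < n & v b = y by apply: im; exists [:: y]; rewrite /= ay.
apply: (near_adj wfX (y := b)); first by rewrite (v_adj vX) // vb.
apply: IHd => // [z bz|]; last by exists u; split => //; exists q; rewrite vb.
by apply: im; rewrite -add1n; apply: dist_le_trans bz; exists [:: v b]; rewrite /= vb ay.
Qed.

Lemma close_view i d a : a < n -> d <= r -> D 1 (v a) ->
  close_to X i d a = `[< close_set i d (v a) >].
Proof.
move=> an dr Da; apply/idP/asboolP; first exact: close_to_set.
apply: close_set_to => // y ay; apply: (v_im vX).
by apply: (v_dist vX Da); exact: dist_le_mono ay.
Qed.

(** Two levels suffice for a component of any length: one to go from [x] to the piece, none inside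
    the piece, one to come back out to [y]. *)
Lemma close_comp_deep i d e x y : d.*2 < r -> D e.+2 x -> close_comp i d x y -> D e y.
Proof.
move=> dr Dx [_ [q [_ pq <-]]]; case: q pq => [_|z q pq].
  by apply: v_mono Dx; rewrite leqW.
have [u [ui xu]] : close_set i d x by case/andP: pq => /and3P[/set_mem].
have dr' : d <= r by apply: leq_trans (ltnW dr); rewrite -addnn leq_addr.
have [u' [pu' _ yu']] := close_comp_piece dr ui xu pq.
apply: (v_dist vX (x := u')); last first.
  exact: dist_le_sym (@adj_sym _ G) (dist_le_mono dr' yu').
apply: (v_piece vX) pu'; exact: (v_dist vX Dx (dist_le_mono dr' xu)).
Qed.

Lemma comp_close i d a b : a < n -> ccomp X i d a b -> close_comp i d (v a) (v b).
Proof.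
move=> an /(compP wfX _ _ _ an)[q [pq <-]]; exists (size q), (map v q); split.
- by rewrite size_map.
- elim: q a an pq => //= b' q IHq a an /andP[/and3P[na nb ab] pq].
  have bn := near_lt wfX nb; rewrite IHq // andbT /restrict_rel.
  by apply/and3P; split; [apply/mem_set; exact: close_to_set..|rewrite -(v_adj vX)].
- by rewrite last_map.
Qed.

(** Of the three levels two pay for reaching [y]; the last one ensures that closeness to the cell is
    judged correctly at the vertices on the way. *)
Lemma close_comp_view i d a y : d.*2 < r -> a < n -> D 3 (v a) ->
  close_comp i d (v a) y -> exists b, [/\ b < n, v b = y, D 1 y & ccomp X i d a b].
Proof.
move=> dr an Da [_ [q [_ + <-]]].
have dr' : d <= r by apply: leq_trans (ltnW dr); rewrite -addnn leq_addr.
elim/last_ind: q => [_|q z IHq].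
  by exists a; split => //; [exact: v_mono Da|exact: (comp_refl wfX)].
rewrite rcons_path last_rcons => /[dup] pz /andP[pq /and3P[/set_mem Yl /set_mem Yz lz]].
have [b [bn vb Db ab]] := IHq pq.
have Dz : D 1 z.
  apply: (@close_comp_deep i d 1 (v a)) => //; exists (size (rcons q z)), (rcons q z).
  by rewrite last_rcons rcons_path.
have [c cn vc] := v_image Dz; exists c; split => //.
apply: (comp_step wfX an ab).
- by rewrite close_view // vb //; apply/asboolP.
- by rewrite close_view // vc //; apply/asboolP.
- by rewrite (v_adj vX) // vb vc.
Qed.

Lemma comp_deep i d e a b : d.*2 < r -> a < n -> D e.+2 (v a) -> ccomp X i d a b -> D e (v b).
Proof. by move=> dr an Da /(comp_close an); exact: close_comp_deep. Qed.

End OneView.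

Section TwoViews.
Variables (X1 X2 : nstr) (v1 v2 : nat -> G) (D1 D2 : nat -> set G).
Hypotheses (vX1 : view X1 v1 D1) (vX2 : view X2 v2 D2).

Lemma comp_transfer i d a1 a2 b1 : d.*2 < r -> a1 < sz X1 -> a2 < sz X2 -> v1 a1 = v2 a2 ->
  D2 3 (v2 a2) -> ccomp X1 i d a1 b1 ->
  exists b2, [/\ b2 < sz X2, v2 b2 = v1 b1, D2 1 (v2 b2) & ccomp X2 i d a2 b2].
Proof.
move=> dr a1n a2n e Da /(comp_close vX1 a1n); rewrite e => h.
by have [b [bn vb Db ab]] := close_comp_view vX2 dr a2n Da h; exists b; rewrite vb.
Qed.

(** [tr] sends each vertex of the component to its copy in the other view, injectively and
    preserving the order, so the vertices below [b1] inject into those below [b2]. *)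
Lemma rank_transfer_le i d a1 a2 b1 b2 : d.*2 < r -> a1 < sz X1 -> a2 < sz X2 ->
  v1 a1 = v2 a2 -> D2 3 (v2 a2) -> b1 < sz X1 -> b2 < sz X2 -> v1 b1 = v2 b2 ->
  rank X1 i d a1 b1 <= rank X2 i d a2 b2.
Proof.
move=> dr a1n a2n ea Da b1n b2n eb.
have rankE X a b : rank X i d a b = size [seq c <- iota 0 b | ccomp X i d a c].
  rewrite size_filter /rank /index_iota subn0 -sum1_count [RHS]big_mkcond.
  by apply: eq_bigr => c _; case: ccomp.
rewrite !rankE; pose tr c := find (fun c2 => `[< v2 c2 = v1 c >]) (iota 0 (sz X2)).
have trP c : ccomp X1 i d a1 c -> [/\ tr c < sz X2, v2 (tr c) = v1 c & ccomp X2 i d a2 (tr c)].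
  move=> ac; have [c2 [c2n e _ ac2]] := comp_transfer dr a1n a2n ea Da ac.
  suff -> : tr c = c2 by [].
  apply: find_iotaP => //; first exact/asboolP.
  move=> y yc; apply/asboolP => e'; have yn := ltn_trans yc c2n.
  by move: yc; rewrite (v_inj vX2 yn c2n) ?ltnn // e' e.
rewrite -(size_map tr); apply: uniq_leq_size.
  rewrite map_inj_in_uniq ?filter_uniq ?iota_uniq // => c c'.
  rewrite !mem_filter => /andP[ac _] /andP[ac' _] e.
  have [_ h _] := trP _ ac; have [_ h' _] := trP _ ac'.
  apply: (v_inj vX1); [exact: comp_lt (v_wf vX1) _ _ _ _ a1n ac|
    exact: comp_lt (v_wf vX1) _ _ _ _ a1n ac'|].
  by rewrite -h -h' e.
move=> c2 /mapP[c]; rewrite mem_filter mem_iota add0n => /andP[ac /= cb] ->.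
have [tn e at2] := trP _ ac; rewrite mem_filter at2 mem_iota add0n /=.
by rewrite (v_ord vX2) // e -eb -(v_ord vX1) // (ltn_trans cb).
Qed.

End TwoViews.
(** The search bound [zbound] grows with the window. Two windows still find the same code, because
    both searches succeed and the least solution does not depend on the bound. *)
Lemma find_iota_eq (P1 P2 : pred nat) b1 b2 z1 z2 : P1 =1 P2 ->
  z1 < b1 -> P1 z1 -> z2 < b2 -> P2 z2 -> find P1 (iota 0 b1) = find P2 (iota 0 b2).
Proof.
move=> e z1b Pz1 z2b Pz2; have ex : exists z, P1 z by exists z1.
case: (ex_minnP ex) => z Pz zmin.
have before y : y < z -> ~~ P1 y by move=> yz; apply/negP => /zmin; rewrite leqNgt yz.
rewrite (@find_iotaP P1 b1 z) //; last exact: leq_ltn_trans (zmin _ Pz1) z1b.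
rewrite (@find_iotaP P2 b2 z) // -?e // => [|y yz]; last by rewrite -e before.
by apply: leq_ltn_trans z2b; apply: zmin; rewrite e.
Qed.

Lemma rho_large i : ((rho k p s i).+1).*2 < r.
Proof.
by apply: leq_ltn_trans r_large; rewrite leq_double ltnS leq_mul2l leq_subr orbT.
Qed.

Section Transfer.
Variables (X1 X2 : nstr) (v1 v2 : nat -> G) (D1 D2 : nat -> set G).

Definition same_vertex d a1 a2 : Prop :=
  [/\ a1 < sz X1, a2 < sz X2, v1 a1 = v2 a2, D1 d (v1 a1) & D2 d (v2 a2)].

Hypotheses (vX1 : view X1 v1 D1) (vX2 : view X2 v2 D2).

Lemma same_vertex_mono d d' a1 a2 : d <= d' -> same_vertex d' a1 a2 -> same_vertex d a1 a2.
Proof.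
by move=> dd [a1n a2n e Da1 Da2]; split => //; [exact: (v_mono vX1) Da1|exact: (v_mono vX2) Da2].
Qed.

Lemma rank_transfer i d a1 a2 b1 b2 : d.*2 < r -> same_vertex 3 a1 a2 ->
  b1 < sz X1 -> b2 < sz X2 -> v1 b1 = v2 b2 -> rank X1 i d a1 b1 = rank X2 i d a2 b2.
Proof.
move=> dr [a1n a2n e Da1 Da2] b1n b2n eb; apply/eqP; rewrite eqn_leq.
rewrite (rank_transfer_le vX1 vX2 _ dr a1n a2n e Da2 b1n b2n eb).
by rewrite (rank_transfer_le vX2 vX1 _ dr a2n a1n _ Da1).
Qed.

Lemma close_transfer i d a1 a2 : d <= r -> same_vertex 1 a1 a2 ->
  close_to X1 i d a1 = close_to X2 i d a2.
Proof.
by move=> dr [a1n a2n e Da1 Da2]; rewrite (close_view vX1) // (close_view vX2) // e.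
Qed.

Lemma upto_transfer i d a1 a2 : d <= r -> same_vertex 1 a1 a2 ->
  upto X1 i d a1 = upto X2 i d a2.
Proof.
by move=> dr sv; elim: i => //= i ->; rewrite (close_transfer _ dr sv).
Qed.

(** Validity consults the old colors at every vertex of the component, which may be two levels less
    deep than [a1]; there they agree by assumption. *)
Lemma valid_transfer i old1 old2 a1 a2 z d : same_vertex d.+3 a1 a2 ->
  (forall b1 b2 c1 c2 j, same_vertex d.+1 b1 b2 -> same_vertex d.+1 c1 c2 ->
    old1 b1 c1 j = old2 b2 c2 j) ->
  valid k p s X1 i old1 a1 z -> valid k p s X2 i old2 a2 z.
Proof.
move=> sv oldE; have sv3 : same_vertex 3 a1 a2 by exact: same_vertex_mono sv.
have [a1n a2n e Da1 Da2] := sv; have [_ _ _ Da1' Da2'] := sv3.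
have rl := rho_large i.
have rle : (rho k p s i).+1 <= r by apply: leq_trans (ltnW rl); rewrite -addnn leq_addr.
have tr b2 : ccomp X2 i (rho k p s i).+1 a2 b2 ->
    exists b1, [/\ ccomp X1 i (rho k p s i).+1 a1 b1, same_vertex d.+1 b1 b2 &
      rank X1 i (rho k p s i).+1 a1 b1 = rank X2 i (rho k p s i).+1 a2 b2].
  move=> ab2; have [b1 [b1n eb Db ab1]] := comp_transfer vX2 vX1 rl a2n a1n (esym e) Da1' ab2.
  have b2n : b2 < sz X2 := comp_lt (v_wf vX2) a2n ab2.
  exists b1; split => //; last exact: rank_transfer.
  split => //; first exact: (comp_deep vX1 rl a1n Da1 ab1).
  exact: (comp_deep vX2 rl a2n Da2 ab2).
case/(validP (v_wf vX1) _ _ _ a1n) => h; apply/(validP (v_wf vX2) _ _ _ a2n).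
split => c K a b j /tr[a' [Ka' sa ra]] /tr[b' [Kb' sb rb]].
have [a'n an ea _ _] := sa; have [b'n bn eb _ _] := sb.
rewrite (v_mul vX2) // -ea -eb -(v_mul vX1) // => jm.
have [lt1 sym oldh inj] := h a' b' j Ka' Kb' jm.
have sa1 : same_vertex 1 a' a by exact: same_vertex_mono sa.
have sb1 : same_vertex 1 b' b by exact: same_vertex_mono sb.
rewrite /c -ra -rb; split => //.
- rewrite -(upto_transfer _ rle sa1) -(upto_transfer _ rle sb1) => ua ub.
  by rewrite oldh // (oldE _ a _ b).
- move=> d2 l /tr[d' [Kd' sd rd]]; have [d'n d2n ed _ _] := sd.
  rewrite (v_mul vX2) // -ea -ed -(v_mul vX1) // -rd => lm ce.
  have [bd jl] := inj d' l Kd' lm ce; split => //.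
  by apply: (v_inj vX2) => //; rewrite -eb -ed bd.
Qed.

End Transfer.

Lemma same_vertexC X1 X2 v1 v2 D1 D2 d a1 a2 :
  same_vertex X1 X2 v1 v2 D1 D2 d a1 a2 -> same_vertex X2 X1 v2 v1 D2 D1 d a2 a1.
Proof. by case. Qed.

(** Three levels are granted per stage: consulting the previous stage throughout a component costs
    two, and comparing ranks needs depth 3. *)
Lemma stage_transfer X1 X2 v1 v2 D1 D2 i a1 a2 b1 b2 j :
  view X1 v1 D1 -> view X2 v2 D2 -> i <= s.+1 ->
  same_vertex X1 X2 v1 v2 D1 D2 (3 * i).+1 a1 a2 ->
  same_vertex X1 X2 v1 v2 D1 D2 (3 * i).+1 b1 b2 ->
  stage k p s X1 i a1 b1 j = stage k p s X2 i a2 b2 j.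
Proof.
move=> vX1 vX2; elim: i a1 a2 b1 b2 j => //= i IHi a1 a2 b1 b2 j si sa sb.
have d3 : (3 * i.+1).+1 = (3 * i).+4 by rewrite mulnS addnC !addnS addn0.
rewrite d3 in sa sb.
have mono d d' := @same_vertex_mono X1 X2 v1 v2 D1 D2 vX1 vX2 d d'.
have rl := rho_large i.
have rle : rho k p s i <= r.
  by apply: leq_trans (ltnW rl); apply: leq_trans (leqnSn _) _; rewrite -addnn leq_addr.
have sa1 := mono 1 (3 * i).+4 a1 a2 isT sa; have sb1 := mono 1 (3 * i).+4 b1 b2 isT sb.
have sa3 := mono 3 (3 * i).+4 a1 a2 isT sa.
rewrite (close_transfer vX1 vX2 _ rle sa1) (close_transfer vX1 vX2 _ rle sb1).
have IH c1 c2 d1 d2 l : same_vertex X1 X2 v1 v2 D1 D2 (3 * i).+1 c1 c2 ->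
    same_vertex X1 X2 v1 v2 D1 D2 (3 * i).+1 d1 d2 ->
    stage k p s X1 i c1 d1 l = stage k p s X2 i c2 d2 l.
  by apply: IHi; exact: ltnW.
case: ifP => _; last by apply: IH; [apply: mono sa|apply: mono sb]; exact: (leqW (leqW (leqnSn _))).
have [a1n a2n ea _ _] := sa; have [b1n b2n eb _ _] := sb.
rewrite (rank_transfer vX1 vX2 _ rl sa3 a1n a2n ea) (rank_transfer vX1 vX2 _ rl sa3 b1n b2n eb).
congr (col _ _ _ _ _); rewrite ltnS in si.
have [z1 z1b vz1] := valid_exists (v_wf vX1) si (stage_okP (v_wf vX1) (leqW si)) a1n.
have [z2 z2b vz2] := valid_exists (v_wf vX2) si (stage_okP (v_wf vX2) (leqW si)) a2n.
have sa' : same_vertex X1 X2 v1 v2 D1 D2 (3 * i).+3 a1 a2 by exact: mono sa.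
apply: (find_iota_eq _ z1b vz1 z2b vz2) => z; apply/idP/idP.
  by apply: (valid_transfer vX1 vX2 sa') => *; exact: IH.
apply: (valid_transfer vX2 vX1 (same_vertexC sa')) => c1 c2 d1 d2 l sc sd.
by apply/esym; apply: IH; exact: same_vertexC.
Qed.

Lemma lab_transfer X1 X2 v1 v2 D1 D2 i a1 a2 :
  view X1 v1 D1 -> view X2 v2 D2 -> same_vertex X1 X2 v1 v2 D1 D2 3 a1 a2 ->
  lab X1 i a1 = lab X2 i a2.
Proof.
move=> vX1 vX2 sa; have [a1n a2n ea _ _] := sa; elim: i => //= i ->.
rewrite (v_cell vX1) // (v_cell vX2) // ea.
rewrite (rank_transfer vX1 vX2 _ _ sa a1n a2n ea) //.
by apply: leq_ltn_trans r_large; rewrite leq_double.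
Qed.

End Locality.

(** * The algorithm *)

(** Applied in both directions, this shows that the increasing enumeration of an input is unique. *)
Lemma increasing_ge n n' (g : 'I_n -> 'I_n') :
  (forall i j : 'I_n, i < j -> g i < g j) -> forall i : 'I_n, i <= g i.
Proof.
move=> inc [i]; elim: i => [|i IHi] //= lt_in.
apply: leq_ltn_trans (IHi (ltnW lt_in)) (inc _ _ _); exact: ltnSn.
Qed.

Section Enumerations.
Variables (L : language) (s : nat) (I : asi_input L s).

Lemma enum_exists : exists n (v : 'I_n -> in_graph I), increasing_enum v.
Proof.
have [irr tr tot] := in_lt_linear I.
pose T := {classic in_graph I}.
have [t tE] : exists t : seq T, [set: T] = [set` t] by apply/finite_seqP; exact: in_fin.
pose le : rel T := fun x y => (x == y) || in_lt x y.
have le_total : total le.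
  move=> x y; rewrite /le; have [->|/eqP/tot[]->] := eqVneq x y; by rewrite ?orbT.
have le_trans : transitive le.
  move=> y x z /orP[/eqP ->//|xy] /orP[/eqP <-|yz]; first by rewrite /le xy orbT.
  by rewrite /le (tr _ _ _ xy yz) orbT.
pose u := sort le (undup t).
have pw : pairwise (@in_lt _ _ I : rel T) u.
  have u1 : pairwise le u by rewrite -sorted_pairwise ?sort_sorted.
  have u2 : pairwise [rel x y | x != y] u by rewrite -uniq_pairwise sort_uniq undup_uniq.
  apply: (sub_pairwise (r := [rel x y | le x y && (x != y)])); last by rewrite pairwise_relI u1 u2.
  by move=> x y /andP[/orP[->//|]].
have mono (i j : 'I_(size u)) : i < j -> in_lt (tnth (in_tuple u) i : in_graph I) (tnth (in_tuple u) j).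
  have x0 : T := tnth (in_tuple u) i; move=> ij; rewrite !(tnth_nth x0) /=.
  by move/(pairwiseP x0): pw; apply; rewrite ?inE.
have ord (i j : 'I_(size u)) :
    in_lt (tnth (in_tuple u) i : in_graph I) (tnth (in_tuple u) j) = (i < j).
  apply/idP/idP => [h|]; last exact: mono.
  case: (ltngtP i j) => // [/mono h'|/val_inj e].
    by have := tr _ _ _ h h'; rewrite irr.
  by rewrite e irr in h.
exists (size u), (fun i => tnth (in_tuple u) i); split => //.
have mem_u (x : T) : x \in u.
  by rewrite mem_sort mem_undup; have : [set: T] x by []; rewrite tE.
have idx (x : T) : index x u < size u by rewrite index_mem.
exists (fun x => Ordinal (idx x)) => [i|x].
  apply: val_inj => /=; have x0 : T := tnth (in_tuple u) i.
  by rewrite (tnth_nth x0) index_uniq // sort_uniq undup_uniq.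
by rewrite (tnth_nth x) /= nth_index.
Qed.

Lemma enum_unique n n' (v : 'I_n -> in_graph I) (v' : 'I_n' -> in_graph I) :
  increasing_enum v -> increasing_enum v' ->
  n = n' /\ forall i i', v i = v' i' -> nat_of_ord i = i'.
Proof.
move=> [[w vw wv] ov] [[w' vw' wv'] ov'].
have up (i : 'I_n) : i <= w' (v i).
  by apply: (increasing_ge (g := fun i => w' (v i))) => a b ab; rewrite -ov' !wv' ov.
have down (i : 'I_n') : i <= w (v' i).
  by apply: (increasing_ge (g := fun i => w (v' i))) => a b ab; rewrite -ov !wv ov'.
split=> [|i i' e].
  have b : bijective (fun i => w' (v i)).
    by exists (fun i => w (v' i)) => i; rewrite ?wv' ?wv ?vw ?vw'.
  by have := bij_eq_card b; rewrite !card_ord.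
apply/eqP; rewrite eqn_leq; apply/andP; split.
  by have := up i; rewrite e vw'.
by have := down i'; rewrite -e vw.
Qed.

Lemma enum_code_unique n n' (v : 'I_n -> in_graph I) (v' : 'I_n' -> in_graph I) :
  increasing_enum v -> increasing_enum v' ->
  code_input v = code_input v' /\ forall i i', v i = v' i' -> nat_of_ord i = i'.
Proof.
move=> iv iv'; have [e h] := enum_unique iv iv'; split => //.
case: n' / e v' iv' h => v' [[w' vw' wv'] _] h; congr code_input; apply/funext => i.
have := h i (w' (v i)); rewrite wv' => /(_ erefl)/val_inj e.
by rewrite [v' i](congr1 v' e) wv'.
Qed.

End Enumerations.

(** Isomorphic inputs have literally the same code, so an algorithm that looks only at the code and
    at positions in the enumeration is invariant. *)
Lemma code_input_iso (L : language) s (I J : asi_input L s) (f : in_graph I -> in_graph J)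
    n (v : 'I_n -> in_graph I) :
  input_iso f -> increasing_enum v ->
  increasing_enum (f \o v) /\ code_input (f \o v) = code_input v.
Proof.
move=> [[bf fa fi] fl fc fs] [bv ov]; split.
  by split => [|i j]; [exact: bij_comp|rewrite /= fl].
have sub (A : set (in_graph I)) (B : set (in_graph J)) : (forall x, B (f x) <-> A x) ->
    code_subset (f \o v) B = code_subset v A.
  move=> AB; congr hset; congr (map _ _); apply: eq_filter => i.
  by apply/idP/idP => /set_mem/AB/mem_set.
have prs (e : rel (in_graph I)) (e' : rel (in_graph J)) : (forall x y, e' (f x) (f y) = e x y) ->
    code_pairs (f \o v) e' = code_pairs v e.
  by move=> ee; congr hset; congr (map _ _); apply: eq_filter => ij; rewrite /= ee.
rewrite /code_input (sub setT setT) // (prs _ _ fa) (prs _ _ fl) (sub _ _ fs).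
congr hseq; congr (_ ++ _); congr (_ ++ _); last congr (_ ++ _).
- apply: eq_map => R; congr hset; congr (map _ _); apply: eq_filter => t.
  rewrite -fi; congr interp; apply: val_inj => /=; by rewrite map_comp.
- by apply: eq_map => a; apply: sub => x; rewrite /= fc.
Qed.

Local Notation inset I := (@Defs.in_set _ _ I).

(** * Reading a structure back from the code of an input *)

Section Decoding.
Variables (p s : nat) (I : asi_input (mg_language p) s) (n : nat) (v : 'I_n -> in_graph I).

Lemma mem_code_subset (A : set (in_graph I)) (i : 'I_n) :
  hf_mem i (code_subset v A) = (v i \in A).
Proof.
rewrite mem_hset; apply/mapP/idP => [[j + /val_inj ->]|vi]; first by rewrite mem_filter => /andP[].
by exists i; rewrite // mem_filter vi mem_enum.
Qed.

Lemma code_subset_lt (A : set (in_graph I)) x : hf_mem x (code_subset v A) -> x < n.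
Proof. by rewrite mem_hset => /mapP[j _ ->]. Qed.

Lemma mem_code_pairs (e : rel (in_graph I)) (i j : 'I_n) :
  hf_mem (hpair i j) (code_pairs v e) = e (v i) (v j).
Proof.
rewrite mem_hset; apply/mapP/idP => [[[i' j']]|eij].
  by rewrite mem_filter /= => /andP[h _] /hpair_inj[/val_inj -> /val_inj ->].
by exists (i, j); rewrite // mem_filter /= eij mem_enum.
Qed.

Lemma code_pairs_lt (e : rel (in_graph I)) x y :
  hf_mem (hpair x y) (code_pairs v e) -> x < n /\ y < n.
Proof. by rewrite mem_hset => /mapP[[i j] _ /hpair_inj[-> ->]]. Qed.

Lemma mem_code_tuples (P : 2.-tuple (in_graph I) -> bool) (i j : 'I_n) :
  hf_mem (hpair i (hpair j 0)) (code_tuples v P) = P [tuple v i; v j].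
Proof.
have mv : map_tuple v [tuple i; j] = [tuple v i; v j] by apply: val_inj.
rewrite mem_hset; apply/mapP/idP => [[t]|eij].
  rewrite mem_filter => /andP[h _].
  case: t h => -[|i' [|j' []]] //= sz h /hpair_inj[/val_inj ei /hpair_inj[/val_inj ej _]].
  by rewrite -mv ei ej; congr (P _): h; apply: val_inj.
by exists [tuple i; j]; rewrite // mem_filter mv eij mem_enum.
Qed.

Local Notation w := (code_input v).
Local Notation X := (str_of p s w).

Lemma code_input0 : hnth 0 w = code_subset v setT.
Proof. by rewrite /code_input hnth_hseq. Qed.

Lemma code_input1 : hnth 1 w = code_pairs v (@adj _ (in_graph I)).
Proof. by rewrite /code_input hnth_hseq. Qed.

Lemma size_enum_rel (T : Type) (f : rsym (mg_language p) -> T) :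
  size [seq f R | R <- enum (rsym (mg_language p))] = p.
Proof. by rewrite size_map -cardE card_ord. Qed.

Lemma size_enum_cell (T : Type) (f : 'I_s.+1 -> T) : size [seq f a | a <- enum 'I_s.+1] = s.+1.
Proof. by rewrite size_map -cardE card_ord. Qed.

Lemma code_input_rel (j : 'I_p) :
  hnth (3 + j) w = code_tuples v (@interp _ (in_graph I) (j : rsym (mg_language p))).
Proof.
rewrite /code_input hnth_hseq; last by rewrite size_cat ltn_add2l size_cat size_enum_rel ltn_addr.
rewrite -[3 + j]/(j.+3) /= nth_cat size_enum_rel ltn_ord (nth_map (j : rsym (mg_language p))).
  by congr (code_tuples v (@interp _ _ _)); exact: nth_ord_enum.
by rewrite -cardE card_ord.
Qed.

Lemma code_input_cell (a : 'I_s.+1) :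
  hnth (3 + p + a) w = code_subset v (@in_cell _ s I @^-1` [set a]).
Proof.
rewrite /code_input hnth_hseq; last first.
  rewrite !size_cat size_enum_rel size_enum_cell -addnA !ltn_add2l.
  by rewrite (leq_trans (ltn_ord a)) // leq_addr.
rewrite -addnA -[3 + _]/((p + a).+3) /= nth_cat size_enum_rel ltnNge leq_addr /= addKn.
rewrite nth_cat size_enum_cell ltn_ord (nth_map a) ?nth_ord_enum //.
by rewrite -cardE card_ord.
Qed.

Lemma code_input_set : hnth (4 + p + s) w = code_subset v (inset I).
Proof.
have -> : 4 + p + s = (p + s.+1).+3 by rewrite addnS !addSn.
rewrite /code_input hnth_hseq; last first.
  by rewrite !size_cat size_enum_rel size_enum_cell -[(_ + _).+3]add3n !ltn_add2l addn1.
rewrite /= nth_cat size_enum_rel ltnNge leq_addr /= addKn.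
by rewrite nth_cat size_enum_cell ltnn subnn.
Qed.

Lemma str_sz : sz X = n.
Proof.
rewrite -[sz X]/(find (fun x => ~~ hf_mem x (hnth 0 w)) (iota 0 w)) code_input0.
apply: find_iotaP.
(* The search runs below [w], so [n < w] is needed: [n.-1] belongs to the vertex set, whose code is
   a component of [w]. *)
- have lt : code_subset v setT < w by rewrite /code_input /=; case: (hpair_gt (code_subset v setT) (hseq
    ([:: code_pairs v (@adj _ (in_graph I)); code_pairs v (@in_lt _ s I)]
        ++ [seq code_tuples v (@interp _ (in_graph I) R) | R <- enum (rsym (mg_language p))]
        ++ [seq code_subset v (@in_cell _ s I @^-1` [set a]) | a <- enum 'I_s.+1]
        ++ [:: code_subset v (inset I)]))).
  apply: leq_ltn_trans lt; case: (posnP n) => [n0|n0].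
    by apply: (@leq_trans 0) => //; rewrite leqn0; apply/eqP.
  have lt_n : n.-1 < n by rewrite prednK.
  suff : n.-1 < code_subset v setT by rewrite prednK.
  apply: hf_mem_lt; rewrite -[n.-1]/(nat_of_ord (Ordinal lt_n)) mem_code_subset.
  exact: in_setT.
- by apply/negP => /code_subset_lt; rewrite ltnn.
- by move=> y yn; rewrite negbK -[y]/(nat_of_ord (Ordinal yn)) mem_code_subset in_setT.
Qed.

Lemma str_adj (i j : 'I_n) : nadj X i j = adj (v i) (v j).
Proof. by rewrite -[nadj X i j]/(hf_mem (hpair i j) (hnth 1 w)) code_input1 mem_code_pairs. Qed.

Lemma str_adj_lt x y : nadj X x y -> x < n /\ y < n.
Proof. by rewrite -[nadj X x y]/(hf_mem (hpair x y) (hnth 1 w)) code_input1 => /code_pairs_lt. Qed.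

Lemma str_cell a (i : 'I_n) : ncell X a i = (nat_of_ord (in_cell (v i)) == a).
Proof.
rewrite -[ncell X a i]/((a <= s) && hf_mem i (hnth (3 + p + a) w)).
case: (ltnP s a) => sa; rewrite ?andTb ?andFb.
  by apply/esym/negbTE; rewrite neq_ltn (leq_trans (ltn_ord _) sa).
have sa' : a < s.+1 by [].
rewrite -[a]/(nat_of_ord (Ordinal sa')) code_input_cell mem_code_subset.
by apply/idP/eqP => [/set_mem /= ->//|e]; apply/mem_set; apply: val_inj.
Qed.

Lemma str_cell_lt a x : ncell X a x -> x < n.
Proof.
case/andP => sa; have sa' : a < s.+1 by [].
by rewrite -[a]/(nat_of_ord (Ordinal sa')) code_input_cell => /code_subset_lt.
Qed.

Section Multigraph.
Variable m : in_graph I -> in_graph I -> nat.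
Hypothesis em : encodes_multigraph m.

(** On an adjacent pair exactly the predicate standing for its multiplicity holds, so the descending
    test stops at the right value. *)
Lemma str_mul (i j : 'I_n) : nmul X i j = m (v i) (v j).
Proof.
have [msym mp madj mint] := em.
have -> : nmul X i j = if nadj X i j then mul_code p w i j else 0 by [].
rewrite str_adj; case: ifP => ij; last first.
  by apply/esym/eqP; rewrite -leqn0 leqNgt -madj ij.
have pos : 0 < m (v i) (v j) by rewrite -madj.
suff mE q : q <= p -> mul_code q w i j = if m (v i) (v j) <= q then m (v i) (v j) else 0.
  by rewrite mE // mp.
elim: q => [|q IHq] qp; first by rewrite /= leqn0; case: eqP.
have -> : mul_code q.+1 w i j = if hf_mem (hpair i (hpair j 0)) (hnth (3 + Ordinal qp) w)
    then q.+1 else mul_code q w i j by [].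
rewrite IHq; last exact: ltnW.
rewrite code_input_rel mem_code_tuples mint //= [_ <= q.+1]leq_eqVlt ltnS.
by case: eqP => // ->.
Qed.

Lemma str_mul_lt x y : 0 < nmul X x y -> x < n /\ y < n.
Proof.
have -> : nmul X x y = if nadj X x y then mul_code p w x y else 0 by [].
by case: ifP => // /str_adj_lt.
Qed.

Lemma str_wf k : edge_colorable m k -> (forall x, m x x = 0) -> bijective v -> wf k p s X.
Proof.
move=> [phi [ps pk pp]] mirr [v' vv' v'v]; have [msym mp madj mint] := em.
have ordE (x : nat) : x < n -> exists i : 'I_n, x = i by move=> h; exists (Ordinal h).
have zero x y : ~ (x < n /\ y < n) -> nmul X x y = 0.
  by move=> h; case: (posnP (nmul X x y)) => // /str_mul_lt.
have nadjF x y : ~ (x < n /\ y < n) -> nadj X x y = false.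
  by move=> h; apply/negbTE/negP => /str_adj_lt.
have two (x y : nat) : (exists i j : 'I_n, x = i /\ y = j) \/ ~ (x < n /\ y < n).
  case: (ltnP x n) => xn; last by right => -[].
  case: (ltnP y n) => yn; last by right => -[].
  by left; exists (Ordinal xn), (Ordinal yn).
have sw x y : ~ (x < n /\ y < n) -> ~ (y < n /\ x < n) by move=> h [? ?]; apply: h.
have jlt x y j : j < nmul X x y -> exists i i' : 'I_n, [/\ x = i, y = i' & j < m (v i) (v i')].
  move=> h; have [/ordE[i ei] /ordE[i' ei']] := str_mul_lt (leq_ltn_trans (leq0n _) h).
  by exists i, i'; split => //; rewrite -str_mul -ei -ei'.
split.
- move=> x y; have [[i [j [-> ->]]]|h] := two x y; first by rewrite !str_adj adj_sym.
  by rewrite !nadjF //; exact: sw.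
- by move=> x y /str_adj_lt[+ _]; rewrite str_sz.
- move=> x y; have [[i [j [-> ->]]]|h] := two x y; first by rewrite !str_mul msym.
  by rewrite !zero //; exact: sw.
- by move=> x y; have [[i [j [-> ->]]]|h] := two x y; rewrite ?str_mul // zero.
- move=> x y; have [[i [j [-> ->]]]|h] := two x y; first by rewrite str_adj str_mul madj.
  by rewrite nadjF // zero.
- by move=> x; have [[i [j [-> _]]]|h] := two x x; rewrite ?str_mul ?mirr // zero.
- by move=> i x /str_cell_lt; rewrite str_sz.
- move=> x; rewrite str_sz => /ordE[i ->]; exists (in_cell (v i)); first by rewrite -ltnS.
  by rewrite str_cell.
- move=> a b x xa; have [i xi] := ordE _ (str_cell_lt xa); move: xa.
  by rewrite xi !str_cell => /eqP <- /eqP <-.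
- pose v1 x : option (in_graph I) := omap v (insub x).
  pose psi x y j := if v1 x is Some a then if v1 y is Some b then phi a b j else 0 else 0.
  have psiE (i i' : 'I_n) j : psi i i' j = phi (v i) (v i') j by rewrite /psi /v1 !valK.
  exists psi; split.
  + by move=> x y j /jlt[i [i' [-> -> h]]]; rewrite !psiE ps.
  + by move=> x y j /jlt[i [i' [-> -> h]]]; rewrite !psiE pk.
  + move=> x y z j l /jlt[i [i' [-> -> h]]] /jlt[i1 [i2 [/val_inj <- -> h']]].
    by rewrite !psiE => e; have [/(can_inj vv') -> ->] := pp _ _ _ _ _ h h' e.
Qed.

End Multigraph.

End Decoding.

Section Algorithm.
Variables (k p s : nat).
Implicit Types I J : asi_input (mg_language p) s.

Lemma enum_index I : exists2 nv : {n & 'I_n -> in_graph I}, increasing_enum (projT2 nv) &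
  forall x, exists i, projT2 nv i = x.
Proof.
have [n [v iv]] := enum_exists I; exists (existT _ n v) => //= x.
by have [[v' _ v'v] _] := iv; exists (v' x).
Qed.

(** The enumeration is obtained by choice, which does no harm: it is unique, and computability is
    established from its code. *)
Definition the_enum I : {n & 'I_n -> in_graph I} := s2val (cid2 (enum_index I)).

Definition the_index I (x : in_graph I) : 'I_(projT1 (the_enum I)) :=
  sval (cid (s2valP' (cid2 (enum_index I)) x)).

Definition run I (x : inset I) : HF :=
  out k p s (str_of p s (code_input (projT2 (the_enum I)))) (the_index (val x)).

Lemma runE I n (v : 'I_n -> in_graph I) (i : 'I_n) (x : inset I) :
  increasing_enum v -> v i = val x -> run x = out k p s (str_of p s (code_input v)) i.
Proof.
move=> iv vi; have iv' := s2valP (cid2 (enum_index I)).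
have [ec ei] := enum_code_unique iv iv'; rewrite /run -ec; congr out.
by apply/esym/ei; rewrite vi; apply/esym; exact: (svalP (cid (s2valP' (cid2 (enum_index I)) _))).
Qed.

Lemma run_iso_val I J (f : in_graph I -> in_graph J) (x : inset I) (y : inset J) :
  input_iso f -> val y = f (val x) -> run x = run y.
Proof.
move=> iso yx; have [n [v iv]] := enum_exists I.
have [iv' ec] := code_input_iso iso iv.
have [[v' _ v'v] _] := iv.
have h2 : (f \o v) (v' (val x)) = val y by rewrite /comp v'v.
by rewrite (runE iv (v'v (val x))) (runE iv' h2) ec.
Qed.

Lemma run_iso I J (f : in_graph I -> in_graph J) : input_iso f ->
  forall (x : in_graph I) (Cx : x \in inset I) (Cfx : f x \in inset J),
    run (SigSub Cx) = run (SigSub Cfx).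
Proof. by move=> iso x Cx Cfx; apply: (run_iso_val iso). Qed.

Definition algorithm : asi_algorithm (mg_language p) s := AsiAlgorithm run_iso.

Lemma algorithm_computable : computable_algorithm algorithm.
Proof.
exists (fun t => run_code k p s (thead t)); split; first exact: rec_run_code (rec_var0 _).
move=> I n v iv z; rewrite theadE /run_code mem_hsetof str_sz code_input_set.
have oE (i : 'I_n) (Ci : v i \in inset I) :
    algorithm I (SigSub Ci) = out k p s (str_of p s (code_input v)) i.
  exact: (@runE I n v i (SigSub Ci) iv erefl).
split => [/andP[_ /hasP[i]]|[i [Ci ->]]].
  rewrite mem_iota add0n => /andP[_ lt_in] /andP[Ci /eqP ->].
  have Ci' : v (Ordinal lt_in) \in inset I by rewrite -mem_code_subset.
  by exists (Ordinal lt_in), Ci'; rewrite oE.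
rewrite oE; apply/andP; split; first exact: leq_sum_term (ltn_ord i).
apply/hasP; exists (nat_of_ord i); first by rewrite mem_iota add0n ltn_ord.
by rewrite mem_code_subset Ci eqxx.
Qed.

End Algorithm.

(** * Comparing windows and assembling the global coloring *)

Section Windows.
Variables (k p s : nat) (G : sgraph (mg_language p)) (m : G -> G -> nat).
Hypotheses (em : encodes_multigraph m) (cm : edge_colorable m k).
Variables (lt : rel G) (lt_lin : strict_linear_order lt) (cell : G -> 'I_s.+1).

(** One more than twice the largest component radius [(rho k p s 0).+1], so that a component stays
    near a single piece. *)
Definition scale : nat := ((gap k p s * s).+1).*2.+1.
(** After [s.+1] cells [stage_transfer] asks for depth [3 * s.+1 + 1]; one further level is lost in
    passing to the other end of an edge. *)
Definition stages : nat := (3 * s.+1).+2.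

Hypothesis wit : asi_witness scale cell.

Definition win_input (x : G) : asi_input (mg_language p) s :=
  stage_input lt_lin wit stages (piece_of scale cell x).

Definition win_enum (x : G) := projT2 (the_enum (win_input x)).
Arguments win_enum : clear implicits.

Definition win_str (x : G) : nstr := str_of p s (code_input (win_enum x)).

Definition win_vertex (x : G) (a : nat) : G :=
  if insub a is Some i then val (win_enum x i) else x.

Definition deep (x : G) (d : nat) : set G :=
  [set y | exists2 j, j + d <= stages & window scale cell j (piece_of scale cell x) y].

Lemma win_enum_inc x : increasing_enum (win_enum x).
Proof. exact: (s2valP (cid2 (enum_index (win_input x)))). Qed.

Lemma mul_irr x : m x x = 0.
Proof. by have [_ _ ma _] := em; apply/eqP; rewrite -leqn0 leqNgt -ma adj_irr. Qed.

Lemma window_mono i j K : i <= j -> window scale cell i K `<=` window scale cell j K.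
Proof.
move=> ij y [D [pD [q [sq pq lq]]] Dy]; exists D => //; split => //.
by exists q; split => //; exact: leq_trans ij.
Qed.

Lemma win_vertexE x (i : 'I_(projT1 (the_enum (win_input x)))) :
  win_vertex x i = val (win_enum x i).
Proof. by rewrite /win_vertex valK. Qed.

(** A move of length at most [scale] leads to the same piece or to an adjacent one, so it costs one
    level; moves inside a piece are free. *)
Lemma win_view x : view k scale m lt cell (win_str x) (win_vertex x) (deep x).
Proof.
have [[e' ee' e'e] eo] := win_enum_inc x.
have nE : sz (win_str x) = projT1 (the_enum (win_input x)) by exact: str_sz.
have emI : @encodes_multigraph p (in_graph (win_input x)) (fun a b => m (val a) (val b)).
  exact: encodes_induced em.
have ordE a : a < sz (win_str x) -> exists i : 'I_(projT1 (the_enum (win_input x))), a = i.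
  by rewrite nE => h; exists (Ordinal h).
split.
- apply: (str_wf emI).
  + have [phi pphi] := cm; exists (fun a b => phi (val a) (val b)).
    by apply: proper_iso pphi; exact: val_inj.
  + by move=> a; exact: mul_irr.
  + by exists e'.
- move=> a b /ordE[i ->] /ordE[j ->]; rewrite !win_vertexE; exact: esym (eo i j).
- move=> a b /ordE[i ->] /ordE[j ->]; rewrite !win_vertexE; exact: str_adj.
- move=> a b /ordE[i ->] /ordE[j ->]; rewrite !win_vertexE; exact: (str_mul _ emI).
- move=> c a /ordE[i ->]; rewrite !win_vertexE; exact: str_cell.
- move=> y [j jN wy]; rewrite addn0 in jN.
  have wy' : y \in window scale cell stages (piece_of scale cell x).
    by apply/mem_set; exact: window_mono jN _ wy.
  pose y' : in_graph (win_input x) := SigSub wy'.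
  exists (e' y'); first by rewrite nE.
  by rewrite win_vertexE e'e.
- move=> d y z [j jN [D [pD CD] Dy]] yz.
  have pz := piece_of_pieces scale cell z.
  have zz := piece_of_mem scale cell z.
  have [e|ne] := pselect (D = piece_of scale cell z).
    exists j; first by apply: leq_trans jN; rewrite leq_add2l.
    by exists (piece_of scale cell z) => //; split => //; rewrite -e.
  exists (j + 1); first by rewrite addn1 addSnnS.
  exists (piece_of scale cell z) => //; split => //; apply: dist_le_trans CD _.
  exists [:: piece_of scale cell z]; split => //=; rewrite andbT; apply/asboolP.
  by split => //; exists y, z.
- move=> d y z [j jN [D [pD CD] Dy]] yz; exists j => //; exists D => //.
  by rewrite (pieces_piece_of pD Dy).
Qed.

Definition win_index (x y : G) : nat :=
  find (fun a => `[< win_vertex x a = y >]) (iota 0 (sz (win_str x))).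

Lemma win_indexE x a : a < sz (win_str x) -> win_index x (win_vertex x a) = a.
Proof.
move=> an; apply: find_iotaP => //; first exact/asboolP.
move=> b ba; apply/asboolP => e; have bn := ltn_trans ba an.
by move: ba; rewrite (v_inj lt_lin (win_view x) bn an e) ltnn.
Qed.

Lemma win_indexP x y d : deep x d y ->
  win_index x y < sz (win_str x) /\ win_vertex x (win_index x y) = y.
Proof.
by move=> /(v_image (win_view x))[a an <-]; rewrite win_indexE.
Qed.

Lemma deep_self x d : d <= stages -> deep x d x.
Proof.
move=> dN; exists 0 => //; exists (piece_of scale cell x); last exact: piece_of_mem.
by split; [exact: piece_of_pieces|exists [::]].
Qed.

Lemma deep_adj x y d : d < stages -> adj x y -> deep x d y.
Proof.
move=> dN xy; apply: (v_dist (win_view x) (x := x)); first exact: deep_self.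
by exists [:: y]; rewrite /= xy.
Qed.

Lemma win_same x y z d : deep x d z -> deep y d z ->
  same_vertex (win_str x) (win_str y) (win_vertex x) (win_vertex y) (deep x) (deep y) d
    (win_index x z) (win_index y z).
Proof.
move=> Dx Dy; have [xn xz] := win_indexP Dx; have [yn yz] := win_indexP Dy.
by split; rewrite ?xz ?yz.
Qed.

Definition win_color (x y : G) (j : nat) : nat :=
  stage k p s (win_str x) s.+1 (win_index x x) (win_index x y) j.

Definition win_label (x : G) : HF := lab (win_str x) s.+1 (win_index x x).

Lemma win_mul x y : adj x y -> nmul (win_str x) (win_index x x) (win_index x y) = m x y.
Proof.
move=> xy; have [xn xx] := win_indexP (deep_self x (leq0n _)).
have [yn yy] := win_indexP (deep_adj (isT : 0 < stages) xy).
by rewrite (v_mul (win_view x)) // xx yy.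
Qed.

Lemma adj_mul x y j : j < m x y -> adj x y.
Proof. by have [_ _ ma _] := em => jm; rewrite ma; exact: leq_ltn_trans jm. Qed.

Lemma scale_large : ((gap k p s * s).+1).*2 < scale.
Proof. exact: ltnSn. Qed.

(** Both ends of the edge are deep enough in the windows of [x] and of [y], so the two windows
    compute the same color for it. *)
Lemma win_color_transfer x y j : adj x y ->
  win_color x y j = stage k p s (win_str y) s.+1 (win_index y x) (win_index y y) j.
Proof.
move=> xy; have yx : adj y x by rewrite adj_sym.
apply: (stage_transfer lt_lin scale_large) (win_view x) (win_view y) (leqnn _) _ _.
  by apply: win_same; [apply: deep_self|apply: deep_adj].
by apply: win_same; [apply: deep_adj|apply: deep_self].
Qed.

Lemma win_label_transfer x y : adj x y ->
  lab (win_str x) s.+1 (win_index x y) = win_label y.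
Proof.
move=> xy; have st : 3 < stages by rewrite /stages mulnS.
apply: (lab_transfer lt_lin scale_large _ (win_view x) (win_view y)).
by apply: win_same; [apply: deep_adj|apply: deep_self => //; exact: ltnW].
Qed.

Lemma win_color_proper : proper_edge_coloring m (k + p * s) win_color.
Proof.
have [msym _ _ _] := em.
have pr x := stage_proper (v_wf (win_view x)).
split => [x y j xy|x y j xy|x y z j l xy xz e].
- have axy := adj_mul xy; have [ps _ _] := pr y; rewrite win_color_transfer //; apply/esym.
  by apply: ps; rewrite win_mul 1?adj_sym // msym.
- by have [_ pk _] := pr x; apply: pk; rewrite win_mul // (adj_mul xy).
- have axy := adj_mul xy; have axz := adj_mul xz; have [_ _ pp] := pr x.
  have [||e1 ->] := pp _ _ _ _ _ _ _ e; rewrite ?win_mul //; split => //.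
  have [_ yy] := win_indexP (deep_adj (isT : 0 < stages) axy).
  have [_ zz] := win_indexP (deep_adj (isT : 0 < stages) axz).
  by rewrite -yy -zz e1.
Qed.

Lemma win_out x : stage_coloring lt_lin wit (algorithm k p s) stages x =
  out k p s (win_str x) (win_index x x).
Proof.
have [xn xx] := win_indexP (deep_self x (leq0n _)).
have nE : sz (win_str x) = projT1 (the_enum (win_input x)) by exact: str_sz.
have xn' : win_index x x < projT1 (the_enum (win_input x)) by rewrite -nE.
have e : win_enum x (Ordinal xn') = stage_vertex lt_lin wit stages x.
  by apply: val_inj; rewrite -win_vertexE.
exact: (@runE k p s (win_input x) _ _ (Ordinal xn')
  (SigSub (mem_set (stage_vertex_in lt_lin wit stages x))) (win_enum_inc x) e).
Qed.

Lemma win_codes : codes_edge_coloring m win_color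
  (stage_coloring lt_lin wit (algorithm k p s) stages).
Proof.
have [_ mp _ _] := em.
exists win_label; split.
  move=> x y z xy xz; have axy := adj_mul xy; have axz := adj_mul xz.
  rewrite -(win_label_transfer axy) -(win_label_transfer axz) => e.
  have [_ yy] := win_indexP (deep_adj (isT : 0 < stages) axy).
  have [_ zz] := win_indexP (deep_adj (isT : 0 < stages) axz).
  rewrite -yy -zz; congr win_vertex.
  by apply: (@lab_inj k p s _ (v_wf (win_view x)) (win_index x x)) e; rewrite win_mul.
move=> x; rewrite win_out /out; eexists; split; first by reflexivity.
have [xn xx] := win_indexP (deep_self x (leq0n _)).
have opE y j : adj x y -> out_pair k p s (win_str x) (win_index x x) (win_index x y) j =
    hpair (win_label y) (win_color x y j).
  by move=> xy; rewrite /out_pair win_label_transfer.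
move=> h; rewrite mem_hsetof; split => [/andP[_ /hasP[b bn /hasP[j _ /andP[jm /eqP ->]]]]|].
  rewrite mem_iota add0n in bn; have {bn} bn : b < sz (win_str x) by case/andP: bn.
  rewrite (v_mul (win_view x)) // xx in jm.
  exists (win_vertex x b), j; split => //.
  by rewrite -opE ?win_indexE //; exact: adj_mul jm.
move=> [y [j [jm ->]]]; have xy := adj_mul jm; rewrite -opE //.
have [yn _] := win_indexP (deep_adj (isT : 0 < stages) xy).
have jp : j < p := leq_trans jm (mp x y).
apply/andP; split.
  apply: leq_trans (leq_sum_term (fun b => \sum_(0 <= j < p) _) yn).
  exact: (@leq_sum_term _ (fun j => (out_pair k p s _ _ _ j).+1)).
apply/hasP; exists (win_index x y); first by rewrite mem_iota add0n yn.
by apply/hasP; exists j; rewrite ?mem_iota ?add0n // win_mul // jm eqxx.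
Qed.

End Windows.

Theorem theorem3p7 (k p s : nat) :
  ASI_c s (edge_coloring_problem k p (k + p * s)).
Proof.
exists (algorithm k p s); split; first exact: algorithm_computable.
exists (stages s), (scale k p s) => G [m [em cm]] lt lt_lin cell wit.
exists m, (win_color lt_lin wit); split => //.
  exact: win_color_proper.
exact: win_codes.
Qed.
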